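(* Let $\ell>0$, and let $$\mathcal{T}_{(\ell)}(t)=\frac{1}{2\ell\sqrt{\pi}}\,e^{-\frac{t^2}{4\ell^2}}\quad(t\in\mathbb{R}),\qquad \mathcal{E}_{(\ell)}(\mathbf{x})=\frac{1}{(2\ell\sqrt{\pi})^3}\,e^{-\frac{|\mathbf{x}|^2}{4\ell^2}}\quad(\mathbf{x}\in\mathbb{R}^3).$$ Let $\Phi_{\mu\nu}$ ($\mu,\nu=0,\dots,3$) be regular tempered distributions on $\mathbb{R}^4$, and let $h_{\mu\nu}$ be regular tempered distributions on $\mathbb{R}^4$ satisfying $$h_{\mu\nu}=\mathcal{E}_{(\ell)}\ast\Phi_{\mu\nu}.$$ Then the action of the operator $a(\Box)=\exp[-\ell^2\Box]$ on $h_{\mu\nu}$ is represented by the convolution $$a(\Box)h_{\mu\nu}=\mathcal{T}_{(\ell)}\ast\Phi_{\mu\nu}$$ as an equality in $\mathcal{S}^\prime(\mathbb{R}^4)$.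
   Context: Points of $\mathbb{R}^4$ are written $(t,\mathbf{x})\in\mathbb{R}\times\mathbb{R}^3$ and dual variables $(\omega,\mathbf{k})$; the Minkowski metric is $\mathrm{diag}(-1,1,1,1)$, so $\Box=-\partial_t^2+\Delta_{\mathbf{x}}$. $\mathcal{S}^\prime(\mathbb{R}^n)$ is the space of tempered distributions. A regular tempered distribution on $\mathbb{R}^n$ is one given by a locally integrable function $f$ of slow growth, i.e. $\int_{\mathbb{R}^n}|f(x)|(1+|x|^2)^{-s/2}\,dx<\infty$ for some $s\ge 0$. Fourier convention: $\tilde g(\omega,\mathbf{k})=\mathcal{F}[g](\omega,\mathbf{k})=\int_{\mathbb{R}^4} g(t,\mathbf{x})\,e^{-i(\omega t+\mathbf{k}\cdot\mathbf{x})}\,dt\,d\mathbf{x}$, with inverse carrying the factor $(2\pi)^{-4}$, both extended to $\mathcal{S}^\prime(\mathbb{R}^4)$ by duality. The convolution with $\mathcal{E}_{(\ell)}$ acts only in the spatial variable and that with $\mathcal{T}_{(\ell)}$ only in the time variable: $(\mathcal{E}_{(\ell)}\ast\Phi)(t,\mathbf{x})=\int_{\mathbb{R}^3}\mathcal{E}_{(\ell)}(\mathbf{x}-\mathbf{x}^\prime)\Phi(t,\mathbf{x}^\prime)\,d\mathbf{x}^\prime$ and $(\mathcal{T}_{(\ell)}\ast\Phi)(t,\mathbf{x})=\int_{\mathbb{R}}\mathcal{T}_{(\ell)}(t-t^\prime)\Phi(t^\prime,\mathbf{x})\,dt^\prime$. The operator $a(\Box)=\exp[-\ell^2\Box]$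 acts on a regular tempered distribution $h$ by $$a(\Box)h=\mathcal{F}^{-1}\left[e^{-\ell^2\omega^2}e^{\ell^2|\mathbf{k}|^2}\,\tilde h\right],$$ whenever the product of the smooth function $e^{-\ell^2\omega^2}e^{\ell^2|\mathbf{k}|^2}$ with the distribution $\tilde h$ is a tempered distribution. *)

(* Defs.v *)
From HB Require Import structures.
From mathcomp Require Import all_boot all_order all_algebra.
From mathcomp Require Import all_classical all_reals all_analysis.
From mathcomp Require Export complex.

Set Implicit Arguments.
Unset Strict Implicit.
Unset Printing Implicit Defensive.

Import Order.TTheory GRing.Theory Num.Theory.
Import numFieldNormedType.Exports.
Import ComplexField.Normc.

Local Open Scope classical_set_scope.
Local Open Scope complex_scope.
Local Open Scope ring_scope.

Notation R3 R := (R * R * R)%type.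
(* A point of R4 is (t, x), or (omega, k) on the dual side. *)
Notation R4 R := (R * (R * R * R))%type.

(* The library's instance of this fact on [\x] is not found by unification:
   it is shadowed by the one for products of subprobabilities. *)
Lemma product_sigma_finite d1 d2 (T1 : measurableType d1)
    (T2 : measurableType d2) (R : realType)
    (m1 : {sigma_finite_measure set T1 -> \bar R})
    (m2 : {sigma_finite_measure set T2 -> \bar R}) :
  sigma_finite setT (m1 \x m2)%E.
Proof.
have /sigma_finiteP[F [TF ndF Foo]] := sigma_finiteT m1.
have /sigma_finiteP[G [TG ndG Goo]] := sigma_finiteT m2.
exists (fun n => F n `*` G n).
  rewrite -setXTT TF TG predeqE => -[x y]; split.
    move=> [/= [n _ Fnx] [k _ Gky]]; exists (maxn n k) => //; split.
    - by move: x Fnx; exact/subsetPset/ndF/leq_maxl.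
    - by move: y Gky; exact/subsetPset/ndG/leq_maxr.
  by move=> [n _ []/= ? ?]; split; exists n.
move=> k; have [? ?] := Foo k; have [? ?] := Goo k.
split; first exact: measurableX.
by rewrite product_measure1E// lte_mul_pinfty// ge0_fin_numE.
Qed.

Section Spacetime.
Variable R : realType.

Definition dot3 (x y : R3 R) : R :=
  x.1.1 * y.1.1 + x.1.2 * y.1.2 + x.2 * y.2.
(* Euclidean pairing omega t + k . x: the phase of the Fourier transform. *)
Definition dot4 (x y : R4 R) : R := x.1 * y.1 + dot3 x.2 y.2.

Definition basis4 (i : 'I_4) : R4 R :=
  ((i == 0%N :> nat)%:R,
   ((i == 1%N :> nat)%:R, (i == 2%N :> nat)%:R, (i == 3%N :> nat)%:R)).

Local Notation mR := (measurableTypeR R).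

Definition leb1 : set mR -> \bar R := @lebesgue_measure R.
HB.instance Definition _ := Measure.on leb1.
HB.instance Definition _ := SigmaFiniteMeasure.on leb1.

Definition leb2 : set (mR * mR)%type -> \bar R := (leb1 \x leb1)%E.
HB.instance Definition _ := Measure.on leb2.
HB.instance Definition _ := Measure_isSigmaFinite.Build _ _ _ leb2
  (product_sigma_finite leb1 leb1).

Definition leb3 : set (R3 mR) -> \bar R := (leb2 \x leb1)%E.
HB.instance Definition _ := Measure.on leb3.
HB.instance Definition _ := Measure_isSigmaFinite.Build _ _ _ leb3
  (product_sigma_finite leb2 leb1).

Definition leb4 : set (R4 mR) -> \bar R := (leb1 \x leb3)%E.
HB.instance Definition _ := Measure.on leb4.
HB.instance Definition _ := Measure_isSigmaFinite.Build _ _ _ leb4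
  (product_sigma_finite leb1 leb3).

Definition Cintegral d (T : measurableType d) (mu : {measure set T -> \bar R})
    (f : T -> R[i]) : R[i] :=
  (\int[mu]_x complex.Re (f x)) +i* (\int[mu]_x complex.Im (f x)).

Definition expi (theta : R) : R[i] := cos theta +i* sin theta.

(* The multi-index derivative is indexed by the list of the coordinates in
   which one differentiates. *)
Definition partial (s : seq 'I_4) (g : R4 R -> R) : R4 R -> R :=
  foldr (fun i k x => 'D_(basis4 i) k x) g s.

Definition partialC (s : seq 'I_4) (f : R4 R -> R[i]) (x : R4 R) : R[i] :=
  partial s (fun y => complex.Re (f y)) x +i*
  partial s (fun y => complex.Im (f y)) x.

Definition smoothR (g : R4 R -> R) : Prop :=
  forall s : seq 'I_4, continuous (partial s g) /\
    forall (i : 'I_4) x, derivable (partial s g) x (basis4 i).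

Definition smooth (f : R4 R -> R[i]) : Prop :=
  smoothR (fun x => complex.Re (f x)) /\ smoothR (fun x => complex.Im (f x)).

Definition schwartz (f : R4 R -> R[i]) : Prop :=
  smooth f /\
  forall (n : nat) (s : seq 'I_4), exists C : R, forall x : R4 R,
    (1 + dot4 x x) ^+ n * normc (partialC s f x) <= C.

Definition test_function (f : R4 R -> R[i]) : Prop :=
  smooth f /\ compact (closure [set x : R4 R | f x != 0]).

(* These norms increase with n and generate the topology of the Schwartz
   space. *)
Definition schwartz_norm (n : nat) (f : R4 R -> R[i]) : R :=
  sup [set r | exists (s : seq 'I_4) (x : R4 R), (size s <= n)%N /\
               r = (1 + dot4 x x) ^+ n * normc (partialC s f x)].

(* A functional is a total function; only its values on Schwartz functions
   are meaningful, and equality of distributions is [eq_distr]. *)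
Definition functional : Type := (R4 R -> R[i]) -> R[i].

Definition eq_distr (u v : functional) : Prop :=
  forall f, schwartz f -> u f = v f.

Definition tempered (u : functional) : Prop :=
  (forall (a : R[i]) f g, schwartz f -> schwartz g ->
     u (fun x => a * f x + g x) = a * u f + u g) /\
  (forall f, schwartz f -> forall e : R, 0 < e ->
     exists (n : nat) (delta : R), 0 < delta /\
       forall g, schwartz g ->
         schwartz_norm n (fun x => g x - f x) < delta ->
         normc (u g - u f) < e).

(* Measurability is with respect to the Borel sigma-algebra: every locally
   integrable class has such a representative. *)
Definition locally_integrable4 (f : R4 R -> R[i]) : Prop :=
  [/\ measurable_fun [set: R4 mR] (fun x => complex.Re (f x)),
      measurable_fun [set: R4 mR] (fun x => complex.Im (f x)) &
      forall K : set (R4 R), compact K ->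
        (\int[leb4]_(x in K) (normc (f x))%:E < +oo)%E].

Definition slow_growth (f : R4 R -> R[i]) : Prop :=
  exists s : R, 0 <= s /\
    (\int[leb4]_x (normc (f x) * (1 + dot4 x x) `^ (- s / 2))%:E < +oo)%E.

(* The density of a regular tempered distribution. *)
Definition regular_tempered (f : R4 R -> R[i]) : Prop :=
  locally_integrable4 f /\ slow_growth f.

Definition distr (f : R4 R -> R[i]) : functional :=
  fun phi => Cintegral leb4 (fun x => f x * phi x).

Definition fourier (f : R4 R -> R[i]) (xi : R4 R) : R[i] :=
  Cintegral leb4 (fun x => f x * expi (- dot4 xi x)).

Definition inv_fourier (f : R4 R -> R[i]) (x : R4 R) : R[i] :=
  (((2 * pi) ^+ 4)^-1)%:C * Cintegral leb4 (fun xi => f xi * expi (dot4 xi x)).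

Definition fourier_distr (u : functional) : functional :=
  fun phi => u (fourier phi).

Definition inv_fourier_distr (u : functional) : functional :=
  fun phi => u (inv_fourier phi).

(* [v] is the product of the smooth function [m] with [u], and is tempered.
   The product is a priori a distribution, defined on test functions only;
   these are dense in the Schwartz space, so [v] is unique up to
   [eq_distr]. *)
Definition tempered_product (m : R4 R -> R) (u v : functional) : Prop :=
  tempered v /\
  forall phi, test_function phi -> v phi = u (fun x => (m x)%:C * phi x).

Section Operators.
Variable l : R.

Definition a_symbol (xi : R4 R) : R :=
  expR (- (l ^+ 2 * xi.1 ^+ 2)) * expR (l ^+ 2 * dot3 xi.2 xi.2).

(* [w = a(Box) u], including that the action of a(Box) on [u] is defined. *)
Definition a_box_acts (u w : functional) : Prop :=
  exists v : functional,
    tempered_product a_symbol (fourier_distr u) v /\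
    eq_distr w (inv_fourier_distr v).

Definition T_kernel (t : R) : R :=
  (2 * l * Num.sqrt pi)^-1 * expR (- (t ^+ 2 / (4 * l ^+ 2))).

Definition E_kernel (x : R3 R) : R :=
  ((2 * l * Num.sqrt pi) ^+ 3)^-1 * expR (- (dot3 x x / (4 * l ^+ 2))).

End Operators.

Definition time_conv (k : R -> R) (f : R4 R -> R[i]) (x : R4 R) : R[i] :=
  Cintegral leb1 (fun t' => (k (x.1 - t'))%:C * f (t', x.2)).

Definition space_conv (k : R3 R -> R) (f : R4 R -> R[i]) (x : R4 R) : R[i] :=
  Cintegral leb3 (fun x' : R3 R => (k (x.2 - x'))%:C * f (x.1, x')).

End Spacetime.

(* Main.v *)
(** Convolution with the spatial gaussian multiplies the Fourier transform by
    exp(-l^2 |k|^2), which cancels the growing factor exp(l^2 |k|^2) of the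
    symbol; the remaining exp(-l^2 omega^2) is the Fourier transform of the time
    gaussian. Tested on F phi, with phi smooth of compact support, this is Fubini:
    <T * Phi, F phi> and <E * Phi, F (a phi)> both equal
    <Phi, F (exp(-l^2 omega^2) phi)>. As E * Phi is only known to agree with h on
    Schwartz functions, one needs that F (a phi) is one. The product distribution
    is F (T * Phi), from which Fourier inversion on Schwartz functions gives back
    T * Phi.

    All transforms are reduced to the real ones
    g |-> \int g(x) cos(xi . x + th) dx, for which differentiation in xi, as well
    as multiplication by xi, shifts the phase th by pi/2. *)

Require Import Defs.
From HB Require Import structures.
From mathcomp Require Import all_boot all_order all_algebra.
From mathcomp Require Import all_classical all_reals all_analysis.
From mathcomp Require Import complex measurable_realfun ring lra.

Set Implicit Arguments.
Unset Strict Implicit.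
Unset Printing Implicit Defensive.

Import Order.TTheory GRing.Theory Num.Theory.
Import numFieldNormedType.Exports.
Import ComplexField.Normc.

Local Open Scope classical_set_scope.
Local Open Scope complex_scope.
Local Open Scope ring_scope.

(** What makes Fubini available is domination. A density of slow growth is integrable only against
    some [(1 + |x|^2)^-N]; Peetre's inequality carries this weight from a point to its translate at
    the cost of a power of the displacement, which the gaussian kernel absorbs. The same bound gives
    the slow growth of the convolutions. A convolution integral may still diverge on a null set of
    points, where its value is 0 by convention.

    The gaussian transform is computed once, on R4: the product of the two kernels is a scaled
    gaussian there, and setting one group of frequencies to zero isolates each kernel, because the
    other has mass one.

    Compact support of phi serves twice: it keeps the product with the growing symbol a test
    function, and it makes test functions stable under multiplication by coordinates, so that
    derivatives of their transforms are again such transforms. For general Schwartz functions only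
    the decay of the transform is established; it suffices for inversion and for the continuity of
    the functional. *)

Definition integ d (T : measurableType d) (R : realType) (mu : set T -> \bar R)
  (f : T -> R) := mu.-integrable setT (EFin \o f).

(** * Real-valued integrals *)

Section Integration.
Context d (T : measurableType d) (R : realType) (mu : {measure set T -> \bar R}).
Local Notation integ := (integ mu).

(* [fine] sends both infinities to 0; this makes [RintZ] below unconditional. *)
Lemma Rintegral_nonint (f : T -> R) : measurable_fun setT f -> ~ integ f ->
  \int[mu]_x f x = 0.
Proof.
move=> mf nif; rewrite /Rintegral;
  have mEf : measurable_fun setT (EFin \o f) by exact/measurable_EFinP.
rewrite integralE; set a := (X in (X - _)%E); set b := (X in (_ - X)%E).
have a0 : (0 <= a)%E by apply: integral_ge0.
have b0 : (0 <= b)%E by apply: integral_ge0.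
have abE : (\int[mu]_x `|(EFin \o f) x| = a + b)%E.
  rewrite -ge0_integralD//; last 2 first.
  - exact: measurable_funepos.
  - exact: measurable_funeneg.
  by apply: eq_integral => x _; rewrite -/((abse \o (EFin \o f)) x) fune_abse.
have : ~ (a + b < +oo)%E.
  by move=> ab; apply: nif; apply/integrableP; rewrite abE.
move: a0 b0; case: a {abE} => [a| |]; case: b => [b| |] //=.
by move=> _ _ []; rewrite -EFinD ltry.
Qed.

Lemma eq_Rint (f g : T -> R) : f =1 g -> \int[mu]_x f x = \int[mu]_x g x.
Proof. by move=> /funext->. Qed.

Lemma eq_integ (f g : T -> R) : f =1 g -> integ f -> integ g.
Proof. by move=> /funext->. Qed.

Lemma integM_neq0 (c : R) (f : T -> R) : c != 0 -> integ (fun x => c * f x) ->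
  integ f.
Proof.
move=> c0 i; have := @integrableZl _ _ _ mu setT measurableT c^-1 _ i.
by apply: eq_integrable => // x _ /=; rewrite -EFinM mulKf.
Qed.

Lemma integZ (c : R) (f : T -> R) : integ f -> integ (fun x => c * f x).
Proof.
move=> i; have := @integrableZl _ _ _ mu setT measurableT c _ i.
by apply: eq_integrable => // x _ /=; rewrite EFinM.
Qed.

Lemma integD (f g : T -> R) : integ f -> integ g -> integ (fun x => f x + g x).
Proof. by move=> i j; have := integrableD measurableT i j. Qed.

Lemma integB (f g : T -> R) : integ f -> integ g -> integ (fun x => f x - g x).
Proof. by move=> i j; have := integrableB measurableT i j. Qed.

Lemma integ_meas (f : T -> R) : integ f -> measurable_fun setT f.
Proof. by move=> /measurable_int/measurable_EFinP. Qed.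

Lemma integ_le (f g : T -> R) : measurable_fun setT f ->
  (forall x, `|f x| <= g x) -> integ g -> integ f.
Proof.
move=> mf fg; apply: le_integrable => //; first exact/measurable_EFinP.
by move=> x _ /=; rewrite lee_fin (le_trans (fg x))// ler_norm.
Qed.

Lemma integ_norm (f : T -> R) : integ f -> integ (fun x => `|f x|).
Proof. exact: integrable_norm. Qed.

Lemma Rint_le_norm (f g : T -> R) : measurable_fun setT f ->
  (forall x, `|f x| <= g x) -> integ g -> `|\int[mu]_x f x| <= \int[mu]_x g x.
Proof.
move=> mf fg ig; have i := integ_le mf fg ig.
apply: (le_trans (le_normr_Rintegral _ i)) => //.
by apply: le_Rintegral => // ; exact: integ_norm.
Qed.

(** If [c] is nonzero and [f] is not integrable, neither is [c * f], and both sides are 0. This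
    covers the inner integrals of a Fubini argument, whose integrands are integrable only almost
    everywhere. *)
Lemma RintZ (c : R) (f : T -> R) : measurable_fun setT f ->
  \int[mu]_x (c * f x) = c * \int[mu]_x f x.
Proof.
move=> mf; have [->|c0] := eqVneq c 0.
  rewrite mul0r; under eq_Rintegral do rewrite mul0r.
  by rewrite /Rintegral integral0.
have [i|i] := pselect (integ f); first exact: RintegralZl.
rewrite (Rintegral_nonint mf i) mulr0 Rintegral_nonint//.
  exact: measurable_funM.
by move=> /(integM_neq0 c0).
Qed.

Lemma RintD (f g : T -> R) : integ f -> integ g ->
  \int[mu]_x (f x + g x) = \int[mu]_x f x + \int[mu]_x g x.
Proof. by move=> i j; exact: RintegralD. Qed.

Lemma RintB (f g : T -> R) : integ f -> integ g ->
  \int[mu]_x (f x - g x) = \int[mu]_x f x - \int[mu]_x g x.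
Proof. by move=> i j; exact: RintegralB. Qed.

End Integration.
Arguments eq_Rint {d T R mu f} g.
Arguments eq_integ {d T R mu} f {g}.

(** * Mean value theorem and Taylor estimates *)

Section Taylor.
Variable R : realType.

(** Increments of both signs are covered, because the estimates feed two-sided difference quotients;
    a negative [h] uses the mean value theorem on [[h, 0]]. *)
Lemma mvt0 (f f' : R -> R) (h : R) :
  (forall s, `|s| <= `|h| -> is_derive s (1:R) f (f' s)) ->
  exists2 c, `|c| <= `|h| & f h - f 0 = f' c * h.
Proof.
move=> df; have [h0|h0] := leP 0 h.
  have [||c ch ->] := @MVT_segment _ f f' 0 h h0.
  - by move=> c; rewrite in_itv/= => /andP[c0 ch]; apply: df;
    rewrite !ger0_norm// ltW.
  - apply: derivable_within_continuous => s; rewrite in_itv/= => /andP[s0 sh].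
    by apply: ex_derive; apply: df; rewrite !ger0_norm.
  exists c; rewrite ?subr0//.
  by move: ch; rewrite in_itv/= => /andP[? ?]; rewrite !ger0_norm.
have [||c ch E] := @MVT_segment _ f f' h 0 (ltW h0).
- by move=> c; rewrite in_itv/= => /andP[c0 ch]; apply: df;
  rewrite !ler0_norm ?lerN2// ltW.
- apply: derivable_within_continuous => s; rewrite in_itv/= => /andP[s0 sh].
  by apply: ex_derive; apply: df; rewrite !ler0_norm ?lerN2// ltW.
exists c; last by rewrite -opprB E; ring.
move: ch; rewrite in_itv/= => /andP[? ?].
by rewrite !ler0_norm ?lerN2// ltW.
Qed.

(** Two mean values: [f h - f 0 = f' c * h] and [f' c - f' 0 = f'' s * c] with [|s| <= |c| <= |h|].
    The factor 1/2 of Taylor's formula is lost, which is harmless here. *)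
Lemma taylor1 (f f' f'' : R -> R) (h M : R) :
  (forall s, `|s| <= `|h| -> is_derive s (1:R) f (f' s)) ->
  (forall s, `|s| <= `|h| -> is_derive s (1:R) f' (f'' s)) ->
  (forall s, `|s| <= `|h| -> `|f'' s| <= M) ->
  `|f h - f 0 - h * f' 0| <= h ^+ 2 * M.
Proof.
move=> d1 d2 b.
have [c ch ->] := mvt0 d1.
have [s sc E] := @mvt0 f' f'' c (fun s sc => d2 s (le_trans sc ch)).
rewrite (_ : _ - _ = h * (f' c - f' 0)); last by ring.
rewrite E !normrM -(real_normK (num_real h)) expr2 -mulrA.
rewrite ler_wpM2l//.
have := b s (le_trans sc ch) => bs.
rewrite [leRHS]mulrC; exact: ler_pM.
Qed.

Lemma taylor_cos (a b : R) : `|cos (a + b) - cos a + b * sin a| <= b ^+ 2.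
Proof.
have := @taylor1 (fun s => cos (a + s)) (fun s => - sin (a + s)) (fun s => - cos
  (a + s)) b 1.
rewrite addr0 mulrN opprK mulr1; apply.
- move=> s _; apply: is_derive_eq; rewrite /GRing.scale/=; lra.
- move=> s _; apply: is_derive_eq; rewrite /GRing.scale/=; lra.
- by move=> s _; rewrite normrN ler_norml cos_geN1 cos_le1.
Qed.

Lemma cos_lip (a b : R) : `|cos (a + b) - cos a| <= `|b|.
Proof.
have [|c cb] := @mvt0 (fun s => cos (a + s)) (fun s => - sin (a + s)) b.
  move=> s _; apply: is_derive_eq; rewrite /GRing.scale/=; lra.
rewrite addr0 => ->; rewrite normrM normrN ler_piMl//.
by rewrite ler_norml sin_geN1 sin_le1.
Qed.

Lemma cos_norm1 (a : R) : `|cos a| <= 1.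
Proof. by rewrite ler_norml cos_geN1 cos_le1. Qed.

End Taylor.

(** * Borel measurability of continuous functions *)

Lemma continuous_comp_fun (S T U : topologicalType) (f : S -> T) (g : T -> U) :
  continuous f -> continuous g -> continuous (fun x => g (f x)).
Proof. by move=> cf cg x; exact: (continuous_comp (cf x) (cg (f x))). Qed.

(* Reconciles the product topology with the product sigma-algebra. *)
Definition measurable_basis d (T : measurableType d) (nb : T -> set (set T)) :=
  exists B : nat -> set T, (forall n, measurable (B n)) /\
    forall x U, nb x U -> exists n, B n x /\ B n `<=` U.

Lemma basis_prod d1 d2 (T1 : measurableType d1) (T2 : measurableType d2)
    (nb1 : T1 -> set (set T1)) (nb2 : T2 -> set (set T2)) :
  measurable_basis nb1 -> measurable_basis nb2 ->
  @measurable_basis _ (T1 * T2)%type (fun x => filter_prod (nb1 x.1) (nb2 x.2)).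
Proof.
move=> [B1 [m1 b1]] [B2 [m2 b2]].
(* Pairs of indices are numbered by [pickle]; a number that codes no pair gets the empty set. *)
exists (fun n => if unpickle n is Some ij then B1 ij.1 `*` B2 ij.2 else set0).
split=> [n|x U [[/= V W] [/b1[i [ix iV]] /b2[j [jx jW]]] VWU]].
  by case: unpickle => [[i j]|//] /=; exact: measurableX.
exists (pickle (i, j)); rewrite pickleK /=; split=> // y [yi yj].
by apply: VWU; split => /=; [exact: iV|exact: jW].
Qed.

Section Borel.
Variable R : realType.
Local Notation mR := (measurableTypeR R).

Lemma basis_R : @measurable_basis _ mR (fun x : R => nbhs x).
Proof.
exists (fun n => if @unpickle (rat * rat)%type n is Some pq
  then `]ratr pq.1 : R, ratr pq.2[%classic else set0).
split=> [n|x U].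
  by case: unpickle => [[i j]|//] /=.
move=> /nbhs_ballP[e /= e0 xU].
have [p] := @rat_in_itvoo R (x - e) x (ltac:(lra)).
have [q] := @rat_in_itvoo R x (x + e) (ltac:(lra)).
rewrite !in_itv/= => /andP[xq qe] /andP[ep px].
exists (pickle (p, q)); rewrite pickleK/=; split; first by rewrite in_itv/= px xq.
move=> y /=; rewrite in_itv/= => /andP[py yq]; apply: xU.
rewrite /ball/= ltr_norml; apply/andP; split; lra.
Qed.

Lemma basis_R3 : @measurable_basis _ (R3 mR) (fun x : R3 R => nbhs x).
Proof. exact: basis_prod (basis_prod basis_R basis_R) basis_R. Qed.

Lemma basis_R4 : @measurable_basis _ (R4 mR) (fun x : R4 R => nbhs x).
Proof. exact: basis_prod basis_R basis_R3. Qed.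

(** An open set is the union of the basis sets inside it; the others are replaced by the empty set,
    so that the union runs over all of [nat]. *)
Lemma open_measurable_basis d (T : measurableType d) (nb : T -> set (set T))
    (U : set T) : measurable_basis nb -> (forall x, U x -> nb x U) -> measurable U.
Proof.
move=> [B [mB bB]] UU.
rewrite (_ : U = \bigcup_n (if asbool (B n `<=` U) then B n else set0)).
  by apply: bigcupT_measurable => n; case: ifP.
apply/seteqP; split=> [x Ux|x [n _]]; last by case: ifPn => // /asboolP; apply.
have [n [nx nU]] := bB x U (UU x Ux).
by exists n => //; case: ifPn => // /asboolP.
Qed.

Lemma measurable_open4 (U : set (R4 R)) : open U -> measurable (U : set (R4 mR)).
Proof.
by move=> oU; apply: (open_measurable_basis basis_R4) => x Ux;
  exact: open_nbhs_nbhs.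
Qed.

Lemma measurable_cont4 (f : R4 R -> R) : continuous f ->
  measurable_fun [set: R4 mR] f.
Proof.
move=> cf; apply: (measurability _ (RGenOpens.measurableE R)) => //.
by move=> _ [_ [a [b ->]] <-]; rewrite setTI; apply: measurable_open4;
  move/continuousP : cf; apply.
Qed.

End Borel.

(** * Changes of variables *)

Section Scaling.
Variable R : realType.
Local Notation mR := (measurableTypeR R).
Local Open Scope ereal_scope.

(** The image of [mu] under [tau] is [c mu], expressed as a substitution rule. It is stated for
    nonnegative integrands so that Tonelli's theorem yields products; real integrands follow through
    their positive and negative parts. *)
Definition scales d (T : measurableType d) (mu : set T -> \bar R) (tau : T ->
  T) (c : R) :=
  measurable_fun setT tau /\
  forall f : T -> \bar R, measurable_fun setT f -> (forall x, 0 <= f x) ->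
    \int[mu]_x f (tau x) = c%:E * \int[mu]_x f x.

Lemma scales_prod d1 d2 (T1 : measurableType d1) (T2 : measurableType d2)
    (m1 : {sigma_finite_measure set T1 -> \bar R})
    (m2 : {sigma_finite_measure set T2 -> \bar R}) tau1 tau2 (c1 c2 : R) :
  (0 <= c1)%R -> (0 <= c2)%R -> scales m1 tau1 c1 -> scales m2 tau2 c2 ->
  scales (m1 \x m2) (fun x => (tau1 x.1, tau2 x.2)) (c1 * c2).
Proof.
move=> c10 c20 [mt1 s1] [mt2 s2]; split.
  by apply: measurable_fun_pair; exact: measurableT_comp.
move=> f mf f0.
have mft : measurable_fun setT (fun x : T1 * T2 => f (tau1 x.1, tau2 x.2)).
  apply: (measurableT_comp mf).
  by apply: measurable_fun_pair; exact: measurableT_comp.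
rewrite !fubini_tonelli1//= /fubini_F/=.
under eq_integral => x _.
  rewrite (s2 (fun y => f (tau1 x, y)))//;
    last exact: measurableT_comp mf (pair1_measurable _).
  over.
rewrite ge0_integralZl//=.
- rewrite (s1 (fun x => \int[m2]_y f (x, y))).
  + by rewrite muleA -EFinM mulrC.
  + exact: measurable_fun_fubini_tonelli_F.
  + by move=> x; exact: integral_ge0.
- apply: (measurableT_comp (f := fun x => \int[m2]_y f (x, y))) => //.
  exact: measurable_fun_fubini_tonelli_F.
- by move=> x _; exact: integral_ge0.
Qed.

Lemma scales1 (a c : R) : (0 < c)%R ->
  scales (@leb1 R) (fun x : mR => (a + c * x)%R) c^-1.
Proof.
move=> c0; have mt : measurable_fun [set: mR] (fun x : mR => (a + c * x)%R : mR).
  apply: measurable_funD => //; exact: measurable_funM.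
have ci0 : (0 <= c^-1)%R by rewrite invr_ge0 ltW.
split=> // f mf f0.
pose k : {nonneg R} := NngNum (ltW c0).
pose pf := measure_function_pushforward__canonical__measure_function_Measure
  (@leb1 R) mt.
(* By uniqueness of Lebesgue measure it is enough to compare half-open intervals: the preimage of
   []u, v]] is [](u - a) / c, (v - a) / c]], of length [(v - u) / c]. *)
have E A : measurable A -> lebesgue_measure A = mscale k pf A.
  apply: lebesgue_measure_unique => _ [[u v]] _ <-.
  transitivity (c%:E * lebesgue_measure (`]((u - a) / c)%R,
    ((v - a) / c)%R]%classic : set mR)).
    rewrite !lebesgue_measure_itv/= !lte_fin ltr_pM2r ?invr_gt0// ltrD2r.
    case: ifP => _; last by rewrite mule0.
    rewrite -!EFinD -EFinM; congr (_%:E); field; exact: lt0r_neq0.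
  rewrite /mscale/= /pf/= /pushforward; congr (_ * lebesgue_measure _).
  apply/seteqP; split=> x /=; rewrite !in_itv/= ltr_pdivrMr// ler_pdivlMr//.
    by rewrite ltrBlDl lerBrDl [(x * c)%R]mulrC.
  by rewrite ltrBlDl lerBrDl [(x * c)%R]mulrC.
have -> : \int[@leb1 R]_x f x = c%:E * \int[pf]_x f x.
  rewrite -(@ge0_integral_mscale _ _ _ pf _ measurableT k)//.
  by apply: eq_measure_integral => A mA _; exact: E.
rewrite muleA -EFinM mulVf ?lt0r_neq0// mul1e.
by rewrite (ge0_integral_pushforward mt).
Qed.

End Scaling.

(** * Fubini's theorem for real integrals *)

Section Fubini.
Context d1 d2 (T1 : measurableType d1) (T2 : measurableType d2) (R : realType).
Variables (m1 : {sigma_finite_measure set T1 -> \bar R})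
          (m2 : {sigma_finite_measure set T2 -> \bar R}).
Implicit Type f : T1 * T2 -> R.

(** Taking [fine] of the inner integral can only decrease its absolute value, an infinite one
    becoming 0. *)
Lemma integ_fubini_F f : integ (m1 \x m2)%E f ->
  integ m1 (fun x => \int[m2]_y f (x, y)).
Proof.
move=> i; have iF := integrable_fubini_F i.
apply: (le_integrable measurableT _ _ iF).
- apply/measurable_EFinP.
  exact: (measurableT_comp (@fine_measurable R _ measurableT) (measurable_int _
    iF)).
- by move=> x _ /=; rewrite /fubini_F/= /Rintegral; case: (integral _ _ _) => //=;
  rewrite normr0 leey.
Qed.

Lemma Rfubini1 f : integ (m1 \x m2)%E f ->
  \int[(m1 \x m2)%E]_z f z = \int[m1]_x \int[m2]_y f (x, y).
Proof.
move=> i; rewrite /Rintegral -integral12_prod_meas1//; congr fine.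
(* Almost every inner integral is finite, and there [fine] loses nothing. *)
have iF := integrable_fubini_F i.
apply: ae_eq_integral => //.
- exact: measurable_int iF.
- exact: measurable_int (integ_fubini_F i).
- apply: filterS (integrable_ae measurableT iF) => x fx _ /=.
  by rewrite fineK// fx.
Qed.

Lemma integ_swap f : integ (m1 \x m2)%E f -> integ (m2 \x m1)%E (fun z => f (z.2,
  z.1)).
Proof.
move=> i; have mf : measurable_fun setT (EFin \o f) by exact: measurable_int i.
have mg : measurable_fun setT (EFin \o (fun z : T2 * T1 => f (z.2, z.1))).
  by apply: (measurableT_comp mf); exact: measurable_fun_pair.
by apply/(integrable12ltyP _ _ mg); move/(integrable21ltyP _ _ mf) : i.
Qed.

Lemma integ_prod (f : T1 -> R) (g : T2 -> R) : integ m1 f -> integ m2 g ->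
  integ (m1 \x m2)%E (fun z => f z.1 * g z.2).
Proof.
move=> i j.
have mfg : measurable_fun setT (EFin \o (fun z : T1 * T2 => f z.1 * g z.2)).
  apply/measurable_EFinP; apply: measurable_funM.
    exact: measurableT_comp (integ_meas i) _.
  exact: measurableT_comp (integ_meas j) _.
apply/(integrable12ltyP _ _ mfg) => /=.
have /integrableP[_ /= jlt] := j; have /integrableP[_ /= ilt] := i.
under eq_integral => x _.
  under eq_integral => y _ do rewrite normrM EFinM.
  rewrite ge0_integralZl//; last by apply/measurable_EFinP;
    apply: measurableT_comp => //; exact: integ_meas j.
  over.
rewrite ge0_integralZr//.
- by rewrite lte_mul_pinfty// ?ge0_fin_numE//; exact: integral_ge0.
- by apply/measurable_EFinP; apply: measurableT_comp => //; exact: integ_meas i.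
- exact: integral_ge0.
Qed.

Lemma Rint_prod (f : T1 -> R) (g : T2 -> R) : integ m1 f -> integ m2 g ->
  \int[(m1 \x m2)%E]_z (f z.1 * g z.2) = (\int[m1]_x f x) * (\int[m2]_y g y).
Proof.
move=> i j; rewrite (Rfubini1 (integ_prod i j))/=.
rewrite (eq_Rint (fun x => (\int[m2]_y g y) * f x)).
  by rewrite (RintZ m1 _ (integ_meas i)) mulrC.
by move=> x; rewrite (RintZ m2 _ (integ_meas j)) mulrC.
Qed.

End Fubini.

Lemma Rfubini2 d1 d2 (T1 : measurableType d1) (T2 : measurableType d2) (R :
  realType)
    (m1 : {sigma_finite_measure set T1 -> \bar R})
    (m2 : {sigma_finite_measure set T2 -> \bar R}) (f : T1 * T2 -> R) :
  integ (m1 \x m2)%E f -> \int[(m1 \x m2)%E]_z f z = \int[m2]_y \int[m1]_x f (x, y).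
Proof.
move=> i; have j := integ_swap i; rewrite -(Rfubini1 j).
by rewrite /Rintegral -integral21_prod_meas1// -integral12_prod_meas1.
Qed.

Section ScalesReal.
Context d (T : measurableType d) (R : realType) (mu : {measure set T -> \bar R}).
Variables (tau : T -> T) (c : R).
Hypotheses (c0 : 0 < c) (s : scales mu tau c).

Lemma scales_integ (f : T -> R) : integ mu f -> integ mu (f \o tau).
Proof.
move: s => [mt st] /integrableP[mf fi]; apply/integrableP; split.
  exact: (measurableT_comp mf mt).
rewrite (st (fun x => `|(f x)%:E|%E))//; last exact: measurableT_comp.
by rewrite lte_mul_pinfty// lee_fin ltW.
Qed.

(** Substitution in the positive and negative parts separately; integrability makes both integrals
    finite, so that [fine] is compatible with their difference. *)
Lemma scales_Rint (f : T -> R) : integ mu f ->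
  \int[mu]_x f (tau x) = c * \int[mu]_x f x.
Proof.
move: s => [mt st] i; have mf := measurable_int _ i.
have ip := integral_funepos_lt_pinfty measurableT i.
have iq := integral_funeneg_lt_pinfty measurableT i.
have pf : (\int[mu]_x ((EFin \o f)^\+ x) \is a fin_num)%E.
  by rewrite ge0_fin_numE//; exact: integral_ge0.
have qf : (\int[mu]_x ((EFin \o f)^\- x) \is a fin_num)%E.
  by rewrite ge0_fin_numE//; exact: integral_ge0.
have Ep : (\int[mu]_x ((EFin \o f)^\+ (tau x)) = c%:E * \int[mu]_x ((EFin \o f)^\+
  x))%E.
  by apply: st => //; exact: measurable_funepos.
have En : (\int[mu]_x ((EFin \o f)^\- (tau x)) = c%:E * \int[mu]_x ((EFin \o f)^\-
  x))%E.
  by apply: st => //; exact: measurable_funeneg.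
have -> : \int[mu]_x f (tau x) = fine (\int[mu]_x ((EFin \o f)^\+ (tau x)) -
    \int[mu]_x ((EFin \o f)^\- (tau x)))%E.
  rewrite /Rintegral; congr fine;
    rewrite -[LHS]/(\int[mu]_x ((EFin \o f) \o tau) x)%E integralE.
  by rewrite funepos_comp funeneg_comp.
have -> : \int[mu]_x f x = fine (\int[mu]_x ((EFin \o f)^\+ x) -
    \int[mu]_x ((EFin \o f)^\- x))%E.
  by rewrite /Rintegral; congr fine; rewrite [LHS]integralE.
by rewrite Ep En -(fineK pf) -(fineK qf) -!EFinM -!EFinB /= mulrBr.
Qed.

End ScalesReal.

(** * Euclidean geometry of R4 and its weights *)

Section Spacetime.
Variable R : realType.
Local Notation mR := (measurableTypeR R).
Implicit Types (x y v xi : R4 R).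

Lemma scales3 (a : R3 R) (c : R) : 0 < c ->
  scales (@leb3 R) (fun x : R3 R => a + c *: x) (c ^+ 3)^-1.
Proof.
move=> c0; have ci0 : 0 <= c^-1 by rewrite invr_ge0 ltW.
rewrite -exprVn !exprSr expr0 mul1r.
have H2 := scales_prod (m1 := @leb1 R) (m2 := @leb1 R) ci0 ci0
  (scales1 a.1.1 c0) (scales1 a.1.2 c0).
exact: (scales_prod (m1 := @leb2 R) (m2 := @leb1 R)
  (mulr_ge0 ci0 ci0) ci0 H2 (scales1 a.2 c0)).
Qed.

Lemma scales4 (a : R4 R) (c : R) : 0 < c ->
  scales (@leb4 R) (fun x : R4 R => a + c *: x) (c ^+ 4)^-1.
Proof.
move=> c0; have ci0 : 0 <= c^-1 by rewrite invr_ge0 ltW.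
have ci3 : 0 <= (c ^+ 3)^-1 by rewrite invr_ge0 exprn_ge0// ltW.
rewrite exprS invfM.
exact: (scales_prod (m1 := @leb1 R) (m2 := @leb3 R) ci0 ci3
  (scales1 a.1 c0) (scales3 a.2 c0)).
Qed.

Lemma dot4C x y : dot4 x y = dot4 y x.
Proof. rewrite /dot4 /dot3; ring. Qed.

Lemma dot4Dl x y v : dot4 (x + y) v = dot4 x v + dot4 y v.
Proof. rewrite /dot4 /dot3 /=; ring. Qed.

Lemma dot4Zl (c : R) x v : dot4 (c *: x) v = c * dot4 x v.
Proof. rewrite /dot4 /dot3 /= /GRing.scale/=; ring. Qed.

Lemma dot4Dr x y v : dot4 v (x + y) = dot4 v x + dot4 v y.
Proof. by rewrite dot4C dot4Dl !(dot4C v). Qed.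

Lemma dot4Zr (c : R) x v : dot4 v (c *: x) = c * dot4 v x.
Proof. by rewrite dot4C dot4Zl (dot4C v). Qed.

(** The square of the Japanese bracket, the weight in which all growth and decay is measured. *)
Definition br x : R := 1 + dot4 x x.

Lemma dot4_ge0 x : 0 <= dot4 x x.
Proof. by rewrite /dot4 /dot3; repeat apply: addr_ge0; rewrite -expr2 sqr_ge0. Qed.

Lemma br_ge1 x : 1 <= br x.
Proof. by rewrite lerDl dot4_ge0. Qed.

Lemma br_gt0 x : 0 < br x.
Proof. exact: lt_le_trans (br_ge1 x). Qed.

Lemma brX_gt0 n x : 0 < br x ^+ n.
Proof. by rewrite exprn_gt0// br_gt0. Qed.

(** Lagrange's identity: the difference is the sum of the squares of the six 2 by 2 minors. *)
Lemma dot4_cs x y : dot4 x y ^+ 2 <= dot4 x x * dot4 y y.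
Proof.
rewrite -subr_ge0 /dot4 /dot3.
case: x => a [[b c] d]; case: y => a' [[b' c'] d'] /=.
rewrite (_ : _ - _ = (a * b' - b * a') ^+ 2 + (a * c' - c * a') ^+ 2 + (a * d' - d
  * a') ^+ 2
  + (b * c' - c * b') ^+ 2 + (b * d' - d * b') ^+ 2 + (c * d' - d * c') ^+ 2);
    last by ring.
by repeat apply: addr_ge0; rewrite sqr_ge0.
Qed.

(** The first factor is kept sharp because it vanishes with [x]: it becomes the modulus of
    continuity in [ct_lip]. *)
Lemma dot4_le_sqrt x y : `|dot4 x y| <= Num.sqrt (dot4 x x) * br y.
Proof.
rewrite -sqrtr_sqr (le_trans (y := Num.sqrt (dot4 x x * br y ^+ 2)))//.
  rewrite ler_sqrt ?mulr_ge0 ?dot4_ge0 ?exprn_ge0 ?(ltW (br_gt0 _))//.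
  apply: (le_trans (dot4_cs x y)); apply: ler_wpM2l; first exact: dot4_ge0.
  by have := br_ge1 y; have := dot4_ge0 y; rewrite /br => *; nra.
by rewrite sqrtrM ?dot4_ge0// sqrtr_sqr ger0_norm// ltW// br_gt0.
Qed.

Lemma dot4_le_br x y : `|dot4 x y| <= br x * br y.
Proof.
apply: (le_trans (dot4_le_sqrt x y)); rewrite ler_wpM2r ?(ltW (br_gt0 _))//.
rewrite (le_trans (y := Num.sqrt (br x ^+ 2)))//.
  rewrite ler_sqrt ?exprn_ge0 ?(ltW (br_gt0 _))//.
  by have := br_ge1 x; have := dot4_ge0 x; rewrite /br => *; nra.
by rewrite sqrtr_sqr ger0_norm// ltW// br_gt0.
Qed.

(** Peetre's inequality, from [2 x . y <= |x|^2 + |y|^2]. It moves weights through translations and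
    convolutions. *)
Lemma peetre x y : br (x + y) <= 2 * br x * br y.
Proof.
rewrite /br !dot4Dl !dot4Dr.
have E : 0 <= dot4 (x - y) (x - y) by exact: dot4_ge0.
have := dot4_ge0 x; have := dot4_ge0 y.
move: E; rewrite -scaleN1r !dot4Dl !dot4Dr !dot4Zl !dot4Zr (dot4C y x) => *; nra.
Qed.

Lemma continuous_dot4 (f g : R4 R -> R4 R) : continuous f -> continuous g ->
  continuous (fun x => dot4 (f x) (g x)).
Proof.
move=> cf cg x; rewrite /dot4 /dot3.
have c1 (h : R4 R -> R4 R) : continuous h -> {for x, continuous (fun x => (h x).1)}.
  by move=> ch; apply: cvg_comp (ch x) _; exact: cvg_fst.
have c2 (h : R4 R -> R4 R) : continuous h -> {for x, continuous (fun x => (h x).2)}.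
  by move=> ch; apply: cvg_comp (ch x) _; exact: cvg_snd.
have c3 (h : R4 R -> R4 R) : continuous h -> {for x,
  continuous (fun x => (h x).2.1)}.
  by move=> ch; apply: cvg_comp (c2 _ ch) _; exact: cvg_fst.
have c4 (h : R4 R -> R4 R) : continuous h -> {for x,
  continuous (fun x => (h x).2.2)}.
  by move=> ch; apply: cvg_comp (c2 _ ch) _; exact: cvg_snd.
have c5 (h : R4 R -> R4 R) : continuous h -> {for x,
  continuous (fun x => (h x).2.1.1)}.
  by move=> ch; apply: cvg_comp (c3 _ ch) _; exact: cvg_fst.
have c6 (h : R4 R -> R4 R) : continuous h -> {for x,
  continuous (fun x => (h x).2.1.2)}.
  by move=> ch; apply: cvg_comp (c3 _ ch) _; exact: cvg_snd.
rewrite /continuous_at; apply: cvgD; [|apply: cvgD; [apply: cvgD|]]; apply: cvgM.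
- exact: c1.
- exact: c1.
- exact: c5.
- exact: c5.
- exact: c6.
- exact: c6.
- exact: c4.
- exact: c4.
Qed.

Lemma continuous_dotl v : continuous (dot4 v).
Proof. by apply: continuous_dot4 => [x|x]; [exact: cvg_cst|exact: cvg_id]. Qed.

Lemma continuous_br : continuous br.
Proof.
move=> x; apply: cvgD; first exact: cvg_cst.
by apply: continuous_dot4 => y; exact: cvg_id.
Qed.

Lemma continuous_brX n : continuous (fun x => br x ^+ n).
Proof. exact: (continuous_comp_fun continuous_br (@exprn_continuous R n)). Qed.

Lemma measurable_dot4 d (T : measurableType d) (f g : T -> R4 mR) :
  measurable_fun setT f -> measurable_fun setT g ->
  measurable_fun setT (fun t => dot4 (f t) (g t)).
Proof.
move=> mf mg.
have m1 (h : T -> R4 mR) : measurable_fun setT h ->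
  measurable_fun setT (fun t => (h t).1).
  by move=> mh; exact: (measurableT_comp (@measurable_fst _ _ _ _) mh).
have m2 (h : T -> R4 mR) : measurable_fun setT h ->
  measurable_fun setT (fun t => (h t).2).
  by move=> mh; exact: (measurableT_comp (@measurable_snd _ _ _ _) mh).
have m3 (h : T -> R4 mR) : measurable_fun setT h ->
  measurable_fun setT (fun t => (h t).2.1).
  by move=> mh; exact: (measurableT_comp (@measurable_fst _ _ _ _) (m2 _ mh)).
have m4 (h : T -> R4 mR) : measurable_fun setT h ->
  measurable_fun setT (fun t => (h t).2.2).
  by move=> mh; exact: (measurableT_comp (@measurable_snd _ _ _ _) (m2 _ mh)).
have m5 (h : T -> R4 mR) : measurable_fun setT h ->
  measurable_fun setT (fun t => (h t).2.1.1).
  by move=> mh; exact: (measurableT_comp (@measurable_fst _ _ _ _) (m3 _ mh)).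
have m6 (h : T -> R4 mR) : measurable_fun setT h ->
  measurable_fun setT (fun t => (h t).2.1.2).
  by move=> mh; exact: (measurableT_comp (@measurable_snd _ _ _ _) (m3 _ mh)).
rewrite /dot4 /dot3; apply: measurable_funD.
  by apply: measurable_funM; exact: m1.
apply: measurable_funD.
  apply: measurable_funD; apply: measurable_funM;
    [exact: m5|exact: m5|exact: m6|exact: m6].
by apply: measurable_funM; exact: m4.
Qed.

Lemma measurable_cosdot4 d (T : measurableType d) (f g : T -> R4 mR) (th : R) :
  measurable_fun setT f -> measurable_fun setT g ->
  measurable_fun setT (fun t => cos (dot4 (f t) (g t) + th)).
Proof.
move=> mf mg; apply: (measurableT_comp (continuous_measurable_fun (@continuous_cos
  R))).
by apply: measurable_funD => //; exact: measurable_dot4.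
Qed.

Lemma integ_cauchy : integ (@leb1 R) (fun x : mR => (1 + x ^+ 2)^-1).
Proof.
have cc : continuous (fun x : R => (1 + x ^+ 2)^-1) by exact: continuous_oneDsqrV.
have E : (\int[@leb1 R]_x ((1 + x ^+ 2)^-1)%:E = pi%:E)%E.
  rewrite /leb1 ge0_symfun_integralT//=.
  - rewrite (_ : [set x | _] = `[0, +oo[%classic); last first.
      by apply/seteqP; split => x/=; rewrite in_itv/= andbT.
    by rewrite (@integral0y_oneDsqr R) -EFinM mulrCA divff// mulr1.
  - by move=> x; rewrite invr_ge0 addr_ge0// sqr_ge0.
  - by move=> x/=; rewrite sqrrN.
apply/integrableP; split.
  by apply/measurable_EFinP; exact: (continuous_measurable_fun cc).
under eq_integral => x _ /=.
  rewrite ger0_norm ?invr_ge0 ?addr_ge0 ?sqr_ge0//; over.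
by rewrite E ltry.
Qed.

(** Each of the four factors [br x] dominates one [1 + x_i^2], which leaves a product of four Cauchy
    densities. This is the origin of the exponent 4 in the later bounds. *)
Lemma integ_wt : integ (@leb4 R) (fun x => (br x ^+ 4)^-1).
Proof.
have i1 := integ_cauchy.
have i2 := integ_prod (m1 := @leb1 R) (m2 := @leb1 R) i1 i1.
have i3 := integ_prod (m1 := @leb2 R) (m2 := @leb1 R) i2 i1.
have i4 := integ_prod (m1 := @leb1 R) (m2 := @leb3 R) i1 i3.
apply: integ_le i4.
  apply: measurable_cont4 => x; apply: cvgV; last exact: continuous_brX.
  by rewrite lt0r_neq0// brX_gt0.
move=> x /=; rewrite ger0_norm ?invr_ge0 ?(ltW (brX_gt0 _ _))//.
have P (t : R) : 0 < 1 + t ^+ 2 by rewrite (lt_le_trans ltr01)// lerDl sqr_ge0.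
rewrite -!invfM lef_pV2 ?posrE ?brX_gt0// ?mulr_gt0 ?P//.
case: x => a [[b c] d] /=.
set s := br _; have sE : s = 1 + (a ^+ 2 + (b ^+ 2 + c ^+ 2 + d ^+ 2)).
  by rewrite /s /br /dot4 /dot3 /=; ring.
rewrite (_ : s ^+ 4 = s * (s * s * s)); last by ring.
have ha := sqr_ge0 a; have hb := sqr_ge0 b; have hc := sqr_ge0 c; have hd :=
  sqr_ge0 d.
have sa : 1 + a ^+ 2 <= s by rewrite sE; lra.
have sb : 1 + b ^+ 2 <= s by rewrite sE; lra.
have sc : 1 + c ^+ 2 <= s by rewrite sE; lra.
have sd : 1 + d ^+ 2 <= s by rewrite sE; lra.
have pa : 0 <= 1 + a ^+ 2 by lra.
have pb : 0 <= 1 + b ^+ 2 by lra.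
have pc : 0 <= 1 + c ^+ 2 by lra.
have pd : 0 <= 1 + d ^+ 2 by lra.
apply: ler_pM => //; first by rewrite !mulr_ge0.
apply: ler_pM => //; first by rewrite !mulr_ge0.
exact: ler_pM.
Qed.

End Spacetime.

(** A quadratic remainder determines the derivative. In this form it applies to parameter integrals,
    whose remainder is bounded under the integral sign. *)
Lemma is_derive_quad (R : realType) (V : normedModType R) (f : V ->
  R) (x v : V) (d C : R) :
  (forall h, `|h| <= 1 -> `|f (x + h *: v) - f x - h * d| <= h ^+ 2 * C) ->
  is_derive x v f d.
Proof.
move=> Hf.
have C0 : 0 <= C.
  by have := Hf 1; rewrite normr1 expr1n !mul1r => /(_ (lexx _));
    exact: (le_trans (normr_ge0 _)).
suff cv : h^-1 *: ((f \o shift x) (h *: v) - f x) @[h --> 0^'] --> d.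
  by apply: DeriveDef; [apply/cvg_ex; exists d|exact: cvg_lim cv].
apply/cvgrPdist_le => e e0; near=> h.
have h0 : h != 0 by near: h; exact: nbhs_dnbhs_neq.
have hn : 0 < `|h| by rewrite normr_gt0.
have h1 : `|h| <= 1.
  by near: h; apply: dnbhs0_le.
have h2 : `|h| * C <= e.
  have : `|h| <= e / (C + 1) by near: h; apply: dnbhs0_le;
    rewrite divr_gt0// ltr_wpDl.
  rewrite ler_pdivlMr ?ltr_wpDl// mulrDr mulr1; apply: le_trans.
  by rewrite lerDl.
have := Hf h h1.
rewrite /= /shift/= [h *: v + x]addrC -(real_normK (num_real h)) expr2 -mulrA => H.
have -> : d - h^-1 *: (f (x + h *: v) - f x) = - (h^-1 * (f (x + h *: v) - f x - h
  * d)).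
  by rewrite /GRing.scale/=; field.
rewrite normrN normrM normfV ler_pdivrMl//.
by apply: (le_trans H); rewrite ler_pM2l.
Unshelve. all: by end_near. Qed.

(** * The real Fourier transform of rapidly decreasing functions *)

Section Rapid.
Variable R : realType.
Local Notation mR := (measurableTypeR R).
Implicit Types (x y v xi : R4 R) (g : R4 R -> R).

(** Decay without smoothness: what the transform needs in order to be defined and differentiated
    under the integral sign. *)
Definition rapid g := measurable_fun [set: R4 mR] g /\
  forall n, exists C, forall x, br x ^+ n * `|g x| <= C.

Lemma rapid_bound g n : rapid g ->
  exists2 C, 0 <= C & forall x, `|g x| <= C * (br x ^+ n)^-1.
Proof.
move=> [_ /(_ n)[C gC]]; exists C.
  by apply: le_trans (gC 0); rewrite mulr_ge0// ltW// brX_gt0.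
by move=> x; rewrite ler_pdivlMr ?brX_gt0// mulrC.
Qed.

Lemma rapid_integ g : rapid g -> integ (@leb4 R) g.
Proof.
move=> rg; have [C C0 gC] := rapid_bound 4 rg.
exact: integ_le rg.1 gC (integZ C (@integ_wt R)).
Qed.

Lemma rapid_mul (q : R4 R -> R) g (K : R) m : measurable_fun [set: R4 mR] q ->
  (forall x, `|q x| <= K * br x ^+ m) -> rapid g -> rapid (fun x => q x * g x).
Proof.
move=> mq qK [mg gC]; split; first exact: measurable_funM.
move=> n; have [C HC] := gC (n + m)%N; exists (K * C) => x.
have K0 : 0 <= K.
  by have := le_trans (normr_ge0 _) (qK 0); rewrite pmulr_lge0// brX_gt0.
rewrite normrM mulrCA (le_trans (ler_wpM2r _ (qK x)))//.
  by rewrite mulr_ge0// ltW// brX_gt0.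
rewrite -mulrA ler_wpM2l// mulrA -exprD addnC; exact: HC.
Qed.

Lemma rapidZ (c : R) g : rapid g -> rapid (fun x => c * g x).
Proof.
apply: (@rapid_mul _ _ `|c| 0) => // x.
by rewrite expr0 mulr1.
Qed.

Lemma rapid_dot v g : rapid g -> rapid (fun x => dot4 v x * g x).
Proof.
apply: (@rapid_mul _ _ (br v) 1).
  exact: measurable_cont4 (@continuous_dotl R v).
by move=> x; rewrite expr1 dot4_le_br.
Qed.

Lemma rapidD f g : rapid f -> rapid g -> rapid (fun x => f x + g x).
Proof.
move=> [mf fC] [mg gC]; split; first exact: measurable_funD.
move=> n; have [C HC] := fC n; have [D HD] := gC n; exists (C + D) => x.
rewrite (le_trans _ (lerD (HC x) (HD x)))// -mulrDr ler_wpM2l ?ler_normD//.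
by rewrite ltW// brX_gt0.
Qed.

Lemma rapid_br n g : rapid g -> rapid (fun x => br x ^+ n * g x).
Proof.
apply: (@rapid_mul _ _ 1 n).
  exact: measurable_cont4 (@continuous_brX R n).
by move=> x; rewrite mul1r ger0_norm// ltW// brX_gt0.
Qed.

(* With the phases [th = 0] and [th = pi / 2] this real transform gives the
   cosine transform and minus the sine transform. *)
Definition ct g (th : R) xi := \int[@leb4 R]_x (g x * cos (dot4 xi x + th)).

Lemma continuous_cosphase xi (th : R) : continuous (fun x => cos (dot4 xi x + th)).
Proof.
apply: continuous_comp_fun (@continuous_cos R) => x.
by apply: cvgD; [exact: continuous_dotl|exact: cvg_cst].
Qed.

Lemma measurable_cosphase xi (th : R) :
  measurable_fun [set: R4 mR] (fun x => cos (dot4 xi x + th)).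
Proof. exact: measurable_cont4 (@continuous_cosphase xi th). Qed.

Lemma integ_ct g th xi : integ (@leb4 R) g ->
  integ (@leb4 R) (fun x => g x * cos (dot4 xi x + th)).
Proof.
move=> ig; apply: integ_le (integ_norm ig).
  apply: measurable_funM; first exact: integ_meas ig.
  exact: measurable_cosphase.
by move=> x; rewrite normrM ler_piMr// cos_norm1.
Qed.

Lemma ct_bound g th xi : integ (@leb4 R) g ->
  `|ct g th xi| <= \int[@leb4 R]_x `|g x|.
Proof.
move=> ig; apply: Rint_le_norm (integ_norm ig).
  exact: integ_meas (integ_ct _ _ ig).
by move=> x; rewrite normrM ler_piMr// cos_norm1.
Qed.

Lemma ctD f g th xi : integ (@leb4 R) f -> integ (@leb4 R) g ->
  ct (fun x => f x + g x) th xi = ct f th xi + ct g th xi.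
Proof.
move=> i j; rewrite /ct -RintegralD//; [|exact: integ_ct|exact: integ_ct].
by apply: eq_Rint => x; rewrite mulrDl.
Qed.

Lemma ctZ (c : R) g th xi : integ (@leb4 R) g ->
  ct (fun x => c * g x) th xi = c * ct g th xi.
Proof.
move=> i; rewrite /ct -RintZ; last exact: integ_meas (integ_ct _ _ i).
by apply: eq_Rint => x; rewrite mulrA.
Qed.

(** The cosine is 1-Lipschitz and the phase moves by [eta . x], so the integral of [br x * |g x|] is
    a Lipschitz constant, uniform in [th] and [xi]. *)
Lemma ct_lip g : rapid g -> exists2 C, 0 <= C & forall th xi eta,
  `|ct g th (xi + eta) - ct g th xi| <= C * Num.sqrt (dot4 eta eta).
Proof.
move=> rg; have ig := rapid_integ rg.
have ib : integ (@leb4 R) (fun x => `|br x ^+ 1 * g x|).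
  exact: integ_norm (rapid_integ (rapid_br 1 rg)).
exists (\int[@leb4 R]_x `|br x ^+ 1 * g x|).
  by apply: Rintegral_ge0.
move=> th xi eta; rewrite /ct -RintegralB//; [|exact: integ_ct|exact: integ_ct].
rewrite mulrC -RintZ; last exact: integ_meas ib.
apply: Rint_le_norm.
- exact: integ_meas (integB (integ_ct _ _ ig) (integ_ct _ _ ig)).
- move=> x; rewrite -mulrBr normrM expr1 normrM (gtr0_norm (br_gt0 _)) mulrA mulrC.
  rewrite ler_wpM2r// dot4Dl addrAC (le_trans (cos_lip _ _))// dot4_le_sqrt//.
- exact: integZ.
Qed.

Lemma continuous_ct g th : rapid g -> continuous (ct g th).
Proof.
move=> rg; suff H (xi : R4 R) : {for xi, continuous (ct g th)} by move=> xi;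
  exact: H.
have [C C0 HC] := ct_lip rg.
apply/cvgrPdist_le => e e0.
have cq : continuous (fun eta : R4 R => C * Num.sqrt (dot4 (eta - xi) (eta - xi))).
  have c1 : continuous (fun eta : R4 R => eta - xi).
    by move=> y; apply: cvgB; [exact: cvg_id|exact: cvg_cst].
  have c2 := continuous_comp_fun (continuous_dot4 c1 c1) (@sqrt_continuous R).
  by move=> y; apply: cvgM; [exact: cvg_cst|exact: c2].
have /cvgrPdist_le/(_ e e0) := cq xi.
rewrite subrr /dot4 /dot3 /= !mulr0 !addr0 sqrtr0 mulr0.
apply: filterS => eta; rewrite sub0r normrN => H.
rewrite distrC (_ : eta = xi + (eta - xi)); last by rewrite addrC subrK.
apply: (le_trans (HC th xi (eta - xi))).
by apply: le_trans H; rewrite ler_norm.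
Qed.

(** Differentiation under the integral sign: by [taylor_cos] the remainder is at most [h^2] times
    the integral of [(v . x)^2 |g|], and [- sin] is the cosine advanced by [pi / 2]. *)
Lemma ct_derive g th xi v : rapid g ->
  is_derive xi v (ct g th) (ct (fun x => dot4 v x * g x) (th + pi / 2) xi).
Proof.
move=> rg; have ig := rapid_integ rg.
have ivg := rapid_integ (rapid_dot v rg).
have ib := integ_norm (rapid_integ (rapid_dot v (rapid_dot v rg))).
apply: (@is_derive_quad _ _ _ _ _ _ (\int[@leb4 R]_x `|dot4 v x * (dot4 v x * g
  x)|)).
move=> h _; rewrite /ct -RintZ; last exact: integ_meas (integ_ct _ _ ivg).
rewrite -RintegralB//; [|exact: integ_ct|exact: integ_ct].
rewrite -RintegralB//; last 2 first.
- exact: integB (integ_ct _ _ ig) (integ_ct _ _ ig).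
- by apply: integZ; exact: integ_ct.
rewrite -RintZ; last exact: integ_meas ib.
apply: Rint_le_norm; last exact: integZ.
  apply: integ_meas (integB (integB (integ_ct _ _ ig) (integ_ct _ _ ig)) _).
  by apply: integZ; exact: integ_ct.
move=> x; rewrite dot4Dl dot4Zl addrA cosDpihalf.
set A := dot4 xi x + th; set b := dot4 v x.
rewrite (_ : dot4 xi x + h * b + th = A + h * b); last by rewrite /A; ring.
rewrite (_ : _ - _ = g x * (cos (A + h * b) - cos A + (h * b) * sin A));
  last by ring.
rewrite normrM (le_trans (ler_wpM2l _ (taylor_cos A (h * b))))//.
rewrite [b * (b * g x)]mulrA -expr2 [X in _ <= _ * X]normrM (ger0_norm (sqr_ge0 b)).
by rewrite le_eqVlt; apply/orP; left; apply/eqP; ring.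
Qed.

(* Translate the integral by [h *: v] and compare the first-order terms in [h]. *)
Lemma ct_parts g g' (B : R4 R -> R) v th xi :
  integ (@leb4 R) g -> integ (@leb4 R) g' -> integ (@leb4 R) B ->
  (forall x h, `|h| <= 1 -> `|g (x + h *: v) - g x - h * g' x| <= h ^+ 2 * B x) ->
  ct g' th xi = dot4 xi v * ct g (th - pi / 2) xi.
Proof.
move=> ig ig' iB HB.
set a := dot4 xi v; set D := ct g' th xi; set E := ct g (th - pi / 2) xi.
(* [K] adds the second-order remainders of the two expansions of the translated integral: [B] for
   that of [g], [taylor_cos] for that of the phase. *)
pose K := \int[@leb4 R]_x B x + a ^+ 2 * \int[@leb4 R]_x `|g x|.
suff HK h : `|h| <= 1 -> `|h * (D - a * E)| <= h ^+ 2 * K.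
  apply/eqP; rewrite -subr_eq0 -normr_le0; apply/ler_addgt0Pl => e e0.
  rewrite addr0.
  have K0 : 0 <= K by have := HK 1; rewrite normr1 expr1n !mul1r => /(_ (lexx _));
    exact: (le_trans (normr_ge0 _)).
  pose h := Num.min 1 (e / (K + 1)).
  have h0 : 0 < h by rewrite lt_min ltr01 divr_gt0// ltr_wpDl.
  have := HK h; rewrite normrM (gtr0_norm h0) ge_min lexx /= => /(_ isT).
  rewrite expr2 -mulrA ler_pM2l// => /le_trans; apply.
  rewrite (le_trans (y := e / (K + 1) * K))//.
    by rewrite ler_wpM2r// ge_min lexx orbT.
  by rewrite -mulrA ler_piMr ?(ltW e0)// ler_pdivrMl ?ltr_wpDl// mulr1 lerDl.
move=> h1.
have s4 := @scales4 R (h *: v) 1 ltr01.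
have sc1 : scales (@leb4 R) (fun x : R4 R => h *: v + 1 *: x) 1.
  by move: s4; rewrite expr1n invr1.
have igh : integ (@leb4 R) (fun x => g (x + h *: v)).
  apply: eq_integ (scales_integ ltr01 sc1 ig) => x /=.
  by rewrite scale1r addrC.
(* Translation invariance trades the shift of [g] for the shift [- h * a] of the phase. *)
have T : \int[@leb4 R]_x (g (x + h *: v) * cos (dot4 xi x + th)) = ct g (th - h *
  a) xi.
  rewrite -[RHS]mul1r -(scales_Rint sc1); last exact: integ_ct.
  apply: eq_Rint => x; rewrite scale1r addrC; congr (_ * cos _).
  by rewrite dot4Dr dot4Zr /a; ring.
have iL : integ (@leb4 R) (fun x => (g (x + h *: v) - g x - h * g' x) * cos (dot4
  xi x + th)).
  by apply: integ_ct; apply: integB; [exact: integB|exact: integZ].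
have iM : integ (@leb4 R) (fun x => g x * cos (dot4 xi x + (th - h * a)) -
     g x * cos (dot4 xi x + th) - h * a * (g x * cos (dot4 xi x + (th - pi / 2)))).
  apply: integB; first by apply: integB; exact: integ_ct.
  by apply: integZ; exact: integ_ct.
have L : `|ct g (th - h * a) xi - ct g th xi - h * D| <= h ^+ 2 * \int[@leb4 R]_x
  B x.
  rewrite -T /ct /D /ct -RintZ; last exact: integ_meas (integ_ct _ _ ig').
  rewrite -RintegralB//; [|exact: integ_ct|exact: integ_ct].
  rewrite -RintegralB//; last 2 first.
  - by apply: integB; exact: integ_ct.
  - by apply: integZ; exact: integ_ct.
  rewrite -RintZ; last exact: integ_meas iB.
  rewrite [X in `|X|](_ : _ = \int[@leb4 R]_x ((g (x + h *: v) - g x - h * g' x) *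
      cos (dot4 xi x + th))); last by apply: eq_Rint => x; ring.
  apply: Rint_le_norm; [exact: integ_meas iL| |exact: integZ].
  move=> x; rewrite normrM; apply: le_trans (HB x h h1).
  by rewrite ler_piMr// cos_norm1.
have M : `|ct g (th - h * a) xi - ct g th xi - h * a * E| <=
    h ^+ 2 * a ^+ 2 * \int[@leb4 R]_x `|g x|.
  rewrite /ct /E /ct -RintZ; last exact: integ_meas (integ_ct _ _ ig).
  rewrite -RintegralB//; [|exact: integ_ct|exact: integ_ct].
  rewrite -RintegralB//; last 2 first.
  - by apply: integB; exact: integ_ct.
  - by apply: integZ; exact: integ_ct.
  rewrite -RintZ; last exact: integ_meas (integ_norm ig).
  apply: Rint_le_norm; [exact: integ_meas iM| |by apply: integZ; exact: integ_norm].
  move=> x; set A := dot4 xi x + th.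
  rewrite (_ : dot4 xi x + (th - h * a) = A + (- (h * a))); last by rewrite /A;
    ring.
  rewrite (_ : dot4 xi x + (th - pi / 2) = A - pi / 2); last by rewrite /A; ring.
  rewrite cosBpihalf (_ : _ - _ = g x * (cos (A - h * a) - cos A + (- (h * a)) *
    sin A)); last by ring.
  rewrite normrM mulrC ler_wpM2r// (le_trans (taylor_cos _ _))//.
  by rewrite sqrrN exprMn.
set U := _ - ct g th xi in L M.
rewrite (_ : h * _ = (U - h * a * E) - (U - h * D)); last by ring.
rewrite (le_trans (ler_normB _ _))// (le_trans (lerD M L))//.
by rewrite le_eqVlt; apply/orP; left; apply/eqP; rewrite /K; ring.
Qed.

End Rapid.

(** * Directional derivatives as derivatives along lines *)

Section Lines.
Variables (R : realType) (V : normedModType R).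
Implicit Types (f : V -> R) (x v : V).

(** The two difference quotients are the same function of the increment. *)
Lemma is_derive_line f x v (s d : R) : is_derive (x + s *: v) v f d ->
  is_derive s (1 : R) (fun s => f (x + s *: v)) d.
Proof.
have E : (fun h : R => h^-1 *: ((f \o shift (x + s *: v)) (h *: v) - f (x + s *:
  v))) =
    (fun h : R => h^-1 *: (((fun s => f (x + s *: v)) \o shift s) (h *: (1 : R)) -
      f (x + s *: v))).
  apply/funext => h; congr (_ *: (f _ - _)) => /=.
  by rewrite /shift /= (_ : h *: (1 : R) = h) ?scalerDl 1?addrCA//; exact: mulr1.
by move=> [df dE]; split; [move: df; rewrite /derivable E|move: dE;
  rewrite /derive E].
Qed.

Lemma line_is_derive f x v (d : R) :
  is_derive (0 : R) (1 : R) (fun s => f (x + s *: v)) d -> is_derive x v f d.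
Proof.
have E : (fun h : R => h^-1 *: ((f \o shift x) (h *: v) - f x)) =
    (fun h : R => h^-1 *: (((fun s => f (x + s *: v)) \o shift 0) (h *: (1 : R)) -
      f (x + 0 *: v))).
  apply/funext => h; rewrite scale0r addr0; congr (_ *: (f _ - _)) => /=.
  by rewrite /shift /= (_ : h *: (1 : R) = h) ?addr0 1?addrC//; exact: mulr1.
by move=> [df dE]; split; [move: df; rewrite /derivable E|move: dE;
  rewrite /derive E].
Qed.

End Lines.

(** * Polynomials against exponentials *)

Section PolyExp.
Variable R : realType.

(** With [K = 1 + (N + 1) / c] one has [1 + r <= K * exp (c r / (N + 1))]; the [N]-th power uses
    only the fraction [N / (N + 1)] of the exponent. Dividing by [N + 1] rather than [N] includes
    [N = 0]. *)
Lemma expR_poly (N : nat) (c : R) : 0 < c ->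
  exists2 C, 0 < C & forall r, 0 <= r -> (1 + r) ^+ N * expR (- (c * r)) <= C.
Proof.
move=> c0; pose K := 1 + N.+1%:R / c;
  have K1 : 1 <= K by rewrite lerDl divr_ge0// ltW.
exists (K ^+ N); first by rewrite exprn_gt0// (lt_le_trans ltr01).
move=> r r0; rewrite expRN ler_pdivrMr ?expR_gt0//.
have KE : 1 + r <= K * expR (c * r / N.+1%:R).
  apply: (@le_trans _ _ (K * (1 + c * r / N.+1%:R))); last first.
    by rewrite ler_wpM2l ?expR_ge1Dx// (le_trans ler01).
  have q0 : 0 <= c * r / N.+1%:R by rewrite divr_ge0// mulr_ge0// ltW.
  have -> : K * (1 + c * r / N.+1%:R) = 1 + r + (N.+1%:R / c + c * r / N.+1%:R).
    rewrite /K; have := ltr0Sn R N; move: (N.+1%:R) => k k0.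
    by field; rewrite !lt0r_neq0.
  by rewrite lerDl addr_ge0// divr_ge0// ltW.
apply: (@le_trans _ _ ((K * expR (c * r / N.+1%:R)) ^+ N)).
  by rewrite lerXn2r// nnegrE ?addr_ge0// mulr_ge0 ?expR_ge0// (le_trans ler01).
rewrite exprMn -expRM_natl ler_wpM2l ?exprn_ge0 ?(le_trans ler01)// ler_expR.
rewrite [leLHS]mulrC -[leLHS]mulrA ler_piMr ?mulr_ge0 ?(ltW c0)//.
by rewrite mulrC ler_pdivrMr// mul1r ler_nat leqnSn.
Qed.

End PolyExp.

(** * Gaussians *)

Section Gauss.
Variable R : realType.
Local Notation mR := (measurableTypeR R).
Implicit Types (x y v xi : R4 R) (g : R4 R -> R).

Lemma br_scale (s : R) v : `|s| <= 1 -> br (s *: v) <= br v.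
Proof.
move=> s1; rewrite /br dot4Zl dot4Zr lerD2l mulrA -expr2 ler_piMl ?dot4_ge0//.
by rewrite -real_normK ?num_real// expr_le1.
Qed.

(** Peetre's inequality for [x = (x + s *: v) - s *: v]: along a bounded segment the weight changes
    at most by a constant factor. *)
Lemma peetre_inv (s : R) x v : `|s| <= 1 ->
  (br (x + s *: v) ^+ 4)^-1 <= (2 * br v) ^+ 4 * (br x ^+ 4)^-1.
Proof.
move=> s1; rewrite ler_pdivlMr ?brX_gt0// mulrC ler_pdivrMr ?brX_gt0// -exprMn.
have b0 y : 0 <= br y by exact: ltW (br_gt0 y).
rewrite lerXn2r// ?nnegrE ?mulr_ge0//.
have := peetre (x + s *: v) (- s *: v).
rewrite -addrA -scalerDl subrr scale0r addr0 => /le_trans; apply.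
rewrite [leRHS]mulrAC ler_wpM2l ?mulr_ge0//.
by apply: br_scale; rewrite normrN.
Qed.

(** Provides the integrable majorant that [ct_parts] requires: the second derivative decays
    uniformly along the segment from [x] to [x + h *: v]. *)
Lemma taylor_line g g1 g2 v C :
  (forall x, is_derive x v g (g1 x)) -> (forall x, is_derive x v g1 (g2 x)) ->
  (forall x, `|g2 x| <= C * (br x ^+ 4)^-1) ->
  forall x h, `|h| <= 1 ->
    `|g (x + h *: v) - g x - h * g1 x| <= h ^+ 2 * (C * (2 * br v) ^+ 4 * (br x ^+
      4)^-1).
Proof.
move=> d1 d2 b x h h1.
have C0 : 0 <= C.
  by have := le_trans (normr_ge0 _) (b 0); rewrite pmulr_lge0// invr_gt0 brX_gt0.
have := @taylor1 R (fun s => g (x + s *: v)) (fun s => g1 (x + s *: v)) (fun s =>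
  g2 (x + s *: v)) h.
rewrite scale0r addr0; apply.
- by move=> s _; exact: is_derive_line.
- by move=> s _; exact: is_derive_line.
- move=> s sh; apply: (le_trans (b _)); rewrite -mulrA ler_wpM2l// peetre_inv//.
  exact: le_trans sh h1.
Qed.

Lemma ct_parts_line g g1 g2 v C th xi : rapid g -> rapid g1 ->
  (forall x, is_derive x v g (g1 x)) -> (forall x, is_derive x v g1 (g2 x)) ->
  (forall x, `|g2 x| <= C * (br x ^+ 4)^-1) ->
  ct g1 th xi = dot4 xi v * ct g (th - pi / 2) xi.
Proof.
move=> rg rg1 d1 d2 b.
apply: (ct_parts _ _ (rapid_integ rg) (rapid_integ rg1) _ (taylor_line d1 d2 b)).
exact: integZ (@integ_wt R).
Qed.

Definition gauss x := expR (- dot4 x x).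

Lemma continuous_gauss : continuous gauss.
Proof.
apply: continuous_comp_fun (@continuous_expR R) => x.
by apply: cvgN; apply: continuous_dot4 => y; exact: cvg_id.
Qed.

Lemma rapid_gauss : rapid gauss.
Proof.
split; first exact: measurable_cont4 continuous_gauss.
move=> n; have [C _ HC] := @expR_poly R n 1 ltr01; exists C => x.
by have := HC _ (dot4_ge0 x); rewrite mul1r ger0_norm ?expR_ge0.
Qed.

Lemma gauss_derive x v : is_derive x v gauss (- 2 * (dot4 v x * gauss x)).
Proof.
apply: line_is_derive.
rewrite (_ : (fun s => _) = fun s => expR (- (dot4 x x + s * (2 * dot4 v x) + s ^+
  2 * dot4 v v))); last first.
  apply/funext => s; rewrite /gauss !dot4Dl !dot4Dr !dot4Zl !dot4Zr (dot4C x v);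
    congr expR; ring.
apply: is_derive_eq; rewrite /GRing.scale/= /gauss !mul0r expr0n/= mul0r !addr0;
  ring.
Qed.

Lemma gauss_derive2 x v : is_derive x v (fun x => - 2 * (dot4 v x * gauss x))
  ((4 * dot4 v x ^+ 2 - 2 * dot4 v v) * gauss x).
Proof.
apply: line_is_derive.
rewrite (_ : (fun s => _) = fun s => - 2 * ((dot4 v x + s * dot4 v v) *
   expR (- (dot4 x x + s * (2 * dot4 v x) + s ^+ 2 * dot4 v v)))); last first.
  apply/funext => s; rewrite /gauss !dot4Dl !dot4Dr !dot4Zl !dot4Zr (dot4C x v).
  congr (_ * (_ * expR _)); ring.
apply: is_derive_eq; rewrite /GRing.scale/= /gauss !mul0r expr0n/= mul0r !addr0;
  ring.
Qed.

Lemma rapid_gauss1 v : rapid (fun x => - 2 * (dot4 v x * gauss x)).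
Proof. by apply: rapidZ; apply: rapid_dot; exact: rapid_gauss. Qed.

Lemma rapid_gauss2 v : rapid (fun x => (4 * dot4 v x ^+ 2 - 2 * dot4 v v) * gauss
  x).
Proof.
rewrite (_ : (fun x => _) = fun x => 4 * (dot4 v x * (dot4 v x * gauss x)) +
   (- 2 * dot4 v v) * gauss x); last by apply/funext => x; ring.
apply: rapidD; apply: rapidZ; last exact: rapid_gauss.
by apply: rapid_dot; apply: rapid_dot; exact: rapid_gauss.
Qed.

(** The derivative of the gaussian along [v] is [- 2 (v . x)] times itself, so integration by parts
    turns this moment back into the transform of the gaussian. *)
Lemma ct_gauss_parts v th xi :
  ct (fun x => dot4 v x * gauss x) th xi = - (dot4 xi v / 2) * ct gauss (th - pi /
    2) xi.
Proof.
have [C _ HC] := rapid_bound 4 (rapid_gauss2 v).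
have := ct_parts_line th xi rapid_gauss (rapid_gauss1 v)
  (fun x => gauss_derive x v) (fun x => gauss_derive2 x v) HC.
rewrite ctZ; last by apply: rapid_integ; apply: rapid_dot; exact: rapid_gauss.
set A := ct _ _ _; set B := ct _ _ _; move=> E; lra.
Qed.

Lemma integ_gauss1 : integ (@leb1 R) (fun t : mR => expR (- t ^+ 2)).
Proof. exact: integrableT_gauss. Qed.

Lemma Rint_gauss1 : \int[@leb1 R]_t expR (- t ^+ 2) = Num.sqrt pi.
Proof. by rewrite /Rintegral /leb1 (@integralT_gauss R). Qed.

Lemma gauss_prod3 : (integ (@leb3 R) (fun x : R3 mR => expR (- dot3 x x)) *
  (\int[@leb3 R]_x expR (- dot3 x x) = Num.sqrt pi ^+ 3))%type.
Proof.
have i1 := integ_gauss1.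
have i2 := integ_prod (m1 := @leb1 R) (m2 := @leb1 R) i1 i1.
have i3 := integ_prod (m1 := @leb2 R) (m2 := @leb1 R) i2 i1.
have E2 := Rint_prod (m1 := @leb1 R) (m2 := @leb1 R) i1 i1.
have E3 := Rint_prod (m1 := @leb2 R) (m2 := @leb1 R) i2 i1.
have G3 (x : R3 R) : expR (- x.1.1 ^+ 2) * expR (- x.1.2 ^+ 2) * expR (- x.2 ^+ 2)
  = expR (- dot3 x x).
  by rewrite -!expRD /dot3; congr expR; ring.
split; first exact: eq_integ i3.
transitivity (\int[@leb3 R]_x (expR (- x.1.1 ^+ 2) * expR (- x.1.2 ^+ 2) * expR (-
  x.2 ^+ 2))).
  by apply: eq_Rint => x; rewrite G3.
transitivity ((\int[@leb2 R]_x (expR (- x.1 ^+ 2) * expR (- x.2 ^+ 2))) *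
   (\int[@leb1 R]_y expR (- y ^+ 2))); first exact: E3.
rewrite Rint_gauss1 exprSr; congr (_ * _).
transitivity ((\int[@leb1 R]_y expR (- y ^+ 2)) * (\int[@leb1 R]_y expR (- y ^+
  2))); first exact: E2.
by rewrite Rint_gauss1 expr2.
Qed.

Lemma Rint_gauss : \int[@leb4 R]_x gauss x = pi ^+ 2.
Proof.
have E := Rint_prod (m1 := @leb1 R) (m2 := @leb3 R) integ_gauss1 gauss_prod3.1.
transitivity (\int[@leb4 R]_x (expR (- x.1 ^+ 2) * expR (- dot3 x.2 x.2))).
  by apply: eq_Rint => x; rewrite -expRD /gauss /dot4; congr expR; ring.
transitivity ((\int[@leb1 R]_y expR (- y ^+ 2)) *
   (\int[@leb3 R]_y expR (- dot3 y y))); first exact: E.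
rewrite Rint_gauss1 gauss_prod3.2 -exprS -[in RHS](sqr_sqrtr (@pi_ge0 R)).
by rewrite -exprM.
Qed.

(* For the gaussian, multiplication by [dot4 v x] is differentiation up to a
   factor, which yields an ODE along the ray through [xi]. *)
Lemma ct_gauss th xi : ct gauss th xi = pi ^+ 2 * cos th * expR (- (dot4 xi xi /
  4)).
Proof.
pose q := dot4 xi xi; pose phi (s : R) := ct gauss th (s *: xi).
have d1 (s : R) : is_derive s (1 : R) phi (- (s * q / 2) * phi s).
  have -> : - (s * q / 2) * phi s = ct (fun x => dot4 xi x * gauss x) (th + pi /
    2) (s *: xi).
    by rewrite ct_gauss_parts addrK dot4Zl.
  have := ct_derive th (s *: xi) xi rapid_gauss;
    rewrite -[X in is_derive X](add0r (s *: xi)).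
  by move=> /is_derive_line; rewrite (_ : (fun s => _) = phi)//;
    apply/funext => t; rewrite add0r.
(* [expR (s ^+ 2 * q / 4)] is the integrating factor of [phi' = - (s q / 2) phi]; the product is
   therefore constant. *)
have d2 (s : R) : is_derive s (1 : R) (fun s => phi s * expR (s ^+ 2 * q / 4)) 0.
  by apply: is_derive_eq; rewrite /GRing.scale/=; field.
have [c _] := @mvt0 R (fun s => phi s * expR (s ^+ 2 * q / 4)) (fun=> 0) 1 (fun s
  _ => d2 s).
rewrite mul0r => /eqP; rewrite subr_eq0 => /eqP.
have -> : phi 1 = ct gauss th xi by rewrite /phi scale1r.
have -> : phi 0 = ct gauss th 0 by rewrite /phi scale0r.
have -> : expR (0 ^+ 2 * q / 4) = 1 :> R by rewrite expr0n/= !mul0r expR0.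
rewrite expr1n [1 * q]mul1r => E.
have -> : pi ^+ 2 * cos th = ct gauss th 0.
  rewrite /ct -Rint_gauss mulrC -RintZ; last exact: rapid_gauss.1.
  by apply: eq_Rint => x; rewrite /dot4 /dot3 /= !mul0r !add0r mulrC.
by rewrite -[ct gauss th 0]mulr1 -E -mulrA -expRD /q subrr expR0 mulr1.
Qed.

Lemma ct_gauss_scale (b : R) th xi : 0 < b ->
  ct (fun x => gauss (b *: x)) th xi =
    (b ^+ 4)^-1 * (pi ^+ 2 * cos th * expR (- (dot4 xi xi / (4 * b ^+ 2)))).
Proof.
move=> b0; have s4 := @scales4 R 0 b b0.
have ig := integ_ct th (b^-1 *: xi) (rapid_integ rapid_gauss).
have := scales_Rint s4 ig; rewrite -/(ct _ _ _) ct_gauss => E.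
transitivity (\int[@leb4 R]_x (gauss (0 + b *: x) * cos (dot4 (b^-1 *: xi) (0 + b
  *: x) + th))).
  apply: eq_Rint => x; rewrite add0r dot4Zl dot4Zr mulrA mulVf ?mul1r//;
    exact: lt0r_neq0.
rewrite E; congr (_ * (_ * expR (- _))).
by rewrite dot4Zl dot4Zr; field; exact: lt0r_neq0.
Qed.

Lemma rapid_gauss_scale (b : R) : 0 < b -> rapid (fun x => gauss (b *: x)).
Proof.
move=> b0; split.
  apply: measurable_cont4; apply: continuous_comp_fun continuous_gauss => x.
  exact: scaler_continuous.
move=> n; have [C _ HC] := @expR_poly R n (b ^+ 2) (exprn_gt0 2 b0); exists C => x.
have := HC _ (dot4_ge0 x); rewrite ger0_norm ?expR_ge0// /gauss dot4Zl dot4Zr.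
by rewrite mulrA -expr2.
Qed.

End Gauss.

Lemma Rint_dominated d (T : measurableType d) (R : realType)
    (mu : {measure set T -> \bar R}) (f_ : nat -> T -> R) (f G : T -> R) :
  (forall n, measurable_fun setT (f_ n)) -> measurable_fun setT f ->
  (forall x, f_ ^~ x @ \oo --> f x) -> integ mu G ->
  (forall n x, `|f_ n x| <= G x) ->
  \int[mu]_x f_ n x @[n --> \oo] --> \int[mu]_x f x.
Proof.
move=> mf_ mf f_f iG fG.
have [| | | |ifn _ H] := @dominated_convergence d T R mu setT measurableT
  (fun n x => (f_ n x)%:E) (fun x => (f x)%:E) (EFin \o G) _ _ _ iG _.
- by move=> n; exact/measurable_EFinP.
- exact/measurable_EFinP.
- by apply: aeW => x _; apply/cvg_EFin; [exact: nearW|exact: f_f].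
- by apply: aeW => x n _ /=; rewrite lee_fin.
apply: fine_cvg; rewrite fineK//; first exact: integrable_fin_num.
Qed.

(** * Fourier inversion *)

Section Inversion.
Variable R : realType.
Local Notation mR := (measurableTypeR R).
Implicit Types (x y v xi : R4 R) (g : R4 R -> R).

Lemma scales_shift x : scales (@leb4 R) (fun y => y + x) 1.
Proof.
have := @scales4 R x 1 ltr01; rewrite expr1n invr1.
by rewrite (_ : (fun y => _) = (fun y => y + x))//; apply/funext => y;
  rewrite scale1r addrC.
Qed.

Lemma rapid_shift g x : rapid g -> rapid (fun y => g (y + x)).
Proof.
move=> [mg gC]; split.
  exact: measurableT_comp mg (scales_shift x).1.
move=> n; have [C HC] := gC n; exists ((2 * br (- x)) ^+ n * C) => y.
have b0 z : 0 <= br z by exact: ltW (br_gt0 z).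
have K0 : 0 <= (2 * br (- x)) ^+ n by apply: exprn_ge0; apply: mulr_ge0;
  [exact: ler0n|exact: b0].
apply: (le_trans _ (ler_wpM2l K0 (HC (y + x)))).
rewrite mulrA -exprMn ler_wpM2r// lerXn2r// ?nnegrE ?mulr_ge0 ?b0//.
have := peetre (y + x) (- x); rewrite addrK => /le_trans; apply.
by rewrite mulrAC.
Qed.

Lemma ct_shift g x th xi : rapid g ->
  ct (fun y => g (y + x)) th xi = ct g (th - dot4 xi x) xi.
Proof.
move=> rg; rewrite -[RHS]mul1r -(scales_Rint (scales_shift x)).
  by apply: eq_Rint => y; rewrite dot4Dr addrACA subrr addr0 addrC.
by apply: integ_ct; exact: rapid_integ.
Qed.

(** Fubini moves the transform onto the damping gaussian, which becomes a gaussian of width [2 b];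
    the substitution [y = 2 b z] then fixes its width and concentrates the argument of [g] at 0 for
    small [b]. The constant 16 is [(2 b)^4 / b^4]. *)
Lemma ct_damped (b : R) g th : 0 < b -> rapid g ->
  \int[@leb4 R]_xi (ct g th xi * gauss (b *: xi)) =
  16 * pi ^+ 2 * cos th * \int[@leb4 R]_z (g ((2 * b) *: z) * gauss z).
Proof.
move=> b0 rg; have rb := rapid_gauss_scale b0.
have igb := rapid_integ rb; have ig := rapid_integ rg.
have b20 : 0 < 2 * b by rewrite mulr_gt0.
pose F := fun z : R4 mR * R4 mR => gauss (b *: z.1) * (g z.2 * cos (dot4 z.1 z.2 +
  th)).
have mF : measurable_fun setT F.
  apply: measurable_funM; first exact: measurableT_comp rb.1 _.
  apply: measurable_funM; first exact: measurableT_comp rg.1 _.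
  by apply: measurable_cosdot4; [exact: measurable_fst|exact: measurable_snd].
have iF : integ (@leb4 R \x @leb4 R)%E F.
  have ip := integ_prod (m1 := @leb4 R) (m2 := @leb4 R) igb (integ_norm ig).
  apply: integ_le mF _ ip => z.
  rewrite normrM ger0_norm ?expR_ge0// ler_wpM2l ?expR_ge0// normrM ler_piMr//.
  exact: cos_norm1.
transitivity (\int[(@leb4 R \x @leb4 R)%E]_z F z).
  rewrite (Rfubini1 iF); apply: eq_Rint => xi; rewrite mulrC -RintZ//.
  exact: integ_meas (integ_ct _ _ ig).
rewrite (Rfubini2 iF).
transitivity (\int[@leb4 R]_y ((b ^+ 4)^-1 * pi ^+ 2 * cos th * (g y * gauss ((2 *
  b)^-1 *: y)))).
  apply: eq_Rint => y.
  transitivity (g y * ct (fun x => gauss (b *: x)) th y).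
    rewrite -RintZ; last exact: integ_meas (integ_ct _ _ igb).
    by apply: eq_Rint => x; rewrite /F/= (dot4C x); ring.
  rewrite (ct_gauss_scale _ _ b0) /gauss dot4Zl dot4Zr.
  have -> : (2 * b)^-1 * ((2 * b)^-1 * dot4 y y) = dot4 y y / (4 * b ^+ 2).
    by field; exact: lt0r_neq0.
  by ring.
have mg' : measurable_fun [set: R4 mR] (fun y => g y * gauss ((2 * b)^-1 *: y)).
  apply: measurable_funM; first exact: rg.1.
  by apply: (rapid_gauss_scale _).1; rewrite invr_gt0.
have ig' : integ (@leb4 R) (fun y => g y * gauss ((2 * b)^-1 *: y)).
  apply: integ_le mg' _ (integ_norm ig) => y.
  by rewrite normrM ler_piMr// ger0_norm ?expR_ge0// -expR0 ler_expR oppr_le0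
    dot4_ge0.
rewrite (RintZ (@leb4 R) _ mg').
have -> : \int[@leb4 R]_z (g ((2 * b) *: z) * gauss z) =
    ((2 * b) ^+ 4)^-1 * \int[@leb4 R]_y (g y * gauss ((2 * b)^-1 *: y)).
  rewrite -(scales_Rint (@scales4 R 0 (2 * b) b20) ig'); apply: eq_Rint => z.
  by rewrite add0r scalerA mulVf ?scale1r// lt0r_neq0.
by field; exact: lt0r_neq0.
Qed.

(* Damp the transform by [gauss (b *: xi)] and let [b] tend to 0. *)
Lemma inversion0 g th : rapid g -> continuous g -> integ (@leb4 R) (ct g th) ->
  \int[@leb4 R]_xi ct g th xi = (2 * pi) ^+ 4 * cos th * g 0.
Proof.
move=> rg cg ict.
pose b (n : nat) : R := n.+1%:R^-1.
have b0 n : 0 < b n by rewrite invr_gt0.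
have gle1 (x : R4 R) : gauss x <= 1 by rewrite /gauss -expR0 ler_expR oppr_le0
  dot4_ge0.
have g00 : gauss (0 : R4 R) = 1.
  by rewrite /gauss -(scale0r (0 : R4 R)) dot4Zl mul0r oppr0 expR0.
have bcvg (c : R) (x : R4 R) : (c * b n) *: x @[n --> \oo] --> (0 : R4 R).
  rewrite -(scale0r x); apply: cvgZr_tmp; rewrite -(mulr0 c).
  by apply: cvgM; [exact: cvg_cst|exact: cvg_harmonic].
have L1 : \int[@leb4 R]_xi (ct g th xi * gauss (b n *: xi)) @[n --> \oo] -->
    \int[@leb4 R]_xi (ct g th xi).
  apply: (Rint_dominated _ _ _ (integ_norm ict)).
  - move=> n; apply: measurable_funM; first exact: integ_meas ict.
    exact: (rapid_gauss_scale (b0 n)).1.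
  - exact: integ_meas ict.
  - move=> x; rewrite -[X in _ --> X]mulr1 -g00; apply: cvgM; first exact: cvg_cst.
    apply: continuous_cvg; first exact: continuous_gauss.
    by have := bcvg 1 x; under eq_fun do rewrite mul1r.
  - by move=> n x; rewrite normrM ler_piMr// ger0_norm ?expR_ge0.
have [M M0 HM] := rapid_bound 0 rg.
have L2 : \int[@leb4 R]_z (g ((2 * b n) *: z) * gauss z) @[n --> \oo] -->
    \int[@leb4 R]_z (g 0 * gauss z).
  have mgs := (rapid_gauss R).1.
  apply: (@Rint_dominated _ _ _ (@leb4 R) (fun n z => g ((2 * b n) *: z) * gauss z)
    (fun z => g 0 * gauss z) (fun z => M * gauss z)).
  - move=> n; apply: measurable_funM => //; apply: measurable_cont4.
    by apply: continuous_comp_fun cg => x; exact: scaler_continuous.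
  - exact: measurable_funM.
  - move=> x; apply: cvgM; last exact: cvg_cst.
    by apply: continuous_cvg; [exact: cg|exact: bcvg].
  - by apply: integZ; apply: rapid_integ; exact: rapid_gauss.
  - move=> n x; rewrite normrM [`|gauss _|]ger0_norm ?expR_ge0// ler_wpM2r
    ?expR_ge0//.
    by have := HM ((2 * b n) *: x); rewrite expr0 invr1 mulr1.
have L3 : \int[@leb4 R]_xi (ct g th xi * gauss (b n *: xi)) @[n --> \oo] -->
    16 * pi ^+ 2 * cos th * \int[@leb4 R]_z (g 0 * gauss z).
  rewrite (_ : (fun n => _) = (fun n => 16 * pi ^+ 2 * cos th *
     \int[@leb4 R]_z (g ((2 * b n) *: z) * gauss z))).
    by apply: cvgM L2; exact: cvg_cst.
  by apply/funext => n; exact: ct_damped.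
(* The gaussian has mass [pi^2], and [16 pi^2 * pi^2 = (2 pi)^4]. *)
rewrite (cvg_unique _ L1 L3)// RintZ; last exact: (rapid_gauss R).1.
by rewrite Rint_gauss; ring.
Qed.

(** Translating [g] by [x] moves the value wanted to the origin and appears in the transform as the
    phase [- xi . x]. *)
Lemma inversion g th x : rapid g -> continuous g ->
  integ (@leb4 R) (fun xi => ct g (th - dot4 xi x) xi) ->
  \int[@leb4 R]_xi ct g (th - dot4 xi x) xi = (2 * pi) ^+ 4 * cos th * g x.
Proof.
move=> rg cg ict.
have E xi : ct g (th - dot4 xi x) xi = ct (fun y => g (y + x)) th xi by rewrite
  ct_shift.
transitivity (\int[@leb4 R]_xi ct (fun y => g (y + x)) th xi); first exact: eq_Rint.
rewrite inversion0 ?add0r//.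
- exact: rapid_shift.
- by apply: continuous_comp_fun cg => y; apply: cvgD;
  [exact: cvg_id|exact: cvg_cst].
- exact: eq_integ ict.
Qed.

End Inversion.

(** * Smooth, Schwartz and test functions *)

Section Smooth.
Variable R : realType.
Local Notation mR := (measurableTypeR R).
Implicit Types (x y v w xi : R4 R) (g f : R4 R -> R) (i : 'I_4) (s : seq 'I_4).

Local Notation e i := (basis4 R i).

Lemma partial_rcons s i g : partial (rcons s i) g = partial s ('D_(e i) g).
Proof. by rewrite /partial foldr_rcons. Qed.

(* Here the innermost derivative is peeled off first, whereas [partial] exposes
   the outermost one; this order suits inductions on products and compositions. *)
Fixpoint Cn (n : nat) g : Prop := if n is m.+1 then
  continuous g /\ forall i, (forall x, derivable g x (e i)) /\ Cn m ('D_(e i) g)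
  else continuous g.

Lemma smoothR_D i g : smoothR g -> smoothR ('D_(e i) g).
Proof. by move=> sg s; have := sg (rcons s i); rewrite partial_rcons. Qed.

Lemma smoothR_derive i g x : smoothR g -> is_derive x (e i) g ('D_(e i) g x).
Proof. by move=> /(_ [::])[_ /(_ i x) dg]; exact: DeriveDef. Qed.

Lemma smoothR_Cn g : smoothR g <-> forall n, Cn n g.
Proof.
split=> [sg n|Cg s].
  elim: n g sg => [|n IH] g sg; first exact: (sg [::]).1.
  split=> [|i]; first exact: (sg [::]).1.
  by split; [exact: (sg [::]).2|apply: IH; exact: smoothR_D].
(* One order more than the length of [s], because derivability of [partial s g] is part of the
   claim. *)
have : Cn (size s).+1 g by exact: Cg.
elim/last_ind: s g {Cg} => [|s i IH] g /=.
  by move=> [cg dg]; split=> // i x; exact: (dg i).1.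
by rewrite size_rcons partial_rcons => -[_ /(_ i)[_]]; exact: IH.
Qed.

Lemma CnS n g : Cn n.+1 g -> Cn n g.
Proof.
elim: n g => [|n IH] g; first by move=> [].
move=> [cg dg]; split=> // i; have [d1 d2] := dg i; split=> //.
exact: IH.
Qed.

Lemma CnD n f g : Cn n f -> Cn n g -> Cn n (fun x => f x + g x).
Proof.
elim: n f g => [|n IH] f g.
  by move=> cf cg x; apply: cvgD; [exact: cf|exact: cg].
move=> [cf df] [cg dg]; split=> [|i].
  by move=> x; apply: cvgD; [exact: cf|exact: cg].
have [df1 df2] := df i; have [dg1 dg2] := dg i; split=> [x|];
  first exact: derivableD.
rewrite (_ : 'D_(e i) _ = fun x => 'D_(e i) f x + 'D_(e i) g x); first exact: IH.
by apply/funext => x; exact: deriveD.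
Qed.

Lemma CnM n f g : Cn n f -> Cn n g -> Cn n (fun x => f x * g x).
Proof.
elim: n f g => [|n IH] f g.
  by move=> cf cg x; apply: cvgM; [exact: cf|exact: cg].
move=> Cf Cg; have Cf' := CnS Cf; have Cg' := CnS Cg.
move: Cf Cg => [cf df] [cg dg]; split=> [|i].
  by move=> x; apply: cvgM; [exact: cf|exact: cg].
have [df1 df2] := df i; have [dg1 dg2] := dg i; split=> [x|];
  first exact: derivableM.
rewrite (_ : 'D_(e i) _ = fun x => f x * 'D_(e i) g x + g x * 'D_(e i) f x);
  last first.
  by apply/funext => x; exact: deriveM.
by apply: CnD; exact: IH.
Qed.

Lemma Cn_cst n (c : R) : Cn n (fun=> c).
Proof.
elim: n c => [|n IH] c; first by move=> x; exact: cvg_cst.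
split=> [|i]; first by move=> x; exact: cvg_cst.
have d x : is_derive x (e i) (fun=> c) 0 by exact: is_derive_cst.
split=> [x|]; first by case: (d x).
by rewrite (_ : 'D_(e i) _ = fun=> 0)//; apply/funext => x; case: (d x).
Qed.

Lemma dot4_derive w x v : is_derive x v (dot4 w) (dot4 w v).
Proof.
apply: (@is_derive_quad _ _ _ _ _ _ 0) => h _.
rewrite dot4Dr dot4Zr mulr0 (_ : _ - _ = 0) ?normr0//; ring.
Qed.

Lemma Cn_dot n w : Cn n (dot4 w).
Proof.
case: n => [|n]; first exact: continuous_dotl.
split=> [|i]; first exact: continuous_dotl.
split=> [x|]; first by case: (dot4_derive w x (e i)).
rewrite (_ : 'D_(e i) _ = fun=> dot4 w (e i)); first exact: Cn_cst.
by apply/funext => x; case: (dot4_derive w x (e i)).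
Qed.

Lemma expR_derive g x v (d : R) : is_derive x v g d ->
  is_derive x v (fun x => expR (g x)) (d * expR (g x)).
Proof.
move=> dg; apply: line_is_derive.
have dl : is_derive (0 : R) (1 : R) (fun t : R => g (x + t *: v)) d.
  by apply: is_derive_line; rewrite scale0r addr0.
have -> : d * expR (g x) = expR (g (x + 0 *: v)) * d by rewrite scale0r addr0 mulrC.
exact: (@is_derive1_comp _ expR (fun t : R => g (x + t *: v)) 0).
Qed.

Lemma Cn_expR n g : (forall m, Cn m g) -> Cn n (fun x => expR (g x)).
Proof.
move=> Cg.
have ce : continuous (fun x => expR (g x)).
  by apply: continuous_comp_fun (@continuous_expR R); exact: (Cg 0%N).
elim: n => [|n IH]; [exact: ce|split; [exact: ce|move=> i]].
have d x : is_derive x (e i) (fun x => expR (g x)) ('D_(e i) g x * expR (g x)).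
  by apply: expR_derive; have [_ /(_ i)[/(_ x) dg _]] := Cg 1%N; exact: DeriveDef.
split=> [x|]; first by case: (d x).
rewrite (_ : 'D_(e i) _ = fun x => 'D_(e i) g x * expR (g x)).
  by apply: CnM => //; have [_ /(_ i)[]] := Cg n.+1.
by apply/funext => x; case: (d x).
Qed.

Lemma smoothRM f g : smoothR f -> smoothR g -> smoothR (fun x => f x * g x).
Proof.
by move=> /smoothR_Cn Cf /smoothR_Cn Cg; apply/smoothR_Cn => n; exact: CnM.
Qed.

Lemma smoothRD f g : smoothR f -> smoothR g -> smoothR (fun x => f x + g x).
Proof.
by move=> /smoothR_Cn Cf /smoothR_Cn Cg; apply/smoothR_Cn => n; exact: CnD.
Qed.

Lemma smoothR_cst (c : R) : @smoothR R (fun=> c).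
Proof. by apply/smoothR_Cn => n; exact: Cn_cst. Qed.

Lemma smoothR_dot w : smoothR (dot4 w).
Proof. by apply/smoothR_Cn => n; exact: Cn_dot. Qed.

Lemma smoothR_expR g : smoothR g -> smoothR (fun x => expR (g x)).
Proof. by move=> /smoothR_Cn Cg; apply/smoothR_Cn => n; exact: Cn_expR. Qed.

Lemma dot4_basis x : (dot4 (e 0) x = x.1) * (dot4 (e 1) x = x.2.1.1) *
  (dot4 (e 2) x = x.2.1.2) * (dot4 (e 3) x = x.2.2).
Proof. by rewrite /dot4 /dot3 /basis4 /= !mul0r !mul1r ?add0r ?addr0. Qed.

Lemma smoothR_a_symbol (l : R) : @smoothR R (a_symbol l).
Proof.
rewrite (_ : a_symbol l = fun x : R4 R => expR (- l ^+ 2 * (dot4 (e 0) x * dot4 (e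
  0) x)) *
   expR (l ^+ 2 * ((dot4 (e 1) x * dot4 (e 1) x + dot4 (e 2) x * dot4 (e 2) x) +
      dot4 (e 3) x * dot4 (e 3) x))); last first.
  apply/funext => x; rewrite !dot4_basis /a_symbol /dot3.
  by congr (expR _ * expR _); ring.
apply: smoothRM; apply: smoothR_expR; apply: smoothRM; try exact: smoothR_cst.
  by apply: smoothRM; exact: smoothR_dot.
by apply: smoothRD; [apply: smoothRD|]; apply: smoothRM; exact: smoothR_dot.
Qed.

Lemma partialD s f g : smoothR f -> smoothR g ->
  partial s (fun x => f x + g x) = (fun x => partial s f x + partial s g x).
Proof.
move=> sf sg; elim: s => [|i s IH] //=.
by apply/funext => x; rewrite IH; apply: deriveD; [exact: (sf s).2|exact: (sg s).2].
Qed.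

Lemma partialZ s (c : R) g : smoothR g ->
  partial s (fun x => c * g x) = (fun x => c * partial s g x).
Proof.
move=> sg; elim: s => [|i s IH] //=.
by apply/funext => x; rewrite IH; exact: (deriveZ c ((sg s).2 i x)).
Qed.

Definition schwR g := smoothR g /\
  forall (n : nat) s, exists C, forall x, br x ^+ n * `|partial s g x| <= C.

Lemma schwR_D i g : schwR g -> schwR ('D_(e i) g).
Proof.
move=> [sg gC]; split; first exact: smoothR_D.
by move=> n s; have := gC n (rcons s i); rewrite partial_rcons.
Qed.

Lemma schwRD f g : schwR f -> schwR g -> schwR (fun x => f x + g x).
Proof.
move=> [sf fC] [sg gC]; split; first exact: smoothRD.
move=> n s; have [C HC] := fC n s; have [D HD] := gC n s; exists (C + D) => x.
rewrite partialD// (le_trans _ (lerD (HC x) (HD x)))// -mulrDr ler_wpM2l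
  ?ler_normD//.
by rewrite ltW// brX_gt0.
Qed.

Lemma schwRZ (c : R) g : schwR g -> schwR (fun x => c * g x).
Proof.
move=> [sg gC]; split; first by apply: smoothRM; [exact: smoothR_cst|exact: sg].
move=> n s; have [C HC] := gC n s; exists (`|c| * C) => x.
by rewrite partialZ// normrM mulrCA ler_wpM2l.
Qed.

Lemma schwR_rapid g : schwR g -> rapid g.
Proof.
move=> [sg gC]; split; first exact: measurable_cont4 (sg [::]).1.
by move=> n; exact: (gC n [::]).
Qed.

Lemma schwR_parts i g th xi : schwR g ->
  ct ('D_(e i) g) th xi = dot4 xi (e i) * ct g (th - pi / 2) xi.
Proof.
move=> Sg; have Sg1 := schwR_D i Sg; have Sg2 := schwR_D i Sg1.
have [C _ HC] := rapid_bound 4 (schwR_rapid Sg2).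
apply: (ct_parts_line th xi (schwR_rapid Sg) (schwR_rapid Sg1) _ _ HC) => x.
  exact: smoothR_derive Sg.1.
exact: smoothR_derive Sg1.1.
Qed.

(** Two integrations by parts shift the phase by [- pi], which the phase [th + pi] compensates; it
    carries the minus sign of the second derivative. *)
Lemma schwR_parts2 i g th xi : schwR g ->
  dot4 xi (e i) ^+ 2 * ct g th xi = ct ('D_(e i) ('D_(e i) g)) (th + pi) xi.
Proof.
move=> Sg; rewrite schwR_parts; last exact: schwR_D.
rewrite schwR_parts// mulrA -expr2; congr (_ * ct g _ xi); lra.
Qed.

(** The supremum of [schwartz_norm] in the form of a bound: the same index limits the order of
    derivation and the power of the weight. *)
Definition nbound (m : nat) g (M : R) := forall s x, (size s <= m)%N ->
  br x ^+ m * `|partial s g x| <= M.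

Lemma br_le (m n : nat) x : (m <= n)%N -> br x ^+ m <= br x ^+ n.
Proof. by move=> mn; rewrite ler_weXn2l// br_ge1. Qed.

Lemma nboundD i m g M : nbound m.+2 g M -> nbound m ('D_(e i) ('D_(e i) g)) M.
Proof.
move=> H s x sm; rewrite -!partial_rcons.
have := H (rcons (rcons s i) i) x; rewrite !size_rcons !ltnS => /(_ sm);
  apply: le_trans.
by rewrite ler_wpM2r// br_le// ltnW.
Qed.

(* Multiplication by [br xi] on the transform side is 1 - Laplacian on [g]. *)
Lemma ct_decay (N : nat) g (M : R) th xi : schwR g -> nbound (4 + N.*2) g M ->
  br xi ^+ N * `|ct g th xi| <= 5 ^+ N * (M * \int[@leb4 R]_x (br x ^+ 4)^-1).
Proof.
elim: N g th => [|N IH] g th Sg Hg.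
  rewrite !expr0 !mul1r; have rg := schwR_rapid Sg.
  rewrite (le_trans (ct_bound _ _ (rapid_integ rg)))// -RintZ;
    last exact: integ_meas (@integ_wt R).
  apply: le_Rintegral => //;
    [exact: integ_norm (rapid_integ rg)|exact: integZ (@integ_wt R)|].
  move=> x _; rewrite ler_pdivlMr ?brX_gt0// mulrC.
  by have := Hg [::] x isT; rewrite addn0.
rewrite exprSr -mulrA -[X in _ * (X * _)](gtr0_norm (br_gt0 xi)) -normrM.
have Hg' : nbound (4 + N.*2) g M.
  move=> s x sm; have := Hg s x; rewrite doubleS !addnS => /(_ (leqW (leqW sm))).
  by apply: le_trans; rewrite ler_wpM2r//; apply: br_le; do 2 apply: leqW.
have Hg2 : nbound (4 + N.*2).+2 g M by [].
have HD i := IH _ (th + pi) (schwR_D i (schwR_D i Sg)) (nboundD i Hg2).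
have H0 := IH _ th Sg Hg'.
have [c [cE P]] : exists c : 'I_4 -> R,
    (forall i, ct ('D_(e i) ('D_(e i) g)) (th + pi) xi = c i) /\
    forall i, c i = dot4 (e i) xi ^+ 2 * ct g th xi.
  exists (fun i => ct ('D_(e i) ('D_(e i) g)) (th + pi) xi); split=> // i.
  by rewrite (dot4C (e i)) (schwR_parts2 i th xi Sg).
have {}HD i : br xi ^+ N * `|c i| <= 5 ^+ N * (M * \int[@leb4 R]_x (br x ^+ 4)^-1).
  by rewrite -cE; exact: HD.
(* [br xi] is 1 plus four squares: five terms under the same bound, hence a factor 5 for each power
   of the weight. *)
have -> : br xi * ct g th xi = ct g th xi + c 0 + c 1 + c 2 + c 3.
  by rewrite !P !dot4_basis /br {1}/dot4 /dot3; ring.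
have b0 : 0 <= br xi ^+ N by exact: ltW (brX_gt0 _ _).
have B a1 a2 a3 a4 a5 K : br xi ^+ N * `|a1| <= K -> br xi ^+ N * `|a2| <= K ->
   br xi ^+ N * `|a3| <= K -> br xi ^+ N * `|a4| <= K -> br xi ^+ N * `|a5| <= K ->
   br xi ^+ N * `|a1 + a2 + a3 + a4 + a5| <= 5 * K.
  move=> h1 h2 h3 h4 h5.
  apply: (@le_trans _ _ (br xi ^+ N * (`|a1| + `|a2| + `|a3| + `|a4| + `|a5|))).
    rewrite ler_wpM2l//; do 4 rewrite (le_trans (ler_normD _ _))// lerD2r.
  rewrite !mulrDr; lra.
by rewrite [5 ^+ _]exprS -[leRHS]mulrA; exact: B.
Qed.

(** [schwR] gives one constant for each list of directions; the lists of bounded length being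
    finitely many, an induction on the length adds up the constants of the four directions while the
    weight stays fixed. *)
Lemma nbound_exists m g : schwR g -> exists M, nbound m g M.
Proof.
move=> Sg; suff H k : forall f, schwR f -> exists M, forall s x, (size s <= k)%N ->
    br x ^+ m * `|partial s f x| <= M by exact: H.
elim: k => [|k IH] f Sf.
  have [M HM] := Sf.2 m [::]; exists M => s x; rewrite leqn0 => /nilP ->; exact: HM.
have [M HM] := Sf.2 m [::].
have [F HF] := choice (fun i => IH _ (schwR_D i Sf)).
exists (`|M| + \sum_i `|F i|) => s x; case/lastP: s => [|s i].
  move=> _; apply: (le_trans (HM x)); rewrite (le_trans (ler_norm _))// lerDl.
  by apply: sumr_ge0.
rewrite size_rcons ltnS partial_rcons => sk; apply: (le_trans (HF i s x sk)).
rewrite (le_trans (ler_norm _))// (bigD1 i)//= addrCA lerDl addr_ge0//.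
by apply: sumr_ge0.
Qed.

(** Any compact set off which [g] vanishes will do as support, so that products need no computation
    of closures. *)
Definition testR g := smoothR g /\ exists S : set (R4 R), compact S /\
  forall x, ~ S x -> g x = 0.

(** Off a closed set the function vanishes in a neighbourhood, and a derivative depends on the germ
    only. *)
Lemma partial_support s g (S : set (R4 R)) : closed S -> (forall x, ~ S x ->
  g x = 0) ->
  forall x, ~ S x -> partial s g x = 0.
Proof.
move=> cS g0; elim: s => [|i s IH] //= x Sx.
have oS : open (~` S) by exact: closed_openC.
have E : \near x, partial s g x = (fun=> 0) x.
  by near=> y; apply: IH; near: y; exact: open_nbhs_nbhs.
rewrite (near_eq_derive _ E).
by case: (@is_derive_cst R (R4 R) R 0 x (e i)).
Unshelve. all: by end_near. Qed.

Lemma testR_schwR g : testR g -> schwR g.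
Proof.
move=> [sg [S [cS g0]]]; split=> // n s.
have clS : closed S by apply: compact_closed => //; exact: norm_hausdorff.
have cf : continuous (fun x => br x ^+ n * `|partial s g x|).
  move=> x; apply: cvgM; first exact: continuous_brX.
  by apply: cvg_norm; exact: (sg s).1.
have := compact_bounded (continuous_compact (continuous_subspaceT cf) cS).
move=> [M [_ /(_ (M + 1))]]; rewrite ltrDl ltr01 => /(_ isT) HM.
exists (Num.max 0 (M + 1)) => x; have [Sx|Sx] := pselect (S x).
  rewrite le_max; apply/orP; right; apply: (le_trans (ler_norm _)).
  by apply: HM; exists x.
by rewrite (partial_support _ clS g0)// normr0 mulr0 le_max lexx.
Qed.

Lemma testRM f g : smoothR f -> testR g -> testR (fun x => f x * g x).
Proof.
move=> sf [sg [S [cS g0]]]; split; first exact: smoothRM.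
by exists S; split=> // x /g0 ->; rewrite mulr0.
Qed.

Lemma ct_derive_basis g th : testR g -> forall i,
  (forall x, derivable (ct g th) x (e i)) /\
  'D_(e i) (ct g th) = ct (fun x => dot4 (e i) x * g x) (th + pi / 2).
Proof.
move=> tg i; have rg := schwR_rapid (testR_schwR tg).
split=> [x|]; first by case: (ct_derive th x (e i) rg).
by apply/funext => x; case: (ct_derive th x (e i) rg).
Qed.

Lemma ct_Cn n g th : testR g -> Cn n (ct g th).
Proof.
elim: n g th => [|n IH] g th tg; first by apply: continuous_ct;
  exact: schwR_rapid (testR_schwR tg).
split=> [|i]; first by apply: continuous_ct; exact: schwR_rapid (testR_schwR tg).
have [d ->] := ct_derive_basis th tg i; split; first exact: d.
apply: IH; apply: testRM; [exact: smoothR_dot|exact: tg].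
Qed.

(** Each derivative of the transform multiplies [g] by a coordinate, which leaves it a test
    function; the claim reduces to the decay of the transform itself, given by [ct_decay]. *)
Lemma ct_schwR g th : testR g -> schwR (ct g th).
Proof.
move=> tg; split; first by apply/smoothR_Cn => n; exact: ct_Cn.
move=> n s; elim/last_ind: s g th tg => [|s i IH] g th tg; last first.
  rewrite partial_rcons (ct_derive_basis th tg i).2; apply: IH.
  by apply: testRM => //; exact: smoothR_dot.
have [M HM] := nbound_exists (4 + n.*2) (testR_schwR tg).
by eexists => x; apply: ct_decay HM; exact: testR_schwR.
Qed.

End Smooth.

(** Tonelli's measurability for the positive and negative parts, whose difference is then sent
    through [fine]; divergent sections are thereby included. *)
Lemma measurable_Rint d1 d2 (T1 : measurableType d1) (T2 : measurableType d2)
    (R : realType) (m2 : {sigma_finite_measure set T2 -> \bar R}) (F : T1 * T2 ->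
      R) :
  measurable_fun setT F -> measurable_fun setT (fun x => \int[m2]_y F (x, y)).
Proof.
move=> mF; have mEF : measurable_fun setT (EFin \o F) by exact/measurable_EFinP.
apply: (measurableT_comp (@fine_measurable R _ measurableT)).
have -> : (fun x => \int[m2]_y (F (x, y))%:E)%E =
   (fun x => (\int[m2]_y (EFin \o F)^\+ (x, y)) - (\int[m2]_y (EFin \o F)^\- (x,
     y)))%E.
  apply/funext => x; rewrite -[LHS]/(\int[m2]_y ((EFin \o F) \o pair x) y)%E
    integralE.
  by rewrite funepos_comp funeneg_comp.
apply: emeasurable_funB.
  by apply: measurable_fun_fubini_tonelli_F => //; exact: measurable_funepos.
by apply: measurable_fun_fubini_tonelli_F => //; exact: measurable_funeneg.
Qed.

(** * Partial convolutions *)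

(* [pr z] is the coordinate of [z] in which one convolves, [rep z x] replaces it
   by [x], and [sh z x] stands for [x - pr z]: this covers time and space. *)
Section Convolution.
Context dZ dX (Z : measurableType dZ) (X : measurableType dX) (R : realType).
Variables (mz : {sigma_finite_measure set Z -> \bar R})
          (mx : {sigma_finite_measure set X -> \bar R}).
Variables (rep : Z -> X -> Z) (pr : Z -> X) (sh : Z -> X -> X).
Hypothesis mrep : measurable_fun setT (fun p : Z * X => rep p.1 p.2).
Hypothesis msh : measurable_fun setT (fun p : Z * X => sh p.1 p.2).
Hypothesis rep_rep : forall z x, rep (rep z x) (pr z) = z.
Hypothesis pr_rep : forall z x, pr (rep z x) = x.
Hypothesis swap : scales (mz \x mx)%E (fun p => (rep p.1 p.2, pr p.1)) 1.
Hypothesis sh_inv : forall z, scales mx (sh z) 1.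

Variables (K : Z -> X -> R) (k : X -> R) (A : Z -> R).
Hypothesis mK : measurable_fun setT (fun p : Z * X => K p.1 p.2).
Hypothesis mk : measurable_fun setT k.
Hypothesis Kk : forall z x, K (rep z x) (pr z) = k (sh z x).
Hypothesis mA : measurable_fun setT A.

Definition kconv z := \int[mx]_x (K z x * A (rep z x)).

Lemma measurable_conv_integrand :
  measurable_fun setT (fun p : Z * X => K p.1 p.2 * A (rep p.1 p.2)).
Proof. by apply: measurable_funM => //; exact: measurableT_comp mA mrep. Qed.

Lemma measurable_conv : measurable_fun setT kconv.
Proof. exact: (measurable_Rint mx measurable_conv_integrand). Qed.

Lemma scales_shear : scales (mz \x mx)%E (fun p => (p.1, sh p.1 p.2)) 1.
Proof.
have mt : measurable_fun setT (fun p : Z * X => (p.1, sh p.1 p.2)).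
  (* For a fixed first component the shear is the measure-preserving map [sh z], so Tonelli applies
     fibre by fibre. *)
  by apply: measurable_fun_pair => //; exact: measurable_fst.
split=> // f mf f0; rewrite mul1e.
rewrite fubini_tonelli1//; last exact: measurableT_comp mf mt.
rewrite (fubini_tonelli1 f mf f0); apply: eq_integral => z _; rewrite /fubini_F /=.
have [_ /(_ (fun x => f (z, x)))] := sh_inv z; rewrite mul1e; apply=> //.
exact: measurableT_comp mf (pair1_measurable z).
Qed.

(** The majorant for Fubini: [A] is integrable against the weight [w], and [kappa] is the kernel
    enlarged by the cost of moving the decay of [q] from [rep z x] back to [z]. *)
Variables (w q : Z -> R) (kappa : X -> R).
Hypothesis mq : measurable_fun setT q.
Hypothesis iwA : integ mz (fun z => w z * `|A z|).
Hypothesis ikappa : integ mx kappa.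
Hypothesis dom : forall z x, `|q (rep z x) * k (sh z x)| <= w z * kappa (sh z x).

Let F (p : Z * X) := q p.1 * (K p.1 p.2 * A (rep p.1 p.2)).

Let mF : measurable_fun setT F.
Proof.
apply: measurable_funM; last exact: measurable_conv_integrand.
exact: measurableT_comp mq (@measurable_fst _ _ _ _).
Qed.

Let Fs (p : Z * X) : F (rep p.1 p.2,
  pr p.1) = A p.1 * (k (sh p.1 p.2) * q (rep p.1 p.2)).
Proof. by rewrite /F /= rep_rep Kk; ring. Qed.

(** After the swap, [A] is evaluated at the unmoved point, and the integrand is dominated by a
    product function of [z] and [sh z x], that is, by a product composed with the shear. *)
Let iFs : integ (mz \x mx)%E (fun p => F (rep p.1 p.2, pr p.1)).
Proof.
have := scales_integ ltr01 scales_shear (integ_prod iwA ikappa).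
apply: integ_le; first exact: measurableT_comp mF swap.1.
move=> p /=; rewrite Fs [k _ * _]mulrC normrM [leRHS]mulrAC [leLHS]mulrC
  ler_wpM2r//.
Qed.

Let iF : integ (mz \x mx)%E F.
Proof.
apply: eq_integ (scales_integ ltr01 swap iFs) => -[z x] /=.
by rewrite rep_rep pr_rep.
Qed.

Let FE z : \int[mx]_x F (z, x) = q z * kconv z.
Proof.
have mz' : measurable_fun setT (fun x => K z x * A (rep z x)).
  exact: measurableT_comp measurable_conv_integrand (pair1_measurable z).
exact: (RintZ mx (q z) mz').
Qed.

Lemma conv_integ : integ mz (fun z => q z * kconv z).
Proof. exact: eq_integ FE (integ_fubini_F iF). Qed.

(** Fubini before and after the swap, which moves the kernel from [A] to [q]. *)
Lemma conv_adjoint : \int[mz]_z (q z * kconv z) =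
  \int[mz]_z (A z * \int[mx]_x (k (sh z x) * q (rep z x))).
Proof.
transitivity (\int[(mz \x mx)%E]_p F p).
  by rewrite (Rfubini1 iF); apply: eq_Rint => z; rewrite FE.
transitivity (\int[(mz \x mx)%E]_p F (rep p.1 p.2, pr p.1)).
  by rewrite (scales_Rint swap iF) mul1r.
rewrite (Rfubini1 iFs); apply: eq_Rint => z.
have mz' : measurable_fun setT (fun x => k (sh z x) * q (rep z x)).
  apply: measurable_funM.
    exact: measurableT_comp mk (measurableT_comp msh (pair1_measurable z)).
  exact: measurableT_comp mq (measurableT_comp mrep (pair1_measurable z)).
rewrite -(RintZ mx (A z) mz').
by apply: eq_Rint => x; exact: (Fs (z, x)).
Qed.

End Convolution.

(** * Exchange of the convolved variable with its replacement *)

Section Swaps.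
Variable R : realType.
Local Notation mR := (measurableTypeR R).
Local Open Scope ereal_scope.

Lemma tonelli4 (f : R4 mR -> \bar R) : measurable_fun setT f -> (forall z,
  0 <= f z) ->
  \int[@leb4 R]_z f z = \int[@leb1 R]_t \int[@leb3 R]_x f (t, x).
Proof. exact: (fubini_tonelli1 (m1 := @leb1 R) (m2 := @leb3 R)). Qed.

(** For a fixed time this is Tonelli's theorem for the two spatial variables. *)
Lemma swap_space : scales (@leb4 R \x @leb3 R)
  (fun p : R4 mR * R3 mR => ((p.1.1, p.2), p.1.2)) 1.
Proof.
have ms : measurable_fun setT (fun p : R4 mR * R3 mR => ((p.1.1, p.2),
  p.1.2) : R4 mR * R3 mR).
  apply: measurable_fun_pair.
    apply: measurable_fun_pair; last exact: measurable_snd.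
    exact: (measurableT_comp (@measurable_fst _ _ _ _) (@measurable_fst _ _ _ _)).
  exact: (measurableT_comp (@measurable_snd _ _ _ _) (@measurable_fst _ _ _ _)).
split=> // f mf f0; rewrite mul1e.
pose fs (p : R4 mR * R3 mR) := f ((p.1.1, p.2), p.1.2).
have mfs : measurable_fun setT fs by exact: measurableT_comp mf ms.
have fs0 p : 0 <= fs p by exact: f0.
have mG : measurable_fun setT (fun z : R4 mR => \int[@leb3 R]_x f ((z.1, x), z.2)).
  exact: (measurable_fun_fubini_tonelli_F fs mfs fs0).
have mH : measurable_fun setT (fun z : R4 mR => \int[@leb3 R]_x f (z, x)).
  exact: (measurable_fun_fubini_tonelli_F (m2 := @leb3 R) f mf f0).
transitivity (\int[@leb4 R]_z \int[@leb3 R]_x f ((z.1, x), z.2)).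
  exact: (fubini_tonelli1 (m1 := @leb4 R) (m2 := @leb3 R) fs mfs fs0).
transitivity (\int[@leb4 R]_z \int[@leb3 R]_x f (z, x)); last first.
  by apply/esym; exact: (fubini_tonelli1 (m1 := @leb4 R) (m2 := @leb3 R) f mf f0).
have mG0 z : 0 <= \int[@leb3 R]_x f ((z.1, x), z.2) by exact: integral_ge0.
have mH0 z : 0 <= \int[@leb3 R]_x f (z, x) by exact: integral_ge0.
rewrite (tonelli4 mG mG0) (tonelli4 mH mH0).
apply: eq_integral => t _ /=.
apply: (fubini_tonelli (m1 := @leb3 R) (m2 := @leb3 R) (fun p => f ((t, p.2),
  p.1))) => //.
apply: (measurableT_comp mf); apply: measurable_fun_pair;
  last exact: measurable_fst.
by apply: measurable_fun_pair => //; exact: measurable_snd.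
Qed.

(** The space variable stands between the two times in the iterated integral; it is first moved
    innermost, then the times are exchanged, then it is moved back. *)
Lemma swap_time : scales (@leb4 R \x @leb1 R)
  (fun p : R4 mR * mR => ((p.2, p.1.2), p.1.1)) 1.
Proof.
have ms : measurable_fun setT (fun p : R4 mR * mR => ((p.2, p.1.2),
  p.1.1) : R4 mR * mR).
  apply: measurable_fun_pair.
    apply: measurable_fun_pair; first exact: measurable_snd.
    exact: (measurableT_comp (@measurable_snd _ _ _ _) (@measurable_fst _ _ _ _)).
  exact: (measurableT_comp (@measurable_fst _ _ _ _) (@measurable_fst _ _ _ _)).
split=> // f mf f0; rewrite mul1e.
pose fs (p : R4 mR * mR) := f ((p.2, p.1.2), p.1.1).
have mfs : measurable_fun setT fs by exact: measurableT_comp mf ms.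
have fs0 p : 0 <= fs p by exact: f0.
have mG : measurable_fun setT (fun z : R4 mR => \int[@leb1 R]_x f ((x, z.2), z.1)).
  exact: (measurable_fun_fubini_tonelli_F fs mfs fs0).
have mH : measurable_fun setT (fun z : R4 mR => \int[@leb1 R]_x f (z, x)).
  exact: (measurable_fun_fubini_tonelli_F (m2 := @leb1 R) f mf f0).
transitivity (\int[@leb4 R]_z \int[@leb1 R]_x f ((x, z.2), z.1)).
  exact: (fubini_tonelli1 (m1 := @leb4 R) (m2 := @leb1 R) fs mfs fs0).
transitivity (\int[@leb4 R]_z \int[@leb1 R]_x f (z, x)); last first.
  by apply/esym; exact: (fubini_tonelli1 (m1 := @leb4 R) (m2 := @leb1 R) f mf f0).
have mG0 z : 0 <= \int[@leb1 R]_x f ((x, z.2), z.1) by exact: integral_ge0.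
have mH0 z : 0 <= \int[@leb1 R]_x f (z, x) by exact: integral_ge0.
rewrite (tonelli4 mG mG0) (tonelli4 mH mH0).
transitivity (\int[@leb1 R]_t \int[@leb1 R]_t' \int[@leb3 R]_x f ((t', x), t)).
  apply: eq_integral => t _ /=.
  apply: (fubini_tonelli (m1 := @leb3 R) (m2 := @leb1 R) (fun p => f ((p.2, p.1),
    t))) => //.
  apply: (measurableT_comp mf); apply: measurable_fun_pair => //.
  by apply: measurable_fun_pair; [exact: measurable_snd|exact: measurable_fst].
transitivity (\int[@leb1 R]_t' \int[@leb1 R]_t \int[@leb3 R]_x f ((t', x), t)).
  apply: (fubini_tonelli (m1 := @leb1 R) (m2 := @leb1 R)
    (fun p => \int[@leb3 R]_x f ((p.2, x), p.1))).
  - apply: (measurable_fun_fubini_tonelli_F (m2 := @leb3 R)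
      (fun p : (mR * mR) * R3 mR => f ((p.1.2, p.2), p.1.1))) => //.
    apply: (measurableT_comp mf); apply: measurable_fun_pair.
      apply: measurable_fun_pair; last exact: measurable_snd.
      exact: (measurableT_comp (@measurable_snd _ _ _ _) (@measurable_fst _ _ _ _)).
    exact: (measurableT_comp (@measurable_fst _ _ _ _) (@measurable_fst _ _ _ _)).
  - by move=> p; exact: integral_ge0.
apply: eq_integral => t' _ /=.
apply: (fubini_tonelli (m1 := @leb1 R) (m2 := @leb3 R) (fun p => f ((t', p.2),
  p.1))) => //.
apply: (measurableT_comp mf); apply: measurable_fun_pair;
  last exact: measurable_fst.
by apply: measurable_fun_pair => //; exact: measurable_snd.
Qed.

End Swaps.

(** * Convolution of slowly growing functions and the real Fourier transform *)

Section ConvR4.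
Variable R : realType.
Local Notation mR := (measurableTypeR R).
Implicit Types (y v w xi : R4 R) (g f q A : R4 R -> R).

Definition slowR A := measurable_fun [set: R4 mR] A /\
  exists N, integ (@leb4 R) (fun x => (br x ^+ N)^-1 * `|A x|).

Lemma slowR_rapid A q : slowR A -> rapid q -> integ (@leb4 R) (fun x => A x * q x).
Proof.
move=> [mA [N iA]] rq; have [C C0 HC] := rapid_bound N rq.
apply: integ_le (integZ C iA); first by apply: measurable_funM => //; exact: rq.1.
by move=> x; rewrite normrM mulrC mulrA ler_wpM2r.
Qed.

Context dX (X : measurableType dX) (mx : {sigma_finite_measure set X -> \bar R}).
Variables (rep : R4 mR -> X -> R4 mR) (pr : R4 mR -> X) (sh : R4 mR -> X -> X).
Hypothesis mrep : measurable_fun setT (fun p : R4 mR * X => rep p.1 p.2).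
Hypothesis msh : measurable_fun setT (fun p : R4 mR * X => sh p.1 p.2).
Hypothesis rep_rep : forall z x, rep (rep z x) (pr z) = z.
Hypothesis pr_rep : forall z x, pr (rep z x) = x.
Hypothesis swap : scales (@leb4 R \x mx)%E (fun p => (rep p.1 p.2, pr p.1)) 1.
Hypothesis sh_inv : forall z, scales mx (sh z) 1.
(** [n] is the weight of the displacement and [e] the Fourier multiplier of the kernel: by [k_cos] a
    cosine wave of frequency [y] is an eigenfunction with real eigenvalue [e y]. *)
Variables (K : R4 mR -> X -> R) (k n : X -> R) (e : R4 R -> R).
Hypothesis mK : measurable_fun setT (fun p : R4 mR * X => K p.1 p.2).
Hypothesis Kk : forall z x, K (rep z x) (pr z) = k (sh z x).
Hypothesis k_ge0 : forall x, 0 <= k x.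
Hypothesis br_rep : forall z x, br (z - rep z x) = n (sh z x).
Hypothesis ik : forall N, integ mx (fun x => n x ^+ N * k x).
Hypothesis k_cos : forall z y th,
  \int[mx]_x (k (sh z x) * cos (dot4 (rep z x) y + th)) = e y * cos (dot4 z y + th).

Let ik0 : integ mx k.
Proof. by apply: eq_integ (ik 0) => x; rewrite expr0 mul1r. Qed.

(** Peetre's inequality for [z = rep z x + (z - rep z x)]: the decay of [q] at the moved point
    becomes decay at [z], and the kernel pays with [n ^+ N]. *)
Lemma conv_dominated q (C : R) N : 0 <= C -> (forall x,
  `|q x| <= C * (br x ^+ N)^-1) ->
  forall z x, `|q (rep z x) * k (sh z x)| <=
    (br z ^+ N)^-1 * (C * 2 ^+ N * (n (sh z x) ^+ N * k (sh z x))).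
Proof.
move=> C0 HC z x; rewrite normrM (ger0_norm (k_ge0 _)).
apply: (le_trans (ler_wpM2r (k_ge0 _) (HC _))).
have key : (br (rep z x) ^+ N)^-1 <= 2 ^+ N * n (sh z x) ^+ N * (br z ^+ N)^-1.
  rewrite ler_pdivlMr ?brX_gt0// mulrC ler_pdivrMr ?brX_gt0// -br_rep -!exprMn.
  have b0 (y : R4 R) : 0 <= br y by exact: ltW (br_gt0 y).
  rewrite lerXn2r// ?nnegrE ?mulr_ge0 ?b0//.
  have := peetre (rep z x) (z - rep z x);
    rewrite [rep z x + _]addrC subrK => /le_trans; apply.
  by rewrite mulrAC.
apply: (le_trans (ler_wpM2r (k_ge0 _) (ler_wpM2l C0 key))).
by rewrite le_eqVlt; apply/orP; left; apply/eqP; ring.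
Qed.

Let kappa (C : R) N x := C * 2 ^+ N * (n x ^+ N * k x).

Let ikappa (C : R) N : integ mx (kappa C N).
Proof. exact: integZ (ik N). Qed.

Let mk : measurable_fun setT k := integ_meas ik0.

Lemma conv_integR4 A q C N : measurable_fun [set: R4 mR] A ->
  measurable_fun [set: R4 mR] q ->
  integ (@leb4 R) (fun x => (br x ^+ N)^-1 * `|A x|) ->
  0 <= C -> (forall x, `|q x| <= C * (br x ^+ N)^-1) ->
  integ (@leb4 R) (fun z => q z * kconv mx rep K A z).
Proof.
move=> mA mq iA C0 HC.
exact: (conv_integ (mz :=
  @leb4 R) mrep msh rep_rep pr_rep swap sh_inv mK Kk mA mq iA
  (ikappa C N) (conv_dominated C0 HC)).
Qed.

(** The weight [br ^- N] itself serves as the function [q], so the growth exponent is preserved. *)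
Lemma conv_slow A : slowR A -> slowR (kconv mx rep K A).
Proof.
move=> [mA [N iA]]; have mc := measurable_conv mx mrep mK mA.
split=> //; exists N.
have bi (x : R4 R) : 0 <= (br x ^+ N)^-1 by rewrite invr_ge0 ltW// brX_gt0.
have HC (x : R4 R) : `|(br x ^+ N)^-1| <= 1 * (br x ^+ N)^-1 by rewrite mul1r
  (ger0_norm (bi x)) lexx.
have mq : measurable_fun [set: R4 mR] (fun x => (br x ^+ N)^-1).
  apply: measurable_cont4 => x; apply: cvgV; last exact: continuous_brX.
  by rewrite lt0r_neq0// brX_gt0.
apply: eq_integ (integ_norm (conv_integR4 mA mq iA ler01 HC)) => x.
by rewrite normrM ger0_norm.
Qed.

Lemma ct_conv g th z : integ (@leb4 R) g ->
  \int[mx]_x (k (sh z x) * ct g th (rep z x)) = ct (fun y => e y * g y) th z.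
Proof.
move=> ig.
have iks : integ mx (fun x => k (sh z x)) := scales_integ ltr01 (sh_inv z) ik0.
pose F (p : X * R4 mR) := k (sh z p.1) * (g p.2 * cos (dot4 (rep z p.1) p.2 + th)).
have mrz : measurable_fun setT (rep z) :=
  measurableT_comp mrep (pair1_measurable z).
have mF : measurable_fun setT F.
  apply: measurable_funM.
    exact: (measurableT_comp (integ_meas iks) (@measurable_fst _ _ _ _)).
  apply: measurable_funM.
    exact: (measurableT_comp (integ_meas ig) (@measurable_snd _ _ _ _)).
  apply: measurable_cosdot4; last exact: measurable_snd.
  exact: (measurableT_comp mrz (@measurable_fst _ _ _ _)).
have iF : integ (mx \x @leb4 R)%E F.
  have ip := integ_prod (m1 := mx) (m2 := @leb4 R) iks (integ_norm ig).
  apply: integ_le mF _ ip => p.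
  rewrite normrM (ger0_norm (k_ge0 _)) ler_wpM2l// normrM ler_piMr// cos_norm1//.
transitivity (\int[(mx \x @leb4 R)%E]_p F p).
  rewrite (Rfubini1 iF); apply: eq_Rint => x.
  by rewrite -(RintZ (@leb4 R) _ (integ_meas (integ_ct _ _ ig))).
rewrite (Rfubini2 iF); apply: eq_Rint => y.
have mky : measurable_fun setT (fun x => k (sh z x) * cos (dot4 (rep z x) y + th)).
  apply: measurable_funM; first exact: integ_meas iks.
  exact: measurable_cosdot4.
transitivity (g y * \int[mx]_x (k (sh z x) * cos (dot4 (rep z x) y + th))).
  by rewrite -(RintZ mx _ mky); apply: eq_Rint => x; rewrite /F/=; ring.
by rewrite k_cos; ring.
Qed.

(** The kernel passes to the transform by adjointness, and from there to [g] as a multiplier by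
    [ct_conv]. *)
Lemma conv_ct_adjoint A g th : slowR A -> integ (@leb4 R) g -> rapid (ct g th) ->
  \int[@leb4 R]_z (kconv mx rep K A z * ct g th z) =
  \int[@leb4 R]_z (A z * ct (fun y => e y * g y) th z).
Proof.
move=> [mA [N iA]] ig rc; have [C C0 HC] := rapid_bound N rc.
transitivity (\int[@leb4 R]_z (ct g th z * kconv mx rep K A z)).
  by apply: eq_Rint => z; rewrite mulrC.
transitivity (\int[@leb4 R]_z (A z * \int[mx]_x (k (sh z x) * ct g th (rep z x)))).
  exact: (conv_adjoint (mz :=
    @leb4 R) mrep msh rep_rep pr_rep swap sh_inv mK mk Kk mA
    rc.1 iA (ikappa C N) (conv_dominated C0 HC)).
by apply: eq_Rint => z; rewrite ct_conv.
Qed.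

End ConvR4.

(** * The gaussian kernels in time and space *)

Section Kernels.
Variable R : realType.
Local Notation mR := (measurableTypeR R).
Variable l : R.
Hypothesis l_gt0 : 0 < l.

(** The scale in which the kernels are multiples of standard gaussians:
    [t^2 / (4 l^2) = (b t)^2]. *)
Let b : R := (2 * l)^-1.
Let b0 : 0 < b. Proof. by rewrite invr_gt0 mulr_gt0. Qed.
Let sp : R := Num.sqrt pi.
Let sp0 : 0 < sp. Proof. by rewrite sqrtr_gt0 pi_gt0. Qed.
Let spE : pi = sp ^+ 2. Proof. by rewrite sqr_sqrtr// pi_ge0. Qed.
Let n1 (t : R) : R := 1 + t ^+ 2.
Let n3 (x : R3 R) : R := 1 + dot3 x x.

Lemma T_kernelE (t : R) : T_kernel l t = (2 * l * sp)^-1 * expR (- (b ^+ 2 * t ^+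
  2)).
Proof.
rewrite /T_kernel; congr (_ * expR (- _)); rewrite /b; field; exact: lt0r_neq0.
Qed.

Lemma E_kernelE (x : R3 R) : E_kernel l x = ((2 * l * sp) ^+ 3)^-1 * expR (- (b ^+
  2 * dot3 x x)).
Proof.
rewrite /E_kernel; congr (_ * expR (- _)); rewrite /b; field; exact: lt0r_neq0.
Qed.

Lemma T_kernel_ge0 (t : R) : 0 <= T_kernel l t.
Proof. by rewrite mulr_ge0 ?expR_ge0// invr_ge0 !mulr_ge0 ?sqrtr_ge0// ltW. Qed.

Lemma E_kernel_ge0 (x : R3 R) : 0 <= E_kernel l x.
Proof. by rewrite mulr_ge0 ?expR_ge0// invr_ge0 exprn_ge0// !mulr_ge0 ?sqrtr_ge0//
  ltW. Qed.

(** Lets the single transform formula on R4 serve both kernels. *)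
Lemma TE_gauss (x : R4 R) :
  T_kernel l x.1 * E_kernel l x.2 = ((2 * l * sp) ^+ 4)^-1 * gauss (b *: x).
Proof.
rewrite T_kernelE E_kernelE /gauss dot4Zl dot4Zr mulrA -expr2.
rewrite (_ : - (b ^+ 2 * dot4 x x) = - (b ^+ 2 * x.1 ^+ 2) + - (b ^+ 2 * dot3 x.2
  x.2)); last first.
  by rewrite /dot4; ring.
by rewrite expRD; field; rewrite !lt0r_neq0.
Qed.

Lemma gauss1_scaled (c : R) : 0 < c ->
  integ (@leb1 R) (fun t : mR => expR (- (c ^+ 2 * t ^+ 2))) /\
  \int[@leb1 R]_t expR (- (c ^+ 2 * t ^+ 2)) = c^-1 * sp.
Proof.
move=> c0; have s := @scales1 R 0 c c0; have ig := @integ_gauss1 R.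
have E (t : R) : expR (- (0 + c * t) ^+ 2) = expR (- (c ^+ 2 * t ^+ 2)).
  by rewrite add0r exprMn.
have ci : 0 < c^-1 by rewrite invr_gt0.
split; first by apply: eq_integ (scales_integ ci s ig) => t; exact: E.
by rewrite /sp -(@Rint_gauss1 R) -(scales_Rint s ig); apply: eq_Rint => t;
  rewrite E.
Qed.

Lemma gauss3_scaled (c : R) : 0 < c ->
  integ (@leb3 R) (fun x : R3 mR => expR (- (c ^+ 2 * dot3 x x))) /\
  \int[@leb3 R]_x expR (- (c ^+ 2 * dot3 x x)) = (c ^+ 3)^-1 * sp ^+ 3.
Proof.
move=> c0; have s := @scales3 R 0 c c0; have [ig gE] := @gauss_prod3 R.
have E (x : R3 R) : expR (- dot3 (0 + c *: x) (0 + c *: x)) = expR (- (c ^+ 2 *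
  dot3 x x)).
  by rewrite add0r; congr (expR (- _)); rewrite /dot3 /= /GRing.scale/=; ring.
have ci : 0 < (c ^+ 3)^-1 by rewrite invr_gt0 exprn_gt0.
split; first by apply: eq_integ (scales_integ ci s ig) => t; exact: E.
by rewrite /sp -gE -(scales_Rint s ig); apply: eq_Rint => t; rewrite E.
Qed.

Lemma Rint_T_kernel : \int[@leb1 R]_t T_kernel l t = 1.
Proof.
have [ig gE] := gauss1_scaled b0.
transitivity (\int[@leb1 R]_t ((2 * l * sp)^-1 * expR (- (b ^+ 2 * t ^+ 2)))).
  by apply: eq_Rint => t; exact: T_kernelE.
rewrite (RintZ _ _ (integ_meas ig)) gE /b.
by field; rewrite !lt0r_neq0.
Qed.

Lemma Rint_E_kernel : \int[@leb3 R]_x E_kernel l x = 1.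
Proof.
have [ig gE] := gauss3_scaled b0.
transitivity (\int[@leb3 R]_x (((2 * l * sp) ^+ 3)^-1 * expR (- (b ^+ 2 * dot3 x
  x)))).
  by apply: eq_Rint => x; exact: E_kernelE.
rewrite (RintZ _ _ (integ_meas ig)) gE /b.
by field; rewrite !lt0r_neq0.
Qed.

(** Three quarters of the exponent absorb the polynomial; the remaining quarter, [(b / 2)^2], is
    again a gaussian and gives integrability. *)
Lemma expR_split (N : nat) : exists2 C, 0 < C & forall r, 0 <= r ->
  (1 + r) ^+ N * expR (- (b ^+ 2 * r)) <= C * expR (- ((b / 2) ^+ 2 * r)).
Proof.
have c0 : 0 < b ^+ 2 * 3 / 4 by apply: divr_gt0 => //; apply: mulr_gt0 => //;
  exact: exprn_gt0 b0.
have [C C0 HC] := expR_poly N c0; exists C => // r r0.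
rewrite (_ : - (b ^+ 2 * r) = - (b ^+ 2 * 3 / 4 * r) + - ((b / 2) ^+ 2 * r));
  last by field.
by rewrite expRD mulrA ler_wpM2r ?expR_ge0// HC.
Qed.

Lemma integ_T_kernel N : integ (@leb1 R) (fun t : mR => n1 t ^+ N * T_kernel l t).
Proof.
have [C C0 HC] := expR_split N.
have [ig _] := gauss1_scaled (divr_gt0 b0 (ltr0Sn R 1)).
apply: integ_le (integZ ((2 * l * sp)^-1) (integZ C ig)).
  apply: measurable_funM.
    apply: measurable_funX; apply: measurable_funD => //; exact: measurable_funX.
  have [igb _] := gauss1_scaled b0.
  rewrite (funext T_kernelE); exact: integ_meas (integZ _ igb).
move=> t; have h0 : 0 <= n1 t by rewrite addr_ge0// sqr_ge0.
rewrite ger0_norm; last by rewrite mulr_ge0 ?exprn_ge0// T_kernel_ge0.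
rewrite T_kernelE mulrCA ler_wpM2l//; last exact: HC (sqr_ge0 t).
by rewrite invr_ge0 !mulr_ge0 ?(ltW sp0)// ltW.
Qed.

Lemma dot3_ge0 (x : R3 R) : 0 <= dot3 x x.
Proof. by rewrite /dot3; repeat apply: addr_ge0; rewrite -expr2 sqr_ge0. Qed.

Lemma integ_E_kernel N : integ (@leb3 R) (fun x : R3 mR => n3 x ^+ N * E_kernel l
  x).
Proof.
have [C C0 HC] := expR_split N.
have [ig _] := gauss3_scaled (divr_gt0 b0 (ltr0Sn R 1)).
apply: integ_le (integZ (((2 * l * sp) ^+ 3)^-1) (integZ C ig)).
  apply: measurable_funM.
    apply: measurable_funX; rewrite (_ : n3 = fun x => br (0 : R, x)).
      apply: (measurableT_comp (measurable_cont4 (@continuous_br R))).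
      exact: measurable_fun_pair.
    by apply/funext => x; rewrite /n3 /br /dot4/= mul0r add0r.
  have [igb _] := gauss3_scaled b0.
  rewrite (funext E_kernelE); exact: integ_meas (integZ _ igb).
move=> x; have h0 : 0 <= n3 x by rewrite addr_ge0// dot3_ge0.
rewrite ger0_norm; last by rewrite mulr_ge0 ?exprn_ge0// E_kernel_ge0.
rewrite E_kernelE mulrCA ler_wpM2l//; last exact: HC (dot3_ge0 x).
by rewrite invr_ge0 exprn_ge0// !mulr_ge0 ?(ltW sp0)// ltW.
Qed.

Let iT : integ (@leb1 R) (T_kernel l : mR -> R).
Proof. by apply: eq_integ (integ_T_kernel 0) => t; rewrite expr0 mul1r. Qed.

Let iE : integ (@leb3 R) (E_kernel l : R3 mR -> R).
Proof. by apply: eq_integ (integ_E_kernel 0) => t; rewrite expr0 mul1r. Qed.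

Lemma TE_cos (xi : R4 R) (th : R) :
  \int[@leb4 R]_x (T_kernel l x.1 * E_kernel l x.2 * cos (dot4 xi x + th)) =
  expR (- (l ^+ 2 * dot4 xi xi)) * cos th.
Proof.
transitivity (((2 * l * sp) ^+ 4)^-1 * ct (fun x => gauss (b *: x)) th xi).
  rewrite -(RintZ (@leb4 R)).
    by apply: eq_Rint => x; rewrite TE_gauss mulrA.
  exact: integ_meas (integ_ct _ _ (rapid_integ (rapid_gauss_scale b0))).
rewrite (ct_gauss_scale _ _ b0) spE.
rewrite (_ : dot4 xi xi / (4 * b ^+ 2) = l ^+ 2 * dot4 xi xi); last first.
  by rewrite /b; field; exact: lt0r_neq0.
by rewrite /b; field; rewrite !lt0r_neq0.
Qed.

Lemma integ_T_cos (om th : R) :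
  integ (@leb1 R) (fun t : mR => T_kernel l t * cos (om * t + th)).
Proof.
apply: integ_le iT.
  apply: measurable_funM; first exact: integ_meas iT.
  apply: (measurableT_comp (continuous_measurable_fun (@continuous_cos R))).
  by apply: measurable_funD => //; exact: measurable_funM.
by move=> t; rewrite normrM (ger0_norm (T_kernel_ge0 t)) ler_piMr ?T_kernel_ge0//
  cos_norm1.
Qed.

(** Multiplying by the mass 1 of the space kernel turns this into the integral on R4 at the
    frequency [(om, 0)]. *)
Lemma T_cos (om th : R) :
  \int[@leb1 R]_t (T_kernel l t * cos (om * t + th)) = expR (- (l ^+ 2 * om ^+ 2))
    * cos th.
Proof.
have iTc := integ_T_cos om th.
have := Rint_prod (m1 := @leb1 R) (m2 := @leb3 R) iTc iE.
rewrite Rint_E_kernel mulr1 => <-.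
transitivity (\int[@leb4 R]_x (T_kernel l x.1 * E_kernel l x.2 *
    cos (dot4 (om, (0, 0, 0)) x + th))).
  rewrite /Rintegral; congr (fine _); apply: eq_integral => x _; congr (_%:E).
  by rewrite mulrAC /dot4 /dot3/= !mul0r !addr0.
by rewrite TE_cos /dot4 /dot3/= !mul0r !addr0 expr2.
Qed.

Lemma integ_E_cos (k : R3 R) (th : R) :
  integ (@leb3 R) (fun x : R3 mR => E_kernel l x * cos (dot3 k x + th)).
Proof.
apply: integ_le iE.
  apply: measurable_funM; first exact: integ_meas iE.
  rewrite (_ : (fun x => cos _) = (fun x => cos (dot4 (0, k) (0, x) + th))).
    apply: measurable_cosdot4; first exact: measurable_cst.
    exact: measurable_fun_pair.
  by apply/funext => x; rewrite /dot4/= mul0r add0r.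
by move=> x; rewrite normrM (ger0_norm (E_kernel_ge0 x)) ler_piMr ?E_kernel_ge0//
  cos_norm1.
Qed.

Lemma E_cos (k : R3 R) (th : R) :
  \int[@leb3 R]_x (E_kernel l x * cos (dot3 k x + th)) =
  expR (- (l ^+ 2 * dot3 k k)) * cos th.
Proof.
have iEc := integ_E_cos k th.
have := Rint_prod (m1 := @leb1 R) (m2 := @leb3 R) iT iEc.
rewrite Rint_T_kernel mul1r => <-.
transitivity (\int[@leb4 R]_x (T_kernel l x.1 * E_kernel l x.2 * cos (dot4 (0,
  k) x + th))).
  rewrite /Rintegral; congr (fine _); apply: eq_integral => x _; congr (_%:E).
  by rewrite mulrA /dot4/= mul0r add0r.
by rewrite TE_cos /dot4/= mul0r add0r.
Qed.

End Kernels.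

(** * The convolutions in time and in space *)

Section Operators.
Variable R : realType.
Local Notation mR := (measurableTypeR R).
Variable l : R.
Hypothesis l_gt0 : 0 < l.
Implicit Types (A g : R4 R -> R).

Definition tconv A := kconv (@leb1 R) (fun (z : R4 mR) (t : mR) => (t, z.2) : R4 mR)
  (fun z t => T_kernel l (z.1 - t)) A.

Definition sconv A := kconv (@leb3 R) (fun (z : R4 mR) (x : R3 mR) => (z.1,
  x) : R4 mR)
  (fun z x => E_kernel l (z.2 - x)) A.

Definition damp_t (y : R4 R) : R := expR (- (l ^+ 2 * y.1 ^+ 2)).
Definition damp_x (y : R4 R) : R := expR (- (l ^+ 2 * dot3 y.2 y.2)).

Let mfst2 : measurable_fun setT (fun p : R4 mR * mR => p.1.1).
Proof. exact: (measurableT_comp (@measurable_fst _ _ _ _) (@measurable_fst _ _ _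
  _)). Qed.

Let msnd2 dX (X : measurableType dX) : measurable_fun setT (fun p : R4 mR * X =>
  p.1.2).
Proof. exact: (measurableT_comp (@measurable_snd _ _ _ _) (@measurable_fst _ _ _
  _)). Qed.

Let mrep_t : measurable_fun setT (fun p : R4 mR * mR => (p.2, p.1.2) : R4 mR).
Proof. by apply: measurable_fun_pair; [exact: measurable_snd|exact: msnd2]. Qed.

Let mrep_x : measurable_fun setT (fun p : R4 mR * R3 mR => (p.1.1, p.2) : R4 mR).
Proof.
apply: measurable_fun_pair; last exact: measurable_snd.
exact: (measurableT_comp (@measurable_fst _ _ _ _) (@measurable_fst _ _ _ _)).
Qed.

Let msh_t : measurable_fun setT (fun p : R4 mR * mR => p.2 - p.1.1 : mR).
Proof. by apply: measurable_funB; [exact: measurable_snd|exact: mfst2]. Qed.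

Let measurable_subR3 d (T : measurableType d) (f g : T -> R3 mR) :
  measurable_fun setT f -> measurable_fun setT g ->
  measurable_fun setT (fun t => (f t : R3 R) - g t : R3 mR).
Proof.
have coord (h : T -> R3 mR) : measurable_fun setT h ->
    [/\ measurable_fun setT (fun t => (h t).1.1),
        measurable_fun setT (fun t => (h t).1.2) & measurable_fun setT (fun t =>
          (h t).2)].
  move=> mh; have mh1 := measurableT_comp (@measurable_fst _ _ _ _) mh; split.
  - exact: (measurableT_comp (@measurable_fst _ _ _ _) mh1).
  - exact: (measurableT_comp (@measurable_snd _ _ _ _) mh1).
  - exact: (measurableT_comp (@measurable_snd _ _ _ _) mh).
move=> /coord[f1 f2 f3] /coord[g1 g2 g3].
apply: (measurable_fun_pair (f := fun t => ((f t).1.1 - (g t).1.1,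
  (f t).1.2 - (g t).1.2) : mR * mR)
  (g := fun t => (f t).2 - (g t).2 : mR)); last exact: measurable_funB.
by apply: measurable_fun_pair; exact: measurable_funB.
Qed.

Let msh_x : measurable_fun setT (fun p : R4 mR * R3 mR => (p.2 : R3 R) - p.1.2 :
  R3 mR).
Proof. by apply: measurable_subR3; [exact: measurable_snd|exact: msnd2]. Qed.

Let mK_t : measurable_fun setT (fun p : R4 mR * mR => T_kernel l (p.1.1 - p.2)).
Proof.
apply: (measurableT_comp (f := T_kernel l : mR -> R)).
  by have := integ_meas (integ_T_kernel l_gt0 0); apply: eq_measurable_fun => t _;
    rewrite expr0 mul1r.
by apply: measurable_funB; [exact: mfst2|exact: measurable_snd].
Qed.

Let mK_x : measurable_fun setT (fun p : R4 mR * R3 mR => E_kernel l ((p.1.2 : R3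
  R) - p.2)).
Proof.
apply: (measurableT_comp (f := E_kernel l : R3 mR -> R)).
  by have := integ_meas (integ_E_kernel l_gt0 0); apply: eq_measurable_fun => t _;
    rewrite expr0 mul1r.
by apply: measurable_subR3; [exact: msnd2|exact: measurable_snd].
Qed.

Let sh_t (z : R4 mR) : scales (@leb1 R) (fun t : mR => t - z.1) 1.
Proof.
have := @scales1 R (- z.1) 1 ltr01; rewrite invr1.
by rewrite (_ : (fun t : mR => _) = (fun t : mR => t - z.1))//; apply/funext => t;
  rewrite mul1r addrC.
Qed.

Let sh_x (z : R4 mR) : scales (@leb3 R) (fun x : R3 mR => (x : R3 R) - z.2) 1.
Proof.
have := @scales3 R (- (z.2 : R3 R)) 1 ltr01; rewrite expr1n invr1.
rewrite (_ : (fun x : R3 R => _) = (fun x : R3 R => x - z.2))//.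
by apply/funext => x; rewrite scale1r addrC.
Qed.

Let cos_t (z : R4 mR) (y : R4 R) (th : R) :
  \int[@leb1 R]_t (T_kernel l (t - z.1) * cos (dot4 (t, z.2) y + th)) =
    damp_t y * cos (dot4 z y + th).
Proof.
(* The translation [t - z.1] centres the kernel and leaves [cos (dot4 z y + th)] as the phase at the
   centre. *)
rewrite -(T_cos l_gt0) -[RHS]mul1r -(scales_Rint (sh_t z) (integ_T_cos l_gt0 _ _)).
by apply: eq_Rint => t; congr (_ * cos _); rewrite /dot4/=; ring.
Qed.

Let cos_x (z : R4 mR) (y : R4 R) (th : R) :
  \int[@leb3 R]_x (E_kernel l ((x : R3 R) - z.2) * cos (dot4 (z.1, x) y + th)) =
    damp_x y * cos (dot4 z y + th).
Proof.
rewrite -(E_cos l_gt0) -[RHS]mul1r -(scales_Rint (sh_x z) (integ_E_cos l_gt0 _ _)).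
by apply: eq_Rint => x; congr (_ * cos _); rewrite /dot4 /dot3/=; ring.
Qed.

Let br_t (z : R4 mR) (t : mR) : br ((z : R4 R) - (t, z.2)) = 1 + (t - z.1) ^+ 2.
Proof. by rewrite /br /dot4 /dot3/=; ring. Qed.

Let br_x (z : R4 mR) (x : R3 mR) : br ((z : R4 R) - (z.1, x)) =
  1 + dot3 ((x : R3 R) - z.2) ((x : R3 R) - z.2).
Proof. by rewrite /br /dot4 /dot3/=; ring. Qed.



Lemma tconv_slow A : slowR A -> slowR (tconv A).
Proof.
exact: (conv_slow (mx := @leb1 R)
  (rep := fun (z : R4 mR) (t : mR) => (t, z.2)) (K :=
    fun z t => T_kernel l (z.1 - t))
  (pr := fun z => z.1) (sh := fun z t => t - z.1)
  (k := T_kernel l) (n :=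
    fun t => 1 + t ^+ 2) mrep_t msh_t (fun z x => esym (surjective_pairing z))
  (fun z x => erefl) (@swap_time R) sh_t mK_t (fun z x => erefl) (T_kernel_ge0
    l_gt0)
  br_t (integ_T_kernel l_gt0)).
Qed.

Lemma tconv_adjoint A g th : slowR A -> integ (@leb4 R) g -> rapid (ct g th) ->
  \int[@leb4 R]_z (tconv A z * ct g th z) =
  \int[@leb4 R]_z (A z * ct (fun y => damp_t y * g y) th z).
Proof.
exact: (conv_ct_adjoint (mx := @leb1 R)
  (rep := fun (z : R4 mR) (t : mR) => (t, z.2)) (K :=
    fun z t => T_kernel l (z.1 - t))
  (pr := fun z => z.1) (sh := fun z t => t - z.1)
  (k := T_kernel l) (n :=
    fun t => 1 + t ^+ 2) mrep_t msh_t (fun z x => esym (surjective_pairing z))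
  (fun z x => erefl) (@swap_time R) sh_t mK_t (fun z x => erefl) (T_kernel_ge0
    l_gt0)
  br_t (integ_T_kernel l_gt0) cos_t).
Qed.

Lemma sconv_slow A : slowR A -> slowR (sconv A).
Proof.
exact: (conv_slow (mx := @leb3 R)
  (rep := fun (z : R4 mR) (x : R3 mR) => (z.1, x)) (K :=
    fun z x => E_kernel l ((z.2 : R3 R) - x))
  (pr := fun z => z.2) (sh := fun z x => (x : R3 R) - z.2)
  (k := E_kernel l) (n :=
    fun x => 1 + dot3 x x) mrep_x msh_x (fun z x => esym (surjective_pairing z))
  (fun z x => erefl) (@swap_space R) sh_x mK_x (fun z x => erefl) (E_kernel_ge0
    l_gt0)
  br_x (integ_E_kernel l_gt0)).
Qed.

Lemma sconv_adjoint A g th : slowR A -> integ (@leb4 R) g -> rapid (ct g th) ->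
  \int[@leb4 R]_z (sconv A z * ct g th z) =
  \int[@leb4 R]_z (A z * ct (fun y => damp_x y * g y) th z).
Proof.
exact: (conv_ct_adjoint (mx := @leb3 R)
  (rep := fun (z : R4 mR) (x : R3 mR) => (z.1, x)) (K :=
    fun z x => E_kernel l ((z.2 : R3 R) - x))
  (pr := fun z => z.2) (sh := fun z x => (x : R3 R) - z.2)
  (k := E_kernel l) (n :=
    fun x => 1 + dot3 x x) mrep_x msh_x (fun z x => esym (surjective_pairing z))
  (fun z x => erefl) (@swap_space R) sh_x mK_x (fun z x => erefl) (E_kernel_ge0
    l_gt0)
  br_x (integ_E_kernel l_gt0) cos_x).
Qed.

Lemma damp_symbol (y : R4 R) : damp_x y * a_symbol l y = damp_t y.
Proof. by rewrite /damp_x /a_symbol mulrCA -expRD addNr expR0 mulr1. Qed.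

End Operators.

(** * Pairings with real Fourier transforms *)

Section RealPart.
Variable R : realType.
Local Notation mR := (measurableTypeR R).
Implicit Types (x y xi : R4 R) (g W A : R4 R -> R).

Lemma ct_rapid g th : schwR g -> rapid (ct g th).
Proof.
move=> Sg; split.
  exact: measurable_cont4 (@continuous_ct R g th (schwR_rapid Sg)).
move=> N; have [M HM] := nbound_exists (4 + N.*2) Sg.
by eexists => xi; exact: ct_decay HM.
Qed.

(** The bound of [ct_decay] is uniform in the phase, which here varies with [xi]; measurability
    comes from reading the integrand as the transform of a translate. *)
Lemma integ_ct_shift g th x : schwR g ->
  integ (@leb4 R) (fun xi => ct g (th - dot4 xi x) xi).
Proof.
move=> Sg; have rg := schwR_rapid Sg; have [M HM] := nbound_exists (4 + 4.*2) Sg.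
apply: integ_le (integZ (5 ^+ 4 * (M * \int[@leb4 R]_x (br x ^+ 4)^-1)) (@integ_wt
  R)).
  rewrite (_ : (fun xi => _) = ct (fun y => g (y + x)) th).
    exact: measurable_cont4 (@continuous_ct R _ th (rapid_shift x rg)).
  by apply/funext => xi; rewrite ct_shift.
by move=> xi; rewrite ler_pdivlMr ?brX_gt0// mulrC; exact: ct_decay.
Qed.

(** The product of the two cosines is half the sum of the cosines of the sum and of the difference
    of their arguments; [inversion] evaluates one at [- x] and the other at [x]. *)
Lemma ct_ct g th phi x : schwR g -> ct (ct g th) phi x =
  (2 * pi) ^+ 4 / 2 * (cos (th + phi) * g (- x) + cos (th - phi) * g x).
Proof.
move=> Sg; have rg := schwR_rapid Sg; have cg : continuous g := (Sg.1 [::]).1.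
have ig := rapid_integ rg.
have I1 := integ_ct_shift (th + phi) (- x) Sg; have I2 :=
  integ_ct_shift (th - phi) x Sg.
have E1 := inversion rg cg I1; have E2 := inversion rg cg I2.
transitivity (2^-1 * (\int[@leb4 R]_xi (ct g ((th + phi) - dot4 xi (- x)) xi +
     ct g ((th - phi) - dot4 xi x) xi))); last first.
  transitivity (2^-1 * (\int[@leb4 R]_xi ct g ((th + phi) - dot4 xi (- x)) xi +
     \int[@leb4 R]_xi ct g ((th - phi) - dot4 xi x) xi)).
    by congr (_ * _); exact: RintegralD.
  by rewrite E1 E2; field.
rewrite -(RintZ (@leb4 R)); last exact: integ_meas (integD I1 I2).
apply: eq_Rint => xi.
set c1 := (th + phi) - _; set c2 := (th - phi) - _.
have iD := integD (integ_ct c1 xi ig) (integ_ct c2 xi ig).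
have -> : ct g c1 xi + ct g c2 xi =
    \int[@leb4 R]_y (g y * cos (dot4 xi y + c1) + g y * cos (dot4 xi y + c2)).
  by rewrite RintegralD//; exact: integ_ct.
rewrite mulrC -(RintZ (@leb4 R) _ (integ_meas iD)).
rewrite -(RintZ (@leb4 R) _ (integ_meas (integ_ct th xi ig))).
rewrite /c1 /c2.
apply: eq_Rint => y.
have -> : dot4 xi (- x) = - dot4 xi x by rewrite -scaleN1r dot4Zr mulN1r.
rewrite (dot4C x xi).
set a := dot4 xi y; set b := dot4 xi x.
have -> : a + (th + phi - - b) = (a + th) + (b + phi) by ring.
have -> : a + (th - phi - b) = (a + th) - (b + phi) by ring.
by rewrite (cosD (a + th)) (cosB (a + th)); field.
Qed.

Definition pair_ct W g th := \int[@leb4 R]_x (W x * ct g th x).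

Lemma pair_ct_linear W f g (c : R) th : slowR W -> schwR f -> schwR g ->
  pair_ct W (fun x => c * f x + g x) th = c * pair_ct W f th + pair_ct W g th.
Proof.
move=> sW Sf Sg.
have iF := slowR_rapid sW (ct_rapid th Sf); have iG :=
  slowR_rapid sW (ct_rapid th Sg).
have jf := rapid_integ (schwR_rapid Sf); have jg := rapid_integ (schwR_rapid Sg).
rewrite /pair_ct -(RintZ (@leb4 R) _ (integ_meas iF)) -RintegralD//;
  last exact: integZ.
apply: eq_Rint => x; rewrite ctD ?ctZ//; last exact: integZ.
by ring.
Qed.

(** Linear in the seminorm bound [M], with a constant depending on [W] and [N] only: this becomes
    the continuity of the Fourier transform of [W]. *)
Lemma pair_ct_bound W (N : nat) g (M : R) th : measurable_fun [set: R4 mR] W ->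
  integ (@leb4 R) (fun x => (br x ^+ N)^-1 * `|W x|) ->
  schwR g -> nbound (4 + N.*2) g M ->
  `|pair_ct W g th| <= 5 ^+ N * (\int[@leb4 R]_x (br x ^+ 4)^-1) *
     (\int[@leb4 R]_x ((br x ^+ N)^-1 * `|W x|)) * M.
Proof.
move=> mW iW Sg Hg.
rewrite mulrAC -(RintZ (@leb4 R) _ (integ_meas iW)).
apply: Rint_le_norm; last exact: integZ.
  by apply: measurable_funM => //; exact: (ct_rapid th Sg).1.
move=> x; rewrite normrM mulrC mulrA ler_wpM2r//.
rewrite ler_pdivlMr ?brX_gt0// mulrC (le_trans (ct_decay th x Sg Hg))//.
by rewrite le_eqVlt; apply/orP; left; apply/eqP; ring.
Qed.

Lemma pair_tconv (l : R) A g th : 0 < l -> slowR A -> schwR g ->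
  pair_ct (tconv l A) g th = \int[@leb4 R]_z (A z * ct (fun y => damp_t l y * g y)
    th z).
Proof.
move=> l0 sA Sg; apply: tconv_adjoint => //; last exact: ct_rapid.
exact: rapid_integ (schwR_rapid Sg).
Qed.

Lemma pair_sconv (l : R) A g th : 0 < l -> slowR A -> schwR g ->
  pair_ct (sconv l A) g th = \int[@leb4 R]_z (A z * ct (fun y => damp_x l y * g y)
    th z).
Proof.
move=> l0 sA Sg; apply: sconv_adjoint => //; last exact: ct_rapid.
exact: rapid_integ (schwR_rapid Sg).
Qed.

(** Compact support of [g] keeps its product with the growing symbol a Schwartz function, so that
    both adjoint formulas apply. *)
Lemma pair_tconv_sconv (l : R) A g th : 0 < l -> slowR A -> testR g ->
  pair_ct (tconv l A) g th = pair_ct (sconv l A) (fun x => a_symbol l x * g x) th.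
Proof.
move=> l0 sA tg.
have tag := testRM (@smoothR_a_symbol R l) tg.
rewrite (pair_tconv _ l0 sA (testR_schwR tg)) (pair_sconv _ l0 sA (testR_schwR
  tag)).
have -> : (fun y => damp_t l y * g y) = (fun y => damp_x l y * (a_symbol l y * g
  y)).
  by apply/funext => y; rewrite mulrA damp_symbol.
by [].
Qed.

End RealPart.

(** * Complex-valued functions and distributions *)

Section Complex.
Variable R : realType.
Local Notation mR := (measurableTypeR R).
Local Notation Re := complex.Re.
Local Notation Im := complex.Im.
Implicit Types (x y xi : R4 R) (f h W : R4 R -> R[i]).

Lemma normc_le (z : R[i]) : normc z <= `|Re z| + `|Im z|.
Proof.
case: z => a b /=; rewrite -(@ler_pXn2r _ 2)// ?nnegrE ?sqrtr_ge0 ?addr_ge0//.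
rewrite sqr_sqrtr ?addr_ge0 ?sqr_ge0// sqrrD !real_normK ?num_real//.
by rewrite addrAC lerDl mulrn_wge0// mulr_ge0.
Qed.

Lemma normc_Re (z : R[i]) : `|Re z| <= normc z.
Proof. by case: z => a b /=; rewrite -sqrtr_sqr ler_wsqrtr// lerDl sqr_ge0. Qed.

Lemma normc_Im (z : R[i]) : `|Im z| <= normc z.
Proof. by case: z => a b /=; rewrite -sqrtr_sqr ler_wsqrtr// lerDr sqr_ge0. Qed.

Lemma normc_ge0 (z : R[i]) : 0 <= normc z.
Proof. exact: le_trans (normr_ge0 _) (normc_Re z). Qed.

Lemma measurable_normc f : measurable_fun [set: R4 mR] (fun x => Re (f x)) ->
  measurable_fun [set: R4 mR] (fun x => Im (f x)) ->
  measurable_fun [set: R4 mR] (fun x => normc (f x)).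
Proof.
move=> mr mi.
rewrite (_ : (fun x => _) = (fun x => Num.sqrt (Re (f x) ^+ 2 + Im (f x) ^+ 2)));
  last first.
  by apply/funext => x; case: (f x).
apply: (measurableT_comp (continuous_measurable_fun (@sqrt_continuous R))).
by apply: measurable_funD; apply: measurable_funX.
Qed.

Lemma slowR_common (A B : R4 R -> R) : slowR A -> slowR B -> exists N,
  integ (@leb4 R) (fun x => (br x ^+ N)^-1 * `|A x|) /\
  integ (@leb4 R) (fun x => (br x ^+ N)^-1 * `|B x|).
Proof.
have mono (N M : nat) (C : R4 R -> R) : measurable_fun [set: R4 mR] C ->
  (N <= M)%N ->
    integ (@leb4 R) (fun x => (br x ^+ N)^-1 * `|C x|) ->
    integ (@leb4 R) (fun x => (br x ^+ M)^-1 * `|C x|).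
  move=> mC NM; apply: integ_le.
    apply: measurable_funM; last exact: measurableT_comp.
    apply: measurable_cont4 => x; apply: cvgV; last exact: continuous_brX.
    by rewrite lt0r_neq0// brX_gt0.
  move=> x; rewrite ger0_norm; last by rewrite mulr_ge0// invr_ge0 ltW// brX_gt0.
  by rewrite ler_wpM2r// lef_pV2 ?posrE ?brX_gt0// br_le.
move=> [mA [N iA]] [mB [M iB]]; exists (maxn N M); split.
  by apply: mono iA => //; exact: leq_maxl.
by apply: mono iB => //; exact: leq_maxr.
Qed.

Lemma regular_slowR f : regular_tempered f ->
  slowR (fun x => Re (f x)) /\ slowR (fun x => Im (f x)).
Proof.
move=> [[mr mi _] [s [s0 fs]]].
(* A natural number above [s], hence above [s / 2]; as [br x >= 1], the weight [br ^- N] lies below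
   the given one. *)
pose N := Num.bound s.
have H (g : R4 R -> R) : measurable_fun [set: R4 mR] g -> (forall x,
  `|g x| <= normc (f x)) -> slowR g.
  move=> mg gf; split=> //; exists N; apply/integrableP; split.
    apply/measurable_EFinP; apply: measurable_funM; last exact: measurableT_comp.
    apply: measurable_cont4 => x; apply: cvgV; last exact: continuous_brX.
    by rewrite lt0r_neq0// brX_gt0.
  apply: le_lt_trans fs; apply: ge0_le_integral => //.
  - apply/measurable_EFinP; apply: measurableT_comp => //.
    apply: measurable_funM; last exact: measurableT_comp.
    apply: measurable_cont4 => x; apply: cvgV; last exact: continuous_brX.
    by rewrite lt0r_neq0// brX_gt0.
  - apply/measurable_EFinP; apply: measurable_funM; first exact: measurable_normc.
    apply: (measurableT_comp (@measurable_powR R _)).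
    exact: measurable_cont4 (@continuous_br R).
  - move=> x _ /=; rewrite lee_fin normrM normr_id mulrC.
    rewrite ger0_norm ?invr_ge0 ?(ltW (brX_gt0 _ _))//; apply: ler_pM => //.
      by rewrite invr_ge0 ltW// brX_gt0.
    rewrite -/(br x) -powR_invn ?(ltW (br_gt0 x))// ler_powR ?br_ge1//.
    rewrite mulNr lerN2 ler_pdivrMr//.
    have := ltW (archi_boundP s0); rewrite -/N => /le_trans; apply.
    by rewrite ler_peMr// ler1n.
by split; apply: H => // x; [exact: normc_Re|exact: normc_Im].
Qed.

Lemma measurable_compact (S : set (R4 R)) : compact S ->
  measurable (S : set (R4 mR)).
Proof.
move=> cS; rewrite -[S]setCK; apply: measurableC; apply: measurable_open4.
by apply: closed_openC; apply: compact_closed => //; exact: norm_hausdorff.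
Qed.

Lemma compact_br_bound (S : set (R4 R)) N : compact S ->
  exists2 C, 0 < C & forall x, S x -> br x ^+ N <= C.
Proof.
move=> cS.
have := compact_bounded (continuous_compact (continuous_subspaceT (@continuous_brX
  R N)) cS).
move=> [M [_ /(_ (`|M| + 1))]];
  rewrite (le_lt_trans (ler_norm M)) ?ltrDl// => /(_ isT) HM.
exists (`|M| + 1); first by rewrite ltr_wpDl.
by move=> x Sx; apply: (le_trans (ler_norm _)); apply: HM; exists x.
Qed.

Lemma slowR_regular f : slowR (fun x => Re (f x)) -> slowR (fun x => Im (f x)) ->
  regular_tempered f.
Proof.
move=> sr si; have [N [ir ii]] := slowR_common sr si.
have mr := sr.1; have mi := si.1.
have mn := measurable_normc mr mi.
pose G x := (br x ^+ N)^-1 * `|Re (f x)| + (br x ^+ N)^-1 * `|Im (f x)|.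
have iG : integ (@leb4 R) G by exact: integD.
have mG := integ_meas iG.
have G0 x : 0 <= G x by rewrite addr_ge0// mulr_ge0// invr_ge0 ltW// brX_gt0.
have iGlt : (\int[@leb4 R]_x (G x)%:E < +oo)%E.
  have /integrableP[_] := iG; under eq_integral => x _ do rewrite /= ger0_norm//.
  by [].
have nG x : normc (f x) <= br x ^+ N * G x.
  rewrite (le_trans (normc_le _))// /G -mulrDr mulrA divff ?mul1r//.
  by rewrite lt0r_neq0// brX_gt0.
split.
  split=> // S cS; have mS := measurable_compact cS.
  (* On a compact set [br ^+ N] is bounded, so integrability against [br ^- N] gives local
     integrability. *)
  have [C C0 HC] := compact_br_bound N cS.
  apply: (@le_lt_trans _ _ (\int[@leb4 R]_(x in S) (C * G x)%:E)%E).
    apply: ge0_le_integral => //.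
    - by move=> x _; rewrite lee_fin normc_ge0.
    - by apply/measurable_EFinP; exact: measurable_funTS.
    - by apply/measurable_EFinP; apply: measurable_funTS; exact: measurable_funM.
    - move=> x Sx; rewrite lee_fin (le_trans (nG x))// ler_wpM2r//; exact: HC.
  apply: (@le_lt_trans _ _ (\int[@leb4 R]_x (C * G x)%:E)%E).
    apply: ge0_subset_integral => //.
    - by apply/measurable_EFinP; exact: measurable_funM.
    - by move=> x _; rewrite lee_fin mulr_ge0// ltW.
  have /integrableP[_] := integZ C iG; under eq_integral => x _.
    rewrite /= ger0_norm; last by rewrite mulr_ge0// ltW.
    over.
  by [].
(* The exponent in [slow_growth] is [- s / 2]. *)
exists (2 * N%:R); split; first by rewrite mulr_ge0.
apply: le_lt_trans iGlt; apply: ge0_le_integral => //.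
- by move=> x _; rewrite lee_fin mulr_ge0 ?normc_ge0 ?powR_ge0.
- apply/measurable_EFinP; apply: measurable_funM => //.
  apply: (measurableT_comp (@measurable_powR R _)).
  exact: measurable_cont4 (@continuous_br R).
- exact/measurable_EFinP.
- move=> x _; rewrite lee_fin -/(br x) mulNr mulrAC divff// mul1r.
  by rewrite powR_invn ?(ltW (br_gt0 x))// ler_pdivrMr ?brX_gt0// mulrC.
Qed.

Lemma time_convE (l : R) f :
  (fun x => Re (time_conv (T_kernel l) f x)) = tconv l (fun x => Re (f x)) /\
  (fun x => Im (time_conv (T_kernel l) f x)) = tconv l (fun x => Im (f x)).
Proof.
split; apply/funext => x; apply: eq_Rint => t; case: (f (t, x.2)) => a b /=; ring.
Qed.

Lemma space_convE (l : R) f :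
  (fun x => Re (space_conv (E_kernel l) f x)) = sconv l (fun x => Re (f x)) /\
  (fun x => Im (space_conv (E_kernel l) f x)) = sconv l (fun x => Im (f x)).
Proof.
split; apply/funext => x; apply: eq_Rint => t; case: (f (x.1, t)) => a b /=; ring.
Qed.

Lemma schwartzP f : schwartz f <->
  schwR (fun x => Re (f x)) /\ schwR (fun x => Im (f x)).
Proof.
split=> [[[sr si] fC]|[[sr rC] [si iC]]].
  by split; split=> // n s; have [C HC] := fC n s; exists C => x;
    apply: le_trans (HC x);
    rewrite ler_wpM2l ?(ltW (brX_gt0 n x))//; [exact: (normc_Re (partialC s f x))
      |exact: (normc_Im (partialC s f x))].
split=> // n s; have [C HC] := rC n s; have [D HD] := iC n s; exists (C + D) => x.
rewrite (le_trans _ (lerD (HC x) (HD x)))// -mulrDr ler_wpM2l ?(ltW (brX_gt0 n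
  x))//.
exact: (normc_le (partialC s f x)).
Qed.

(** A [sup] dominates its set only if the set is bounded, which [nbound_exists] supplies for the
    real and imaginary parts. *)
Lemma schwartz_norm_nbound n f : schwartz f ->
  nbound n (fun x => Re (f x)) (schwartz_norm n f) /\
  nbound n (fun x => Im (f x)) (schwartz_norm n f).
Proof.
move=> Sf; have [Sr Si] := (schwartzP f).1 Sf.
have H s x : (size s <= n)%N ->
  br x ^+ n * normc (partialC s f x) <= schwartz_norm n f.
  move=> sn; apply: ub_le_sup; last by exists s, x.
  have [M HM] := nbound_exists n Sr; have [M' HM'] := nbound_exists n Si.
  exists (M + M') => _ [t [y [tn ->]]].
  rewrite (le_trans _ (lerD (HM t y tn) (HM' t y tn)))// -mulrDr.
  rewrite ler_wpM2l ?(ltW (brX_gt0 n y))//; exact: (normc_le (partialC t f y)).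
by split=> s x sn; apply: le_trans (H s x sn);
  rewrite ler_wpM2l ?(ltW (brX_gt0 n x))//;
  [exact: (normc_Re (partialC s f x))|exact: (normc_Im (partialC s f x))].
Qed.

Lemma test_functionP f : test_function f ->
  testR (fun x => Re (f x)) /\ testR (fun x => Im (f x)).
Proof.
move=> [[sr si] cf].
have f0 x : ~ closure [set x | f x != 0] x -> f x = 0.
  by move=> nx; apply/eqP; apply: contrapT => /negP fx; apply: nx;
    exact: subset_closure.
by split; split=> //; exists (closure [set x | f x != 0]); split=> // x /f0 ->.
Qed.

Lemma fourierE f xi : integ (@leb4 R) (fun x => Re (f x)) ->
  integ (@leb4 R) (fun x => Im (f x)) ->
  fourier f xi =
    (ct (fun x => Re (f x)) 0 xi - ct (fun x => Im (f x)) (pi / 2) xi) +i*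
    (ct (fun x => Im (f x)) 0 xi + ct (fun x => Re (f x)) (pi / 2) xi).
Proof.
move=> ir ii; rewrite /fourier /Cintegral; congr (_ +i* _).
  rewrite /ct -RintegralB//; [|exact: integ_ct|exact: integ_ct].
  apply: eq_Rint => x; case: (f x) => a b /=.
  by rewrite cosDpihalf addr0 cosN sinN; ring.
rewrite /ct -RintegralD//; [|exact: integ_ct|exact: integ_ct].
apply: eq_Rint => x; case: (f x) => a b /=.
by rewrite cosDpihalf addr0 cosN sinN; ring.
Qed.

Lemma inv_fourierE f x : integ (@leb4 R) (fun x => Re (f x)) ->
  integ (@leb4 R) (fun x => Im (f x)) ->
  inv_fourier f x =
    (((2 * pi) ^+ 4)^-1 * (ct (fun x => Re (f x)) 0 x + ct (fun x => Im (f x)) (pi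
      / 2) x)) +i*
    (((2 * pi) ^+ 4)^-1 * (-1 * ct (fun x => Re (f x)) (pi / 2) x + ct (fun x =>
      Im (f x)) 0 x)).
Proof.
move=> ir ii; rewrite /inv_fourier /Cintegral.
set k := (_ ^+ 4)^-1.
have -> : \int[@leb4 R]_xi Re (f xi * expi (dot4 xi x)) =
    ct (fun x => Re (f x)) 0 x + ct (fun x => Im (f x)) (pi / 2) x.
  rewrite /ct -RintegralD//; [|exact: integ_ct|exact: integ_ct].
  apply: eq_Rint => y; case: (f y) => a b /=.
  by rewrite cosDpihalf addr0 (dot4C x); ring.
have -> : \int[@leb4 R]_xi Im (f xi * expi (dot4 xi x)) =
    -1 * ct (fun x => Re (f x)) (pi / 2) x + ct (fun x => Im (f x)) 0 x.
  rewrite /ct -(RintZ (@leb4 R) _ (integ_meas (integ_ct _ _ ir))) -RintegralD//.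
  - apply: eq_Rint => y; case: (f y) => a b /=.
    by rewrite cosDpihalf addr0 (dot4C x); ring.
  - by apply: integZ; exact: integ_ct.
  - exact: integ_ct.
by apply/eqP; rewrite eq_complex /= !mul0r subr0 addr0 !eqxx.
Qed.

(** By [ct_ct] each double transform yields values at [x] and [- x]; terms with phases differing by
    [pi / 2] vanish, and the values at [- x] cancel between the others. This order of composition is
    the one that appears when two transforms of a distribution are moved to the test side. *)
Lemma fourier_inv f : schwartz f -> fourier (inv_fourier f) = f.
Proof.
move=> /schwartzP[Sr Si].
have ir := rapid_integ (schwR_rapid Sr); have ii := rapid_integ (schwR_rapid Si).
set f1 := fun x => Re (f x); set f2 := fun x => Im (f x).
pose k : R := ((2 * pi) ^+ 4)^-1.
pose u1 x := k * (ct f1 0 x + ct f2 (pi / 2) x).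
pose u2 x := k * (-1 * ct f1 (pi / 2) x + ct f2 0 x).
have E x : inv_fourier f x = u1 x +i* u2 x by rewrite inv_fourierE.
have j1 th := rapid_integ (ct_rapid th Sr); have j2 th :=
  rapid_integ (ct_rapid th Si).
have iu1 : integ (@leb4 R) u1 by apply: integZ; exact: integD.
have iu2 : integ (@leb4 R) u2 by apply: integZ; apply: integD => //; exact: integZ.
apply/funext => x; rewrite (_ : inv_fourier f = fun x => u1 x +i* u2 x);
  last exact/funext.
rewrite fourierE//=.
have k0 : (2 * pi) ^+ 4 * k = 1 by rewrite divff// expf_neq0// mulf_neq0//
  lt0r_neq0// pi_gt0.
have U1 th : ct u1 th x = k * (ct (ct f1 0) th x + ct (ct f2 (pi / 2)) th x).
  by rewrite /u1 ctZ ?ctD//; exact: integD.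
have U2 th : ct u2 th x = k * (-1 * ct (ct f1 (pi / 2)) th x + ct (ct f2 0) th x).
  by rewrite /u2 ctZ ?ctD ?ctZ//; [exact: integZ|apply: integD => //;
    exact: integZ].
rewrite !U1 !U2 !ct_ct// !addr0 !subr0 add0r sub0r subrr cos0 cosN cos_pihalf.
have -> : pi / 2 + pi / 2 = pi :> R by field.
rewrite cospi.
have -> : f x = f1 x +i* f2 x by rewrite /f1 /f2; case: (f x).
move: k0; set P := (2 * pi) ^+ 4 => k0; congr (_ +i* _).
  by transitivity (P * k * f1 x); [field|rewrite k0 mul1r].
by transitivity (P * k * f2 x); [field|rewrite k0 mul1r].
Qed.

End Complex.

(** * Fourier transform of a slowly growing density *)

Section FourierDistr.
Variable R : realType.
Local Notation Re := complex.Re.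
Local Notation Im := complex.Im.
Variable W : R4 R -> R[i].
Hypothesis sr : slowR (fun x => Re (W x)).
Hypothesis si : slowR (fun x => Im (W x)).
Implicit Types f g : R4 R -> R[i].

(** With [pair_im], the real and imaginary parts of the pairing of [W] with the Fourier transform of
    a real function [u]. *)
Definition pair_re (u : R4 R -> R) := pair_ct (fun x => Re (W x)) u 0 -
  pair_ct (fun x => Im (W x)) u (pi / 2).
Definition pair_im (u : R4 R -> R) := pair_ct (fun x => Re (W x)) u (pi / 2) +
  pair_ct (fun x => Im (W x)) u 0.

Lemma distr_fourierE f : schwR (fun x => Re (f x)) -> schwR (fun x => Im (f x)) ->
  distr W (fourier f) =
    (pair_re (fun x => Re (f x)) - pair_im (fun x => Im (f x))) +i*
    (pair_re (fun x => Im (f x)) + pair_im (fun x => Re (f x))).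
Proof.
move=> Sr Si.
have ir := rapid_integ (schwR_rapid Sr); have ii := rapid_integ (schwR_rapid Si).
have I1 th := slowR_rapid sr (ct_rapid th Sr); have I2 th :=
  slowR_rapid sr (ct_rapid th Si).
have I3 th := slowR_rapid si (ct_rapid th Sr); have I4 th :=
  slowR_rapid si (ct_rapid th Si).
rewrite /distr /Cintegral /pair_re /pair_im /pair_ct; congr (_ +i* _).
  have E := RintB (integB (I1 0) (I3 (pi / 2))) (integD (I2 (pi / 2)) (I4 0)).
  rewrite (RintB (I1 0) (I3 (pi / 2))) (RintD (I2 (pi / 2)) (I4 0)) in E.
  apply: etrans E.
  by apply: eq_Rint => x; rewrite fourierE//; case: (W x) => a b /=; ring.
have E := RintD (integB (I2 0) (I4 (pi / 2))) (integD (I1 (pi / 2)) (I3 0)).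
rewrite (RintB (I2 0) (I4 (pi / 2))) (RintD (I1 (pi / 2)) (I3 0)) in E.
apply: etrans E.
by apply: eq_Rint => x; rewrite fourierE//; case: (W x) => a b /=; ring.
Qed.

Let linear_sub (c x1 y1 x2 y2 u v : R) : u = c * x1 + y1 -> v = c * x2 + y2 ->
  u - v = c * (x1 - x2) + (y1 - y2).
Proof. by move=> -> ->; ring. Qed.

Let linear_add (c x1 y1 x2 y2 u v : R) : u = c * x1 + y1 -> v = c * x2 + y2 ->
  u + v = c * (x1 + x2) + (y1 + y2).
Proof. by move=> -> ->; ring. Qed.

Lemma pair_re_linear (c : R) (u1 u2 : R4 R -> R) : schwR u1 -> schwR u2 ->
  pair_re (fun x => c * u1 x + u2 x) = c * pair_re u1 + pair_re u2.
Proof.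
move=> S1 S2.
exact: linear_sub (pair_ct_linear c 0 sr S1 S2) (pair_ct_linear c (pi / 2) si S1
  S2).
Qed.

Lemma pair_im_linear (c : R) (u1 u2 : R4 R -> R) : schwR u1 -> schwR u2 ->
  pair_im (fun x => c * u1 x + u2 x) = c * pair_im u1 + pair_im u2.
Proof.
move=> S1 S2.
exact: linear_add (pair_ct_linear c (pi / 2) sr S1 S2) (pair_ct_linear c 0 si S1
  S2).
Qed.

Lemma schwartz_linear (a : R[i]) f g : schwartz f -> schwartz g ->
  schwartz (fun x => a * f x + g x).
Proof.
move=> /schwartzP[fr fi] /schwartzP[gr gi]; apply/schwartzP; case: a => a b; split.
  rewrite (_ : (fun x => _) = (fun x => a * Re (f x) + ((- b) * Im (f x) + Re (g
    x)))).
    by apply: schwRD; [exact: schwRZ|apply: schwRD => //; exact: schwRZ].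
  by apply/funext => x; case: (f x) (g x) => p q [r s] /=; ring.
rewrite (_ : (fun x => _) = (fun x => a * Im (f x) + (b * Re (f x) + Im (g x)))).
  by apply: schwRD; [exact: schwRZ|apply: schwRD => //; exact: schwRZ].
by apply/funext => x; case: (f x) (g x) => p q [r s] /=; ring.
Qed.

Lemma distr_fourier_linear (a : R[i]) f g : schwartz f -> schwartz g ->
  distr W (fourier (fun x => a * f x + g x)) = a * distr W (fourier f) + distr W
    (fourier g).
Proof.
move=> Sf Sg; have /schwartzP[hr hi] := schwartz_linear a Sf Sg.
move: Sf Sg => /schwartzP[fr fi] /schwartzP[gr gi].
rewrite !distr_fourierE//; case: a hr hi => a b _ _.
have -> : (fun x => Re ((a +i* b) * f x + g x)) =
    (fun x => a * Re (f x) + ((- b) * Im (f x) + Re (g x))).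
  by apply/funext => x; case: (f x) (g x) => p q [r s] /=; ring.
have -> : (fun x => Im ((a +i* b) * f x + g x)) =
    (fun x => a * Im (f x) + (b * Re (f x) + Im (g x))).
  by apply/funext => x; case: (f x) (g x) => p q [r s] /=; ring.
have S1 : schwR (fun x => (- b) * Im (f x) + Re (g x)) by apply: schwRD => //;
  exact: schwRZ.
have S2 : schwR (fun x => b * Re (f x) + Im (g x)) by apply: schwRD => //;
  exact: schwRZ.
rewrite !pair_re_linear// !pair_im_linear//.
move: (pair_re (fun x => Re (f x))) (pair_re (fun x => Im (f x)))
  (pair_re (fun x => Re (g x))) (pair_re (fun x => Im (g x)))
  (pair_im (fun x => Re (f x))) (pair_im (fun x => Im (f x)))
  (pair_im (fun x => Re (g x))) (pair_im (fun x => Im (g x))) => p1 p2 p3 p4 q1 q2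
    q3 q4.
by apply/eqP; rewrite eq_complex /=; apply/andP; split; apply/eqP; ring.
Qed.

Let norm_sum4 (p q p' q' N : R) : `|p| <= N -> `|q| <= N -> `|p'| <= N ->
  `|q'| <= N ->
  `|p - q| + `|p' + q'| <= 4 * N.
Proof. by have := ler_normB p q; have := ler_normD p' q'; lra. Qed.

Lemma tempered_fourier_distr : tempered (fourier_distr (distr W)).
Proof.
split=> [a f g|f Sf e e0]; first exact: distr_fourier_linear.
have [N [i1 i2]] := slowR_common sr si.
(* The order of seminorm at which [ct_decay] yields decay of order [N], matching the growth of
   [W]. *)
pose n := (4 + N.*2)%N.
pose K1 := 5 ^+ N * (\int[@leb4 R]_x (br x ^+ 4)^-1) *
   (\int[@leb4 R]_x ((br x ^+ N)^-1 * `|Re (W x)|)).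
pose K2 := 5 ^+ N * (\int[@leb4 R]_x (br x ^+ 4)^-1) *
   (\int[@leb4 R]_x ((br x ^+ N)^-1 * `|Im (W x)|)).
(* The 4 counts the pairings in [distr_fourierE], two in each part; the added 1 makes [K]
   positive. *)
pose K := `|4 * (K1 + K2)| + 1.
have K0 : 0 < K by rewrite ltr_wpDl.
exists n, (e / K); split; first by rewrite divr_gt0.
move=> g Sg; set D := fun x => g x - f x.
have DE : D = fun x => -1 * f x + g x by apply/funext => x; rewrite mulN1r addrC.
have SD : schwartz D by rewrite DE; exact: schwartz_linear.
have -> : fourier_distr (distr W) g - fourier_distr (distr W) f = distr W (fourier
  D).
  by rewrite DE distr_fourier_linear// mulN1r addrC.
have [Dr Di] := (schwartzP D).1 SD; have [Br Bi] := schwartz_norm_nbound n SD.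
move: Br Bi; set M := schwartz_norm n D => Br Bi.
rewrite ltr_pdivlMr// => Me.
have M0 : 0 <= M.
  by apply: le_trans (Br [::] 0 isT); rewrite mulr_ge0// ltW// brX_gt0.
have B1 u th : schwR u -> nbound n u M ->
  `|pair_ct (fun x => Re (W x)) u th| <= K1 * M.
  by move=> S' B'; exact: pair_ct_bound sr.1 i1 S' B'.
have B2 u th : schwR u -> nbound n u M ->
  `|pair_ct (fun x => Im (W x)) u th| <= K2 * M.
  by move=> S' B'; exact: pair_ct_bound si.1 i2 S' B'.
have Pr u : schwR u -> nbound n u M -> `|pair_re u| <= (K1 + K2) * M.
  move=> S' B'; rewrite mulrDl (le_trans (ler_normB _ _))// lerD//;
    [exact: B1|exact: B2].
have Pi u : schwR u -> nbound n u M -> `|pair_im u| <= (K1 + K2) * M.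
  move=> S' B'; rewrite mulrDl (le_trans (ler_normD _ _))// lerD//;
    [exact: B1|exact: B2].
apply: le_lt_trans Me; rewrite distr_fourierE//.
apply: (le_trans (normc_le _)) => /=.
apply: (@le_trans _ _ (4 * ((K1 + K2) * M))).
  exact: norm_sum4 (Pr _ Dr Br) (Pi _ Di Bi) (Pr _ Di Bi) (Pi _ Dr Br).
by rewrite mulrA [leRHS]mulrC ler_wpM2r// /K (le_trans (ler_norm _))// lerDl.
Qed.

End FourierDistr.

(** * The symbol acting on the transformed convolution *)

Section Assembly.
Variable R : realType.
Local Notation Re := complex.Re.
Local Notation Im := complex.Im.

Lemma schwartz_fourier_test (f : R4 R -> R[i]) :
  testR (fun x => Re (f x)) -> testR (fun x => Im (f x)) -> schwartz (fourier f).
Proof.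
move=> tr ti; have ir := rapid_integ (schwR_rapid (testR_schwR tr)).
have ii := rapid_integ (schwR_rapid (testR_schwR ti)).
apply/schwartzP; split.
  rewrite (_ : (fun x => _) = fun x => ct (fun x => Re (f x)) 0 x +
     (-1) * ct (fun x => Im (f x)) (pi / 2) x).
    by apply: schwRD; [|apply: schwRZ]; exact: ct_schwR.
  by apply/funext => x; rewrite fourierE//= mulN1r.
rewrite (_ : (fun x => _) = fun x => ct (fun x => Im (f x)) 0 x +
   ct (fun x => Re (f x)) (pi / 2) x).
  by apply: schwRD; exact: ct_schwR.
by apply/funext => x; rewrite fourierE.
Qed.

Lemma symbol_mulE (m : R4 R -> R) (f : R4 R -> R[i]) :
  (fun x => Re ((m x)%:C * f x)) = (fun x => m x * Re (f x)) /\
  (fun x => Im ((m x)%:C * f x)) = (fun x => m x * Im (f x)).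
Proof. by split; apply/funext => x; case: (f x) => a b /=; ring. Qed.

(** Both sides are the same combination of eight real pairings, at the phases 0 and [pi / 2], which
    [pair_tconv_sconv] matches one by one. *)
Lemma distr_conv_fourier (l : R) (f phi : R4 R -> R[i]) : 0 < l ->
  slowR (fun x => Re (f x)) -> slowR (fun x => Im (f x)) -> test_function phi ->
  distr (time_conv (T_kernel l) f) (fourier phi) =
  distr (space_conv (E_kernel l) f) (fourier (fun x => (a_symbol l x)%:C * phi x)).
Proof.
move=> l0 sr si /test_functionP[tr ti].
have [tE1 tE2] := time_convE l f; have [sE1 sE2] := space_convE l f.
have [mE1 mE2] := symbol_mulE (a_symbol l) phi.
have ar := testRM (@smoothR_a_symbol R l) tr; have ai :=
  testRM (@smoothR_a_symbol R l) ti.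
rewrite distr_fourierE; last 4 first.
- by rewrite tE1; exact: tconv_slow.
- by rewrite tE2; exact: tconv_slow.
- exact: testR_schwR.
- exact: testR_schwR.
rewrite distr_fourierE; last 4 first.
- by rewrite sE1; exact: sconv_slow.
- by rewrite sE2; exact: sconv_slow.
- by rewrite mE1; exact: testR_schwR.
- by rewrite mE2; exact: testR_schwR.
rewrite mE1 mE2 /pair_re /pair_im tE1 tE2 sE1 sE2.
have P (A g : R4 R -> R) th (sA : slowR A) (tg : testR g) :=
  pair_tconv_sconv th l0 sA tg.
by rewrite (P _ _ 0 sr tr) (P _ _ 0 sr ti) (P _ _ 0 si tr) (P _ _ 0 si ti)
  (P _ _ (pi / 2) sr tr) (P _ _ (pi / 2) sr ti) (P _ _ (pi / 2) si tr) (P _ _ (pi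
    / 2) si ti).
Qed.

End Assembly.

(** A divergent real integral has the value 0, so an equality of functionals alone would not show
    that the convolution is the density of a tempered distribution; the first conclusion records
    this. *)
Theorem proposition3p2 (R : realType) (l : R) (l_gt0 : 0 < l)
    (Phi h : 'I_4 -> 'I_4 -> R4 R -> R[i])
    (Phi_regular : forall mu nu : 'I_4, regular_tempered (Phi mu nu))
    (h_regular : forall mu nu : 'I_4, regular_tempered (h mu nu))
    (hE : forall mu nu : 'I_4,
       eq_distr (distr (h mu nu)) (distr (space_conv (E_kernel l) (Phi mu nu)))) :
  forall mu nu : 'I_4,
    regular_tempered (time_conv (T_kernel l) (Phi mu nu)) /\
    a_box_acts l (distr (h mu nu)) (distr (time_conv (T_kernel l) (Phi mu nu))).
Proof.
move=> mu nu; have [sr si] := regular_slowR (Phi_regular mu nu).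
have [tE1 tE2] := time_convE l (Phi mu nu).
have tr := tconv_slow l_gt0 sr; have ti := tconv_slow l_gt0 si.
rewrite -tE1 in tr; rewrite -tE2 in ti.
split; first exact: slowR_regular.
exists (fourier_distr (distr (time_conv (T_kernel l) (Phi mu nu)))); split.
  split; first exact: tempered_fourier_distr.
  move=> phi tphi; rewrite /fourier_distr (distr_conv_fourier l_gt0 sr si tphi)
    -hE//.
  have [pr pi] := test_functionP tphi.
  have [mE1 mE2] := symbol_mulE (a_symbol l) phi.
  apply: schwartz_fourier_test; rewrite ?mE1 ?mE2; apply: testRM => //;
    exact: smoothR_a_symbol.
move=> psi Spsi; rewrite /inv_fourier_distr /fourier_distr fourier_inv//.
Qed.
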